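(* Let $0<\alpha<1$ and let $g$ be the density of the Darling--Mandelbrot distribution of parameter $\alpha$. Let $C_0=\frac{\sin(\alpha\pi)}{\pi}=\frac{1}{\Gamma(1-\alpha)\Gamma(\alpha)}$, and let $a(x)=C_0x^{\alpha-1}\mathbf{1}_{x>0}$ and $b(x)=-C_0\frac{(x-1)^{\alpha}}{x}\mathbf{1}_{x>1}$. For $k\ge 0$ define $g_k = a * b^{*k}$ (the convolution of $a$ with $k$ copies of $b$; $g_0=a$). Then $g(x)=\sum_{k=0}^\infty g_k(x)$, where each $g_k$ is continuous for $x>0$, supported on $x>k$, and analytic on its support. Moreover, setting $\beta_k=\alpha+k(1+\alpha)$ and $C_k=\frac{1}{\Gamma(1-\alpha)\Gamma(-\alpha)^k\Gamma(\beta_k)}$, for $k<x<k+1$ one has the convergent power series representation $$g_k(x)=C_k(x-k)^{\beta_k-1}\sum_{n_1,\dots,n_k\ge 0}\frac{(1+\alpha)_{n_1}\cdots(1+\alpha)_{n_k}}{(\beta_k)_{n_1+\dots+n_k}}(k-x)^{n_1+\dots+n_k},$$ and for $x\ge k+1$, $g_k(x)$ is given by the analytic continuation of this expression.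
   Context: For $0<\alpha<1$, the Darling--Mandelbrot distribution of parameter $\alpha$ is the probability distribution on $\mathbb{R}_+$ with characteristic function $\phi_\alpha(s)=\frac{(-is)^{-\alpha}}{-\alpha\,\gamma(-\alpha,-is)}=\bigl(1-\sum_{n\ge1}\frac{\alpha}{n-\alpha}\frac{(is)^n}{n!}\bigr)^{-1}$, where $\gamma(y,z)=\int_0^z x^{y-1}e^{-x}dx$ is the lower incomplete gamma function (extended by analytic continuation); it has a density $g$. Convolution is $(u*v)(x)=\int u(y)v(x-y)\,dy$. $(y)_n=\Gamma(y+n)/\Gamma(y)$ is the Pochhammer symbol. *)

(* Defs.v *)
From mathcomp Require Import all_boot all_order all_algebra finmap.
From mathcomp Require Import complex.
From mathcomp Require Import all_classical all_reals all_analysis.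
From mathcomp.analysis.showcase Require Import summability.
Import Order.TTheory GRing.Theory Num.Theory.
Import numFieldNormedType.Exports.

Set Implicit Arguments.
Unset Strict Implicit.
Unset Printing Implicit Defensive.

Local Open Scope classical_set_scope.
Local Open Scope ring_scope.

Definition euler_integral (R : realType) (y : R) : R :=
  \int[lebesgue_measure]_(t in `]0, +oo[) (t `^ (y - 1) * expR (- t)).

(* For y <= 0 the recurrence Gamma (y + 1) = y * Gamma y is iterated until the
   argument is positive; at a pole y = 0, -1, -2, ... the product vanishes and
   the value is the junk value 0. *)
Definition Gamma (R : realType) (y : R) : R :=
  if 0 < y then euler_integral y
  else let n := (Num.truncn (- y)).+1 in
       euler_integral (y + n%:R) / \prod_(j < n) (y + j%:R).

Definition pochhammer (R : realType) (y : R) (n : nat) : R :=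
  Gamma (y + n%:R) / Gamma y.

Definition charfun (R : realType) (P : probability (measurableTypeR R) R)
    (s : R) : R[i] :=
  ((\int[P]_x cos (s * x)) +i* (\int[P]_x sin (s * x)))%C.

(* The series form of (-is)^(-a) / (- a * gamma(-a, -is)), which also makes
   sense at s = 0. The topology on R[i] is that of its modulus, carried by the
   regular module R[i]^o. *)
Definition DM_charfun (R : realType) (a s : R) : R[i] :=
  (1 - lim ((fun N => \sum_(1 <= n < N)
       ((a / (n%:R - a))%:C%C * (('i%C * s%:C%C) ^+ n / (n`!)%:R))
         : (R[i])^o) @ \oo))^-1.

Definition is_DM (R : realType) (a : R)
    (P : probability (measurableTypeR R) R) : Prop :=
  P [set x | 0 <= x] = 1%E /\ forall s, charfun P s = DM_charfun a s.

Definition is_density (R : realType) (P : probability (measurableTypeR R) R)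
    (g : R -> R) : Prop :=
  [/\ measurable_fun [set: measurableTypeR R] g,
      forall x, 0 <= g x &
      forall A : set (measurableTypeR R), measurable A ->
        P A = (\int[lebesgue_measure]_(x in A) (g x)%:E)%E].

Definition convolution (R : realType) (u v : R -> R) (x : R) : R :=
  \int[lebesgue_measure]_y (u y * v (x - y)).

Definition C0 (R : realType) (a : R) : R := sin (a * pi) / pi.

Definition afun (R : realType) (a : R) (x : R) : R :=
  if 0 < x then C0 a * x `^ (a - 1) else 0.

Definition bfun (R : realType) (a : R) (x : R) : R :=
  if 1 < x then - C0 a * ((x - 1) `^ a / x) else 0.

Definition gk (R : realType) (a : R) (k : nat) : R -> R :=
  iter k (fun u => convolution u (bfun a)) (afun a).

Definition beta_ (R : realType) (a : R) (k : nat) : R := a + k%:R * (1 + a).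

Definition C_ (R : realType) (a : R) (k : nat) : R :=
  (Gamma (1 - a) * Gamma (- a) ^+ k * Gamma (beta_ a k))^-1.

Definition gk_term (R : realType) (a : R) (k : nat) (x : R)
    (n : {ffun 'I_k -> nat}) : R :=
  (\prod_(i < k) pochhammer (1 + a) (n i))
    / pochhammer (beta_ a k) (\sum_(i < k) n i)%N
  * (k%:R - x) ^+ (\sum_(i < k) n i)%N.

(* [sum] is the limit of the sums over finite subsets of the index type, i.e.,
   the unordered sum over all k-tuples of exponents. *)
Definition gk_expr (R : realType) (a : R) (k : nat) (x : R) : R :=
  C_ a k * (x - k%:R) `^ (beta_ a k - 1) * sum (gk_term a x (k := k)).

Definition analytic_at (R : realType) (f : R -> R) (x : R) : Prop :=
  exists (c : nat -> R) (r : R), 0 < r /\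
    forall y, `|y - x| < r -> series (fun n => c n * (y - x) ^+ n) @ \oo --> f y.

Definition analytic_on (R : realType) (f : R -> R) (A : set R) : Prop :=
  forall x, A x -> analytic_at f x.

Definition analytic_continuation (R : realType) (e : R -> R) (A B : set R)
    (h : R -> R) : Prop :=
  analytic_on h B /\ forall x, A x -> h x = e x.

(* Main.v *)
(* Let L be the Laplace transform of g. The series defining the characteristic
   function phi is 1 / phi(s) = 1 - int_0^1 (e^(isy) - 1) a y^(-a-1) dy.
   Integrating the real part of phi * (1 / phi) = 1 against the Cauchy kernel
   l / (l^2 + s^2), whose Fourier transform is pi e^(-l|x|), gives
     L(l) (Gamma(1 - a) l^a + int_1^oo e^(-ly) a y^(-a-1) dy) = 1.
   Since C0 Gamma(a) l^(-a) is the Laplace transform of the function a and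
   C0 Gamma(a) l^(-a) int_1^oo e^(-ly) a y^(-a-1) dy that of -b, uniqueness of
   Laplace transforms yields the renewal equation g = a + g * b almost
   everywhere. Iterating it, g = g_0 + ... + g_(n-1) + g * b * ... * b, where the
   remainder vanishes for x <= n because b is supported on x > 1.

   Substituting y = k + t (x - k - 1) in the convolution shows that
   g_k(x) = (x - k)^(beta_k - 1) G_k(x - k), where
     G_(k+1)(w) = - C0 int_0^1 t^(beta_k - 1) (1 - t)^a
                         G_k(w t) / (1 + w (1 - t)) dt.
   The Taylor coefficients of G_k at v >= 0 satisfy the corresponding recursion,
   grow at most like rho^n for every rho > 1, uniformly in v, and at v = 0 they
   are Beta integrals, which give the stated power series. *)
Require Import Defs.
From mathcomp Require Import all_boot all_order all_algebra finmap.
From mathcomp Require Import complex.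
From mathcomp Require Import all_classical all_reals all_analysis.
From mathcomp.analysis.showcase Require Import summability.
From mathcomp Require Import measurable_realfun lebesgue_integral_under.
From mathcomp Require Import ring lra.
Import Order.TTheory GRing.Theory Num.Theory.
Import numFieldNormedType.Exports.

Set Implicit Arguments.
Unset Strict Implicit.
Unset Printing Implicit Defensive.

Local Open Scope classical_set_scope.
Local Open Scope ring_scope.

(** * Affine changes of variable and measurability *)

(** The identity phi * (1 / phi) = 1 holds on the imaginary axis, while the renewal equation is read
    off at real l > 0. Averaging against the Cauchy kernel replaces the analytic continuation
    between the two. Since g lives on the positive half-line, the Fourier transform of the kernel is
    only met at x >= 0, where e^(-l|x|) is multiplicative. The obstacle is the weight a y^(-a-1),
    which is not integrable at 0: exchanging the integrals needs a Hoelder bound |s y|^gamma with a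
    < gamma < 1, large enough for y near 0 and small enough for the tail of the kernel in s. The
    density is known only up to null sets, so its equality with the series holds almost everywhere
    and then at continuity points; convolution with the bounded function b erases null sets. The two
    expressions of C_0 rest on the reflection formula, derived here from Euler integrals and the
    partial fractions of the cotangent. For analyticity, the denominators 1 + v (1 - t) are at least
    1 when v >= 0, so the Taylor bounds survive each step of the recursion, with radius at least 1
    for all k and v. *)

(** Lebesgue measure is characterised by its values on half-open intervals, so the scaled
    pushforward only has to be computed there. *)
Lemma lebesgue_measure_affine (R : realType) (c w : R) (A : set (measurableTypeR R)) :
  0 < w -> measurable A ->
  lebesgue_measure A =
  (w%:E * pushforward lebesgue_measure ((fun t => (c + w * t)%R) : measurableTypeR R -> measurableTypeR R) A)%E.
Proof.
move=> w0 mA.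
have mphi : measurable_fun [set: measurableTypeR R]
    ((fun t => (c + w * t)%R) : measurableTypeR R -> measurableTypeR R).
  by apply: measurable_funD => //; exact: measurable_funM.
pose wn : {nonneg R} := NngNum (ltW w0).
have -> : (w%:E * pushforward lebesgue_measure ((fun t => (c + w * t)%R) : measurableTypeR R -> measurableTypeR R) A)%E
  = mscale wn (pushforward lebesgue_measure ((fun t => (c + w * t)%R) : measurableTypeR R -> measurableTypeR R)) A by [].
apply: lebesgue_measure_unique => // _ [[u v]] _ <-.
have phiE : (fun t : R => c + w * t) @^-1` `]u, v] = `](u - c) / w, (v - c) / w]%classic.
  apply/seteqP; split => t /=; rewrite !in_itv/= ltr_pdivrMr// ler_pdivlMr// ltrBlDl lerBrDl (mulrC t) //.
transitivity (w%:E * lebesgue_measure [set` `]((u - c) / w)%R, ((v - c) / w)%R] ])%E; last by rewrite -phiE.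
rewrite !lebesgue_measure_itv /= !lte_fin ltr_pM2r ?invr_gt0// ltrD2r.
case: ifPn => uv; last by rewrite mule0.
rewrite -!EFinD -EFinM; congr EFin; field; lra.
Qed.

Section affine.
Context {R : realType}.
Local Notation mu := (@lebesgue_measure R).

Lemma ge0_integral_affine (c w : R) (f : R -> \bar R) : 0 < w ->
  measurable_fun [set: R] f -> (forall x, 0 <= f x)%E ->
  (\int[mu]_x f x = w%:E * \int[mu]_x f (c + w * x)%R)%E.
Proof.
move=> w0 mf f0.
have mphi : measurable_fun [set: measurableTypeR R]
    ((fun t => (c + w * t)%R) : measurableTypeR R -> measurableTypeR R).
  by apply: measurable_funD => //; exact: measurable_funM.
pose wn : {nonneg R} := NngNum (ltW w0).
rewrite (eq_measure_integral (mscale wn (pushforward mu ((fun t => (c + w * t)%R) : measurableTypeR R -> measurableTypeR R)))); last first.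
  by move=> A mA _; exact: lebesgue_measure_affine.
rewrite ge0_integral_mscale//=.
by rewrite ge0_integral_pushforward//= preimage_setT.
Qed.

Lemma integrable_affine (c w : R) (f : R -> R) : 0 < w ->
  mu.-integrable setT (EFin \o f) ->
  mu.-integrable setT (EFin \o (fun x => f (c + w * x))).
Proof.
move=> w0 /integrableP[mf fy].
have mphi : measurable_fun [set: R] (fun t => c + w * t).
  by apply: measurable_funD => //; exact: measurable_funM.
apply/integrableP; split.
  exact: (measurableT_comp mf mphi).
move: fy; rewrite (@ge0_integral_affine c w)//; last exact: measurableT_comp.
move=> fy; rewrite ltey; apply/eqP => E; move: fy.
by rewrite [X in (_ * X)%E]E gt0_muley ?lte_fin// ltxx.
Qed.

End affine.

Section measurable_comp.
Context {R : realType} d {T : measurableType d}.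
Implicit Types (D : set T) (f : T -> R).

Lemma measurable_fun_expR D f : measurable_fun D f -> measurable_fun D (fun x => expR (f x)).
Proof. exact: (measurableT_comp (@measurable_expR R)). Qed.

Lemma measurable_fun_powR D f p : measurable_fun D f -> measurable_fun D (fun x => f x `^ p).
Proof. exact: (measurableT_comp (@measurable_powR R p)). Qed.

Lemma measurable_fun_normr D f : measurable_fun D f -> measurable_fun D (fun x => `|f x|).
Proof. exact: (measurableT_comp (@normr_measurable R setT)). Qed.

Lemma measurable_fun_sin D f : measurable_fun D f -> measurable_fun D (fun x => sin (f x)).
Proof. by apply: measurableT_comp; apply: continuous_measurable_fun; exact: continuous_sin. Qed.

Lemma measurable_fun_cos D f : measurable_fun D f -> measurable_fun D (fun x => cos (f x)).
Proof. by apply: measurableT_comp; apply: continuous_measurable_fun; exact: continuous_cos. Qed.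

Lemma measurable_fun_inv D f : measurable_fun D f -> measurable_fun D (fun x => (f x)^-1).
Proof.
apply: measurableT_comp.
(* Inversion is not continuous at 0; on each side it is an exponential of a logarithm, and the last
   branch is the convention 0^-1 = 0. *)
have -> : GRing.inv = (fun x : R => if x < 0 then - expR (- ln (- x))
                                 else if 0 < x then expR (- ln x) else 0).
  apply/funext => x; case: (ltgtP x 0) => [x0|x0|->]; last by rewrite invr0.
    by rewrite expRN lnK ?posrE ?oppr_gt0// invrN opprK.
  by rewrite expRN lnK.
by apply: measurable_fun_ifT; [exact: measurable_fun_ltr| |
   apply: measurable_fun_ifT; [exact: measurable_fun_ltr| |exact: measurable_cst]];
   [apply: measurable_funN| ];
   apply: measurableT_comp => //; apply: measurable_funN => //; exact: measurableT_comp.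
Qed.

End measurable_comp.

Ltac meas :=
  repeat (first
    [ exact: measurable_cst | exact: measurable_id | exact: measurable_fst | exact: measurable_snd
    | exact: measurable_expR | exact: measurable_ln | exact: measurable_powR | exact: normr_measurable
    | assumption
    | apply: measurable_funN
    | apply: measurable_funB
    | apply: measurable_funD
    | apply: measurable_fun_inv
    | apply: measurable_funM
    | apply: measurable_funX
    | apply: measurable_fun_ltr | apply: measurable_fun_ler | apply: measurable_and
    | apply: measurable_fun_expR
    | apply: measurable_fun_powR
    | apply: measurable_fun_normr | apply: measurable_fun_cos | apply: measurable_fun_sin
    | apply: measurable_fun_ifT ]).

(** * Improper integrals *)

Section FTC.
Context {R : realType}.
Local Notation mu := (@lebesgue_measure R).

Lemma integral_if (P : pred R) (f : R -> R) :
  (\int[mu]_x (if P x then f x else 0)%:E = \int[mu]_(x in [set x | P x]) (f x)%:E)%E.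
Proof.
rewrite [RHS]integral_mkcond; apply: eq_integral => x _; rewrite patchE.
by case: ifPn => [Px|/negP nPx]; [rewrite mem_set|rewrite memNset].
Qed.

(** Nonnegativity lets monotone convergence pass from the compact intervals to their union, so
    finiteness of the integral comes out together with its value. *)
Lemma ge0_FTC_bigcup (f F : R -> R) (u v : nat -> R) (A B : R) :
  nonincreasing_seq u -> nondecreasing_seq v -> (forall n, u n < v n) ->
  (forall n x, u n <= x <= v n -> [/\ 0 <= f x, {for x, continuous f} & is_derive x 1 F (f x)]) ->
  F (u n) @[n --> \oo] --> A -> F (v n) @[n --> \oo] --> B ->
  (\int[mu]_(x in \bigcup_n `[u n, v n]%classic) (f x)%:E = (B - A)%:E)%E.
Proof.
move=> du iv uv H FA FB.
have cf n : {within `[u n, v n], continuous f}.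
  apply: continuous_in_subspaceT => x; rewrite inE/= in_itv/= => xn.
  by have [] := H n x xn.
have : (\int[mu]_(x in `[u n, v n]) (f x)%:E)%E @[n --> \oo] -->
    (\int[mu]_(x in \bigcup_n `[u n, v n]%classic) (f x)%:E)%E.
  apply: ge0_nondecreasing_set_cvg_integral.
  - move=> m n mn; rewrite subsetEset; apply: subset_itvScc; rewrite bnd_simp.
      exact: du.
    exact: iv.
  - by move=> n; exact: measurable_itv.
  - move=> n; apply/measurable_EFinP.
    exact: subspace_continuous_measurable_fun.
  - by move=> n x /=; rewrite in_itv/= => /H[]; rewrite lee_fin.
move/cvg_lim => <- //.
- apply/cvg_lim => //.
  have -> : (fun i => \int[mu]_(x in `[u i, v i]) (f x)%:E)%E = (fun n => (F (v n) - F (u n))%:E).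
    apply/funext => n; rewrite (@continuous_FTC2 _ f F)//.
    - split.
      + move=> x; rewrite in_itv/= => /andP[x1 x2].
        by have [|_ _ dF] := H n x; [rewrite !ltW|exact: ex_derive].
      + apply: cvg_at_right_filter.
        have [|_ _ dF] := H n (u n); first by rewrite lexx ltW.
        by apply: differentiable_continuous; apply/derivable1_diffP; exact: ex_derive.
      + apply: cvg_at_left_filter.
        have [|_ _ dF] := H n (v n); first by rewrite lexx ltW.
        by apply: differentiable_continuous; apply/derivable1_diffP; exact: ex_derive.
    - move=> x; rewrite in_itv/= => /andP[x1 x2].
      by have [|_ _ dF] := H n x; [rewrite !ltW|rewrite derive1E; exact: derive_val].
  by apply: cvg_EFin; [exact: nearW|exact: cvgB].
Qed.

Lemma ge0_FTC_oo (f F : R -> R) (a b A B : R) : a < b ->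
  (forall x, a < x < b -> [/\ 0 <= f x, {for x, continuous f} & is_derive x 1 F (f x)]) ->
  F x @[x --> a^'+] --> A -> F x @[x --> b^'-] --> B ->
  (\int[mu]_(x in `]a, b[) (f x)%:E = (B - A)%:E)%E.
Proof.
move=> ab H FA FB.
(* The offset 3 keeps [d n + d n] below b - a already for n = 0, so that every interval is
   nondegenerate. *)
pose d n : R := (b - a) / (n%:R + 3).
have n3 n : 0 < (n%:R + 3 : R) by rewrite ltr_wpDl.
have d0 n : 0 < d n by rewrite divr_gt0// subr_gt0.
have d2 n : d n + d n < b - a.
  rewrite -mulrDr gtr_pMr ?subr_gt0// -mulr2n -(mulr_natr _^-1) mulrC ltr_pdivrMr//.
  by rewrite mul1r ltr_wpDl// ltr_nat.
have dd m n : (m <= n)%N -> d n <= d m.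
  by move=> mn; rewrite ler_pM2l ?subr_gt0// lef_pV2 ?posrE// lerD2r ler_nat.
have d_0 : d n @[n --> \oo] --> 0.
  rewrite -[X in _ --> X](mulr0 (b - a)); apply: cvgMr.
  apply/gtr0_cvgV0; first by apply: nearW.
  exact: (cvg_comp _ _ cvgr_idn (cvg_addrr _)).
have -> : `]a, b[%classic = \bigcup_n `[a + d n, b - d n]%classic.
  apply/seteqP; split => x.
    rewrite /= in_itv/= => /andP[ax xb].
    have : \forall n \near \oo, d n < Num.min (x - a) (b - x).
      apply: (cvgr_lt 0) => //; by rewrite lt_min !subr_gt0 ax.
    move=> [N _ /(_ N (leqnn _))]; rewrite /= lt_min => /andP[h1 h2].
    by exists N => //=; rewrite in_itv/=; apply/andP; split; lra.
  by move=> [n _ /=]; rewrite !in_itv/= => /andP[h1 h2]; have dn0 := d0 n; apply/andP; split; lra.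
apply: ge0_FTC_bigcup.
- by move=> m n mn; rewrite lerD2l dd.
- by move=> m n mn; rewrite lerB// dd.
- by move=> n; have := d2 n; lra.
- by move=> n x /andP[h1 h2]; apply: H; have dn0 := d0 n; apply/andP; split; lra.
- move/cvg_at_rightP : FA; apply; split => [n|]; first by rewrite ltrDl.
  by rewrite -[X in _ --> X](addr0 a); apply: cvgD => //; exact: cvg_cst.
- move/cvg_at_leftP : FB; apply; split => [n|]; first by rewrite gtrBl.
  by rewrite -[X in _ --> X](subr0 b); apply: cvgB => //; exact: cvg_cst.
Qed.

Lemma ge0_FTC_oy (f F : R -> R) (a A B : R) :
  (forall x, a < x -> [/\ 0 <= f x, {for x, continuous f} & is_derive x 1 F (f x)]) ->
  F x @[x --> a^'+] --> A -> F x @[x --> +oo] --> B ->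
  (\int[mu]_(x in `]a, +oo[) (f x)%:E = (B - A)%:E)%E.
Proof.
move=> H FA FB.
pose d n : R := (n%:R + 1)^-1.
have n3 n : 0 < (n%:R + 1 : R) by rewrite ltr_wpDl.
have d0 n : 0 < d n by rewrite invr_gt0.
have d1 n : d n <= 1 by rewrite invf_le1// ler_wpDl.
have dd m n : (m <= n)%N -> d n <= d m.
  by move=> mn; rewrite lef_pV2 ?posrE// lerD2r ler_nat.
have d_0 : d n @[n --> \oo] --> 0.
  apply/gtr0_cvgV0; first by apply: nearW.
  exact: (cvg_comp _ _ cvgr_idn (cvg_addrr _)).
have vy : (a + 2 + n%:R) @[n --> \oo] --> +oo.
  exact: (cvg_comp _ _ cvgr_idn (cvg_addrl _)).
have -> : `]a, +oo[%classic = \bigcup_n `[a + d n, a + 2 + n%:R]%classic.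
  apply/seteqP; split => x.
    rewrite /= in_itv/= andbT => ax.
    have h1 : \forall n \near \oo, d n < x - a.
      by apply: (cvgr_lt 0) => //; rewrite subr_gt0.
    have h2 : \forall n \near \oo, x <= a + 2 + n%:R by move/cvgryPge : vy; apply.
    have [N _ /(_ N (leqnn _))/= [g1 g2]] : \forall n \near \oo, d n < x - a /\ x <= a + 2 + n%:R.
      by apply: filterS2 h1 h2.
    by exists N => //=; rewrite in_itv/= g2 andbT; lra.
  by move=> [n _ /=]; rewrite !in_itv/= => /andP[h1 h2]; have dn0 := d0 n; apply/andP; split => //; lra.
apply: ge0_FTC_bigcup.
- by move=> m n mn; rewrite lerD2l dd.
- by move=> m n mn; rewrite lerD2l ler_nat.
- by move=> n; have := d1 n; have : 0 <= n%:R :> R by []; lra.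
- by move=> n x /andP[h1 h2]; apply: H; have dn0 := d0 n; lra.
- move/cvg_at_rightP : FA; apply; split => [n|]; first by rewrite ltrDl.
  by rewrite -[X in _ --> X](addr0 a); apply: cvgD => //; exact: cvg_cst.
- by move/cvg_pinftyP : FB; apply.
Qed.

Lemma ge0_FTC_T (f F : R -> R) (A B : R) :
  (forall x, [/\ 0 <= f x, {for x, continuous f} & is_derive x 1 F (f x)]) ->
  F x @[x --> -oo] --> A -> F x @[x --> +oo] --> B ->
  (\int[mu]_x (f x)%:E = (B - A)%:E)%E.
Proof.
move=> H FA FB.
have vy : (1 + n%:R : R) @[n --> \oo] --> +oo.
  exact: (cvg_comp _ _ cvgr_idn (cvg_addrl _)).
have -> : [set: R] = \bigcup_n `[- n%:R, 1 + n%:R]%classic.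
  apply/seteqP; split => x // _.
  have h1 : \forall n \near \oo, `|x| <= n%:R by apply: nbhs_infty_ger.
  have [N _ /(_ N (leqnn _))/=] := h1; rewrite ler_norml => /andP[g1 g2].
  by exists N => //=; rewrite in_itv/= g1/=; lra.
apply: ge0_FTC_bigcup.
- by move=> m n mn; rewrite lerN2 ler_nat.
- by move=> m n mn; rewrite lerD2l ler_nat.
- by move=> n; have : 0 <= n%:R :> R by []; lra.
- by move=> n x _; apply: H.
- by move/cvg_ninftyP : FA; apply; apply/cvgNrNy; exact: cvgr_idn.
- by move/cvg_pinftyP : FB; apply.
Qed.

End FTC.

Section power_integrals.
Context {R : realType}.
Local Notation mu := (@lebesgue_measure R).

Lemma ge0_integrable (f : R -> R) (v : R) : measurable_fun [set: R] f -> (forall x, 0 <= f x) ->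
  (\int[mu]_x (f x)%:E = v%:E)%E -> mu.-integrable setT (EFin \o f).
Proof.
move=> mf f0 fv; apply/integrableP; split; first exact/measurable_EFinP.
under eq_integral do rewrite /= ger0_norm//.
by rewrite fv ltry.
Qed.

Lemma ge0_integralM (k : R) (f : R -> R) : 0 <= k ->
  measurable_fun [set: R] f -> (forall x, 0 <= f x) ->
  (\int[mu]_x (k * f x)%:E = k%:E * \int[mu]_x (f x)%:E)%E.
Proof.
move=> k0 mf f0; under eq_integral do rewrite EFinM.
by rewrite ge0_integralZl//; [exact/measurable_EFinP|move=> x _; rewrite lee_fin].
Qed.

Lemma is_derive_powR (p x : R) : 0 < x ->
  is_derive x 1 (fun y : R => y `^ p) (p * x `^ (p - 1)).
Proof.
move=> x0; apply: DeriveDef.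
  by apply: derivable_powR; rewrite in_itv/= x0.
by rewrite -derive1E powR_derive1// in_itv/= x0.
Qed.

Lemma continuous_powR (p x : R) : 0 < x -> {for x, continuous (fun y : R => y `^ p)}.
Proof.
move=> x0; apply: differentiable_continuous; apply/derivable1_diffP.
by apply: derivable_powR; rewrite in_itv/= x0.
Qed.

Lemma cvgr_powRN (p : R) : 0 < p -> x `^ (- p) @[x --> +oo] --> (0 : R).
Proof.
move=> p0; apply/cvgr0Pnorm_lt => e e0.
near=> x.
have x0 : 0 < x by near: x; exact: nbhs_pinfty_gt.
rewrite ger0_norm ?powR_ge0//.
have -> : e = (e `^ (- p^-1)) `^ (- p) by rewrite -powRrM mulrNN mulVf ?gt_eqF// powRr1// ltW.
have ep : 0 < e `^ (- p^-1) by rewrite powR_gt0.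
have ex : e `^ (- p^-1) < x by near: x; apply: nbhs_pinfty_gt; rewrite num_real.
rewrite (powRN x) (powRN (_ `^ _)) ltf_pV2 ?posrE ?powR_gt0//.
by apply: gt0_ltr_powR; rewrite // nnegrE ltW.
Unshelve. all: by end_near. Qed.

Lemma integral_powR_0 (p b : R) : 0 < p -> 0 < b ->
  (\int[mu]_(x in `]0%R, b[) (x `^ (p - 1))%:E = (b `^ p / p)%:E)%E.
Proof.
move=> p0 b0.
rewrite (@ge0_FTC_oo _ _ (fun x => x `^ p / p) 0 b 0 (b `^ p / p))//.
- by rewrite subr0.
- move=> x /andP[x0 _]; split.
  + exact: powR_ge0.
  + exact: continuous_powR.
  + have -> : x `^ (p - 1) = p^-1 *: (p * x `^ (p - 1)).
      by rewrite /GRing.scale/= mulrA mulVf ?gt_eqF// mul1r.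
    have -> : (fun x => x `^ p / p) = p^-1 \*: (fun x => x `^ p).
      by apply/funext => y; rewrite /= mulrC.
    by apply: is_deriveZ; exact: is_derive_powR.
- rewrite -[X in _ --> X](mul0r p^-1); apply: cvgM; [exact: powR_cvg0|exact: cvg_cst].
- by apply: cvgM; [apply: cvg_at_left_filter; exact: continuous_powR|exact: cvg_cst].
Qed.

Lemma integral_powR_y (p c : R) : 0 < p -> 0 < c ->
  (\int[mu]_(x in `]c, +oo[) (x `^ (- p - 1))%:E = (c `^ (- p) / p)%:E)%E.
Proof.
move=> p0 c0.
rewrite (@ge0_FTC_oy _ _ (fun x => - (x `^ (- p) / p)) c (- (c `^ (- p) / p)) 0)//.
- by rewrite sub0r opprK.
- move=> x cx; have x0 : 0 < x by exact: lt_trans cx; split.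
  split.
  + exact: powR_ge0.
  + exact: continuous_powR.
  + have -> : x `^ (- p - 1) = (- p^-1) *: (- p * x `^ (- p - 1)).
      by rewrite /GRing.scale/= mulrA mulrNN mulVf ?gt_eqF// mul1r.
    have -> : (fun x => - (x `^ (- p) / p)) = (- p^-1) \*: (fun x => x `^ (- p)).
      by apply/funext => y; rewrite /= /GRing.scale/= mulNr mulrC.
    by apply: is_deriveZ; exact: is_derive_powR.
- by apply: cvgN; apply: cvgM; [apply: cvg_at_right_filter; exact: continuous_powR|exact: cvg_cst].
- by rewrite -oppr0 -(mul0r p^-1); apply: cvgN; apply: cvgM; [exact: cvgr_powRN|exact: cvg_cst].
Qed.

End power_integrals.

(** * The Gamma and Beta integrals *)

Section Gamma.
Context {R : realType}.
Local Notation mu := (@lebesgue_measure R).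

Lemma integral_if_oo (a b : R) (f : R -> R) :
  (\int[mu]_x (if a < x < b then f x else 0)%:E = \int[mu]_(x in `]a, b[) (f x)%:E)%E.
Proof. by rewrite set_itvoo integral_if. Qed.

Lemma integral_if_oy (a : R) (f : R -> R) :
  (\int[mu]_x (if a < x then f x else 0)%:E = \int[mu]_(x in `]a, +oo[) (f x)%:E)%E.
Proof. by rewrite set_itvoy integral_if. Qed.

(** A single term of the exponential series bounds e^t from below. *)
Lemma expRN_le_powR (N : nat) (t : R) : 0 < t -> expR (- t) <= (N.+1)`!%:R * t ^- N.+1.
Proof.
move=> t0; rewrite expRN -[leRHS]invrK lef_pV2 ?posrE ?expR_gt0 ?invr_gt0 ?mulr_gt0 ?invr_gt0 ?exprn_gt0// ?ltr0n ?fact_gt0//.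
rewrite invfM invrK (le_trans _ (expR_ge1Dxn N (ltW t0)))// [_ / _]mulrC.
by rewrite lerDr.
Qed.

(** Integrands are extended by 0 to the whole line, so that affine changes of variable and Tonelli
    apply without tracking domains. *)
Definition gamma_integrand (s l t : R) := if 0 < t then t `^ (s - 1) * expR (- (l * t)) else 0.

Lemma gamma_integrand_ge0 (s l t : R) : 0 <= gamma_integrand s l t.
Proof. by rewrite /gamma_integrand; case: ifP => // _; rewrite mulr_ge0 ?powR_ge0 ?expR_ge0. Qed.

Lemma measurable_gamma_integrand (s l : R) : measurable_fun [set: R] (gamma_integrand s l).
Proof. rewrite /gamma_integrand; meas. Qed.

Lemma gamma_integrand_lty (s : R) : 0 < s -> (\int[mu]_t (gamma_integrand s 1 t)%:E < +oo)%E.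
Proof.
(* As s < N + 1, the bound e^(-t) <= (N+2)! t^(-N-2) leaves at most (N+2)! t^(-2) for t >= 1. *)
move=> s0; pose N := Num.truncn s.
pose G1 (t : R) : R := if 0 < t < 1 then t `^ (s - 1) else 0.
(* The ray starts at 1/2 rather than 1 because it is open and has to contain t = 1. *)
pose G2 (t : R) : R := if 2^-1 < t then t `^ (- 1 - 1) else 0.
have G1_0 t : 0 <= G1 t by rewrite /G1; case: ifP => // _; exact: powR_ge0.
have G2_0 t : 0 <= G2 t by rewrite /G2; case: ifP => // _; exact: powR_ge0.
have mG1 : measurable_fun [set: R] G1 by rewrite /G1; meas.
have mG2 : measurable_fun [set: R] G2 by rewrite /G2; meas.
have h20 : (0 : R) < 2^-1 by [].
apply: (@le_lt_trans _ _ (\int[mu]_t (G1 t + N.+2`!%:R * G2 t)%:E)%E).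
  apply: ge0_le_integral => //.
  - by move=> t _; rewrite lee_fin gamma_integrand_ge0.
  - apply/measurable_EFinP; exact: measurable_gamma_integrand.
  - apply/measurable_EFinP; meas.
  - move=> t _; rewrite lee_fin /gamma_integrand mul1r; case: ifPn => [t0|]; last by rewrite addr_ge0// mulr_ge0.
    have [t1|t1] := ltP t 1.
      apply: (@le_trans _ _ (G1 t)); last by rewrite lerDl mulr_ge0.
      by rewrite /G1 t0 t1/= ler_piMr ?powR_ge0// -expR0 ler_expR oppr_le0 ltW.
    apply: (@le_trans _ _ (N.+2`!%:R * G2 t)); last by rewrite lerDr.
    rewrite /G2 ifT; last by rewrite (lt_le_trans _ t1)// invf_lt1// ltr1n.
    rewrite (le_trans (ler_wpM2l (powR_ge0 _ _) (expRN_le_powR N.+1 t0)))//.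
    rewrite mulrCA ler_wpM2l// -powR_invn ?(ltW t0)// -powRD; last by rewrite (gt_eqF t0) implybT.
    apply: ler_powR => //.
    have : s < N.+1%:R by apply: Num.Theory.truncnS_gt.
    by rewrite -(natr1 N.+1); lra.
under eq_integral do rewrite EFinD.
rewrite ge0_integralD//; last 4 first.
- by move=> t _; rewrite lee_fin.
- exact/measurable_EFinP.
- by move=> t _; rewrite lee_fin mulr_ge0.
- by apply/measurable_EFinP; meas.
rewrite ge0_integralM// /G1 integral_if_oo integral_powR_0//.
by rewrite /G2 integral_if_oy integral_powR_y// -EFinM -EFinD ltry.
Qed.

Lemma integral_gamma1 (s : R) : 0 < s -> (\int[mu]_t (gamma_integrand s 1 t)%:E = (Gamma s)%:E)%E.
Proof.
move=> s0; rewrite /Gamma s0 /euler_integral /Rintegral -integral_if_oy.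
rewrite fineK; first by apply: eq_integral => t _; rewrite /gamma_integrand mul1r.
rewrite ge0_fin_numE.
  apply: le_lt_trans (gamma_integrand_lty s0).
  by under eq_integral do rewrite -[t in expR (- t)]mul1r.
apply: integral_ge0 => t _; rewrite lee_fin; case: ifP => // _.
by rewrite mulr_ge0 ?powR_ge0 ?expR_ge0.
Qed.

Lemma integral_gamma (s l : R) : 0 < s -> 0 < l ->
  (\int[mu]_t (gamma_integrand s l t)%:E = (Gamma s * l `^ (- s))%:E)%E.
Proof.
move=> s0 l0; have := integral_gamma1 s0.
rewrite (@ge0_integral_affine _ 0 l)//; last 2 first.
- by apply/measurable_EFinP; exact: measurable_gamma_integrand.
- by move=> x; rewrite lee_fin gamma_integrand_ge0.
have lE t : gamma_integrand s 1 (0 + l * t) = l `^ (s - 1) * gamma_integrand s l t.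
  rewrite /gamma_integrand add0r pmulr_rgt0//; case: ifPn => t0; last by rewrite mulr0.
  by rewrite mul1r powRM ?ltW// mulrA.
under eq_integral do rewrite lE.
rewrite ge0_integralM ?powR_ge0//; [|exact: measurable_gamma_integrand|by move=> x; exact: gamma_integrand_ge0].
rewrite muleA -EFinM mulr_powRB1 ?(ltW l0)// => E.
have ls0 : l `^ s != 0 by rewrite gt_eqF// powR_gt0.
rewrite powRN mulrC EFinM -E muleA -EFinM mulVf// mul1e//.
Qed.

(** On ]0, 1[ the factor e^(-t) is at least e^(-1), which leaves a positive power integral. *)
Lemma Gamma_gt0 (s : R) : 0 < s -> 0 < Gamma s.
Proof.
move=> s0; rewrite -lte_fin -integral_gamma1//.
pose G1 (t : R) : R := if 0 < t < 1 then t `^ (s - 1) else 0.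
have G1_0 t : 0 <= G1 t by rewrite /G1; case: ifP => // _; exact: powR_ge0.
have mG1 : measurable_fun [set: R] G1 by rewrite /G1; meas.
apply: (@lt_le_trans _ _ (\int[mu]_t (expR (- 1) * G1 t)%:E)%E).
  rewrite ge0_integralM ?expR_ge0// /G1 integral_if_oo integral_powR_0//.
  by rewrite -EFinM lte_fin mulr_gt0 ?expR_gt0// divr_gt0// powR_gt0.
apply: ge0_le_integral => //.
- by move=> t _; rewrite lee_fin mulr_ge0 ?expR_ge0.
- by apply/measurable_EFinP; meas.
- by apply/measurable_EFinP; exact: measurable_gamma_integrand.
move=> t _; rewrite lee_fin /G1; case: ifPn => [/andP[t0 t1]|_].
  rewrite /gamma_integrand t0 mul1r mulrC ler_wpM2l ?powR_ge0// ler_expR lerN2 ltW//.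
by rewrite mulr0 gamma_integrand_ge0.
Qed.

Lemma Gamma1 : Gamma (1 : R) = 1.
Proof.
apply: EFin_inj; rewrite -integral_gamma1// integral_if_oy.
rewrite (@ge0_FTC_oy _ _ (fun x => - expR (- x)) 0 (-1) 0)//; first by rewrite sub0r opprK.
- move=> x x0; split.
  + by rewrite mulr_ge0 ?powR_ge0 ?expR_ge0.
  + apply: (@continuousM _ _ (fun y => y `^ (1 - 1)) (fun y : R => expR (- (1 * y)))).
      exact: continuous_powR.
    apply: continuous_comp; last exact: continuous_expR.
    by apply: continuousN; apply: continuousM => //; exact: cvg_cst.
  + rewrite subrr powRr0 !mul1r.
    apply: is_derive_eq; rewrite /GRing.scale/=; lra.
- rewrite -[X in _ --> - X]expR0 -[X in _ --> - expR X]oppr0.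
  apply: cvgN; apply: cvg_at_right_filter.
  apply: (@continuous_comp _ _ _ (fun x : R => - x) expR); last exact: continuous_expR.
  exact: continuousN.
- rewrite -oppr0; apply: cvgN; exact: cvgr_expR.
Qed.

End Gamma.

Section Beta.
Context {R : realType}.
Local Notation mu := (@lebesgue_measure R).

Lemma tonelli (f : R -> R -> R) :
  measurable_fun [set: R * R] (fun z => f z.1 z.2) -> (forall x y, 0 <= f x y) ->
  (\int[mu]_x \int[mu]_y (f x y)%:E = \int[mu]_y \int[mu]_x (f x y)%:E)%E.
Proof.
move=> mf f0.
apply: (fubini_tonelli (m1 := mu) (m2 := mu) (fun z => (f z.1 z.2)%:E)).
  exact/measurable_EFinP.
by move=> z; rewrite lee_fin.
Qed.

Definition beta_integrand (p q t : R) :=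
  if 0 < t < 1 then t `^ (p - 1) * (1 - t) `^ (q - 1) else 0.

Lemma beta_integrand_ge0 (p q t : R) : 0 <= beta_integrand p q t.
Proof. by rewrite /beta_integrand; case: ifP => // _; rewrite mulr_ge0 ?powR_ge0. Qed.

Lemma measurable_beta_integrand (p q : R) : measurable_fun [set: R] (beta_integrand p q).
Proof. rewrite /beta_integrand; meas. Qed.

(** The double integral of x^(p-1) (z-x)^(q-1) e^(-z) over 0 < x < z is computed in both orders:
    integrating in z first gives Gamma(p) Gamma(q), integrating in x first gives the Beta integral
    times Gamma(p+q). *)
Lemma integral_beta (p q : R) : 0 < p -> 0 < q ->
  (\int[mu]_t (beta_integrand p q t)%:E = (Gamma p * Gamma q / Gamma (p + q))%:E)%E.
Proof.
move=> p0 q0; have pq0 : 0 < p + q by exact: addr_gt0.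
pose f (x z : R) : R := if (0 < x) && (x < z) then x `^ (p - 1) * (z - x) `^ (q - 1) * expR (- z) else 0.
have f0 x z : 0 <= f x z by rewrite /f; case: ifP => // _; rewrite !mulr_ge0 ?powR_ge0 ?expR_ge0.
have mf : measurable_fun [set: R * R] (fun z => f z.1 z.2) by rewrite /f; meas.
have m2 x : measurable_fun [set: R] (f x) by rewrite /f; meas.
have m1 z : measurable_fun [set: R] (f ^~ z) by rewrite /f; meas.
have := tonelli mf f0.
have inner2 x : (\int[mu]_z (f x z)%:E = (Gamma q)%:E * (gamma_integrand p 1 x)%:E)%E.
  rewrite (@ge0_integral_affine _ x 1)// ?mul1e; last 2 first.
    exact/measurable_EFinP.
    by move=> z; rewrite lee_fin.
  have E z : f x (x + 1 * z) = gamma_integrand p 1 x * gamma_integrand q 1 z.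
    rewrite /f /gamma_integrand !mul1r ltrDl; case: ifPn => [/andP[-> ->]|].
      by rewrite addrAC subrr add0r opprD expRD; ring.
    by case: (0 < x) => /= [/negbTE ->|_]; rewrite ?mulr0 ?mul0r.
  under eq_integral do rewrite E.
  rewrite ge0_integralM ?gamma_integrand_ge0//; last 2 first.
    exact: measurable_gamma_integrand.
    by move=> z; exact: gamma_integrand_ge0.
  by rewrite integral_gamma1// muleC.
have inner1 z : (\int[mu]_x (f x z)%:E =
    \int[mu]_t (beta_integrand p q t)%:E * (gamma_integrand (p + q) 1 z)%:E)%E.
  have [z0|z0] := ltP 0 z; last first.
    rewrite /gamma_integrand ltNge z0 /= mule0 integral0_eq// => x _.
    rewrite /f ifF//; apply/negP => /andP[x0 xz].
    by move: z0; rewrite leNgt (lt_trans x0).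
  rewrite (@ge0_integral_affine _ 0 z)//; last 2 first.
    exact/measurable_EFinP.
    by move=> x; rewrite lee_fin.
  have E t : f (0 + z * t) z = z^-1 * gamma_integrand (p + q) 1 z * beta_integrand p q t.
    rewrite /f /gamma_integrand /beta_integrand z0 add0r pmulr_rgt0// gtr_pMr// mul1r.
    case: ifPn => [/andP[t0 t1]|]; last by rewrite mulr0.
    have -> : z - z * t = z * (1 - t) by ring.
    rewrite !powRM ?(ltW z0) ?(ltW t0)//; last by rewrite subr_ge0 ltW.
    have -> : z `^ (p + q - 1) = z * z `^ (p - 1) * z `^ (q - 1).
      rewrite -[X in X * _ * _](powRr1 (ltW z0)) -!powRD; last 2 first.
        by rewrite (gt_eqF z0) implybT.
        by rewrite (gt_eqF z0) implybT.
      by congr (_ `^ _); lra.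
    by field; rewrite gt_eqF.
  under eq_integral do rewrite E.
  rewrite ge0_integralM; last 3 first.
    by rewrite mulr_ge0 ?gamma_integrand_ge0// invr_ge0 ltW.
    exact: measurable_beta_integrand.
    by move=> x; exact: beta_integrand_ge0.
  by rewrite muleA -EFinM mulrA divff ?gt_eqF// mul1r muleC.
under eq_integral do rewrite inner2.
rewrite ge0_integralZl//; last 3 first.
- by apply/measurable_EFinP; exact: measurable_gamma_integrand.
- by move=> x _; rewrite lee_fin gamma_integrand_ge0.
- by rewrite lee_fin ltW// Gamma_gt0.
rewrite integral_gamma1//.
under [X in _ = X -> _]eq_integral do rewrite inner1.
rewrite ge0_integralZl//; last 3 first.
- by apply/measurable_EFinP; exact: measurable_gamma_integrand.
- by move=> x _; rewrite lee_fin gamma_integrand_ge0.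
- by apply: integral_ge0 => x _; rewrite lee_fin beta_integrand_ge0.
rewrite integral_gamma1// => E.
have Gpq := Gamma_gt0 pq0.
rewrite -[LHS]mule1 -[in LHS](divff (lt0r_neq0 Gpq)) EFinM muleA -E -!EFinM.
by congr EFin; rewrite (mulrC (Gamma q)).
Qed.

(** The Beta integral with q = 1 equals 1 / s, which gives the recurrence without an integration by
    parts. *)
Lemma GammaS (s : R) : 0 < s -> Gamma (s + 1) = s * Gamma s.
Proof.
move=> s0; have s10 : 0 < s + 1 by exact: addr_gt0.
have := integral_beta s0 (ltr01 : 0 < (1 : R)).
have -> : (\int[mu]_t (beta_integrand s 1 t)%:E = (s^-1)%:E)%E.
  have := integral_powR_0 s0 (@ltr01 R); rewrite powR1 mul1r => <-.
  rewrite -integral_if_oo; apply: eq_integral => t _; rewrite /beta_integrand.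
  by case: ifP => // _; rewrite subrr powRr0 mulr1.
move=> [] /esym; rewrite Gamma1 mulr1 => E.
have G := Gamma_gt0 s10; have G' := Gamma_gt0 s0.
have -> : Gamma s = s^-1 * Gamma (s + 1) by rewrite -E divfK// gt_eqF.
by rewrite mulrA divff ?gt_eqF// mul1r.
Qed.

End Beta.

(** * The reflection formula *)

Section reflection_integral.
Context {R : realType}.
Local Notation mu := (@lebesgue_measure R).

Let f1 (p v : R) : R := if 0 < v <= 1 then v `^ (p - 1) / (1 + v) else 0.
Let f2 (p v : R) : R := if 1 < v then v `^ (- p) / (1 + v) else 0.

Let f1_ge0 p v : 0 <= f1 p v.
Proof.
by rewrite /f1; case: ifP => // /andP[v0 _]; rewrite divr_ge0 ?powR_ge0// addr_ge0// ltW.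
Qed.

Let f2_ge0 p v : 0 <= f2 p v.
Proof.
rewrite /f2; case: ifP => // v1; rewrite divr_ge0 ?powR_ge0// addr_ge0//.
by rewrite ltW// (lt_trans _ v1).
Qed.

Let mf1 p : measurable_fun [set: R] (f1 p). Proof. rewrite /f1; meas. Qed.
Let mf2 p : measurable_fun [set: R] (f2 p). Proof. rewrite /f2; meas. Qed.

Let f1_rec (p : R) : 0 < p -> (\int[mu]_v (f1 p v)%:E + \int[mu]_v (f1 (p + 1) v)%:E = (p^-1)%:E)%E.
Proof.
move=> p0; rewrite -ge0_integralD//; last 4 first.
- by move=> v _; rewrite lee_fin.
- by apply/measurable_EFinP; first [exact: mf1|exact: mf2].
- by move=> v _; rewrite lee_fin.
- by apply/measurable_EFinP; first [exact: mf1|exact: mf2].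
have := integral_powR_0 p0 (@ltr01 R); rewrite powR1 mul1r => <-.
rewrite integral_itv_bndo_bndc; last by apply/measurable_EFinP/measurable_funTS; meas.
rewrite set_itvoc -integral_if; apply: eq_integral => v _; rewrite -EFinD /f1.
case: ifPn => [/andP[v0 v1]|]; last by rewrite addr0.
have -> : p + 1 - 1 = p by ring.
rewrite -(mulr_powRB1 (ltW v0) p0).
by congr EFin; field; lra.
Qed.

Let f2_rec (p : R) : 0 < p -> (\int[mu]_v (f2 p v)%:E + \int[mu]_v (f2 (p + 1) v)%:E = (p^-1)%:E)%E.
Proof.
move=> p0; rewrite -ge0_integralD//; last 4 first.
- by move=> v _; rewrite lee_fin.
- by apply/measurable_EFinP; first [exact: mf1|exact: mf2].
- by move=> v _; rewrite lee_fin.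
- by apply/measurable_EFinP; first [exact: mf1|exact: mf2].
have := integral_powR_y p0 (@ltr01 R); rewrite powR1 mul1r => <-.
rewrite -integral_if_oy; apply: eq_integral => v _; rewrite -EFinD /f2.
case: ifPn => [v1|]; last by rewrite addr0.
have v0 : 0 < v by exact: lt_trans v1.
rewrite (opprD p 1).
have -> : v `^ (- p) = v * v `^ (- p - 1).
  rewrite -{2}(powRr1 (ltW v0)) -powRD; last by rewrite (gt_eqF v0) implybT.
  by congr (_ `^ _); lra.
by congr EFin; field; lra.
Qed.

(* The alternating series of the 1 / (p + n), with terms paired. The integrals of
   v^(p-1) / (1+v) over ]0, 1] and of v^(-p) / (1+v) over ]1, +oo[ are both
   solutions of X p + X (p + 1) = 1 / p. *)
Definition beta_alt (p : R) (M : nat) : R := \sum_(m < M) ((p + (m.*2)%:R)^-1 - (p + (m.*2)%:R + 1)^-1).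

(** Using the equation at p + 2m and at p + 2m + 1 makes the paired sum telescope to X p - X (p +
    2M), and nonnegativity bounds the remainder by 1 / (p + 2M). *)
Lemma cvg_beta_alt (X : R -> \bar R) : (forall p, (0 <= X p)%E) ->
  (forall p : R, 0 < p -> (X p + X (p + 1)%R = (p^-1)%:E)%E) ->
  forall p : R, 0 < p -> (exists x, X p = x%:E /\ beta_alt p M @[M --> \oo] --> x).
Proof.
move=> X0 XE.
have Xfin (p : R) : 0 < p -> X p = (fine (X p))%:E.
  move=> p0; rewrite fineK// ge0_fin_numE// (@le_lt_trans _ _ (p^-1)%:E) ?ltry//.
  by rewrite -XE// leeDl.
pose x p := fine (X p).
have xE (p : R) : 0 < p -> x p + x (p + 1) = p^-1.
  move=> p0; apply: EFin_inj; rewrite EFinD -!Xfin//; first exact: XE.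
  by rewrite addr_gt0.
have x0 p : 0 <= x p by rewrite fine_ge0.
have xle (p : R) : 0 < p -> x p <= p^-1 by move=> p0; rewrite -xE// lerDl.
move=> p p0; exists (x p); split; first exact: Xfin.
have E M : beta_alt p M = x p - x (p + M.*2%:R).
  elim: M => [|M IH]; first by rewrite /beta_alt big_ord0 addr0 subrr.
  rewrite /beta_alt big_ord_recr /= -/(beta_alt p M) IH.
  have h0 : 0 < p + M.*2%:R by rewrite ltr_wpDr.
  have h1 : 0 < p + M.*2%:R + 1 by rewrite addr_gt0.
  rewrite -(xE _ h0) -(xE _ h1) doubleS -(natr1 M.*2.+1) -natr1 !addrA.
  lra.
have -> : beta_alt p = (fun M => x p - x (p + M.*2%:R)) by apply/funext.
suff : x (p + M.*2%:R) @[M --> \oo] --> 0.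
  by move=> h; have := cvgB (cvg_cst (x p)) h; rewrite subr0; apply.
apply: (@squeeze_cvgr _ _ _ _ (fun=> 0) (fun M => M%:R^-1)).
- near=> M; rewrite x0/= (le_trans (xle _ _))//; first by rewrite ltr_wpDr.
  have M0 : (0 < M)%N by near: M; exact: nbhs_infty_gt.
  rewrite lef_pV2 ?posrE ?ltr0n//; last by rewrite ltr_wpDr.
  rewrite (le_trans (_ : M%:R <= M.*2%:R))//; first by rewrite ler_nat -addnn leq_addl.
  by rewrite lerDr ltW.
- exact: cvg_cst.
- apply/gtr0_cvgV0; last exact: cvgr_idn.
  by near=> M; rewrite ltr0n; near: M; exact: nbhs_infty_gt.
Unshelve. all: by end_near. Qed.

(** The double integral of v^(-a) e^(-u(1+v)) over u, v > 0 is Gamma(1-a) Gamma(a) in one order and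
    the integral of v^(-a) / (1+v) in the other. Cut at v = 1, the latter is [f1 (1 - a)] plus
    [f2 a], whose integrals are the two alternating series. *)
Lemma GammaM_alt (a : R) : 0 < a -> a < 1 ->
  beta_alt a M + beta_alt (1 - a) M @[M --> \oo] --> Gamma (1 - a) * Gamma a.
Proof.
move=> a0 a1; have b0 : 0 < 1 - a by rewrite subr_gt0.
have F1 p : (0 <= \int[mu]_v (f1 p v)%:E)%E by apply: integral_ge0 => v _; rewrite lee_fin.
have F2 p : (0 <= \int[mu]_v (f2 p v)%:E)%E by apply: integral_ge0 => v _; rewrite lee_fin.
have [x [xE cx]] := cvg_beta_alt F1 f1_rec b0.
have [y [yE cy]] := cvg_beta_alt F2 f2_rec a0.
suff -> : Gamma (1 - a) * Gamma a = y + x by exact: cvgD.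
apply: EFin_inj; rewrite EFinD -xE -yE -ge0_integralD//; last 4 first.
- by move=> v _; rewrite lee_fin.
- by apply/measurable_EFinP; first [exact: mf1|exact: mf2].
- by move=> v _; rewrite lee_fin.
- by apply/measurable_EFinP; first [exact: mf1|exact: mf2].
pose f (u v : R) : R := if (0 < u) && (0 < v) then v `^ (- a) * expR (- (u * (1 + v))) else 0.
have f0 u v : 0 <= f u v by rewrite /f; case: ifP => // _; rewrite !mulr_ge0 ?powR_ge0 ?expR_ge0.
have mf : measurable_fun [set: R * R] (fun z => f z.1 z.2) by rewrite /f; meas.
have := tonelli mf f0.
have -> : (\int[mu]_u \int[mu]_v (f u v)%:E = (Gamma (1 - a) * Gamma a)%:E)%E.
  rewrite EFinM -(integral_gamma1 a0) -(ge0_integralM (f := gamma_integrand a 1)); first last.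
  - by move=> x'; exact: gamma_integrand_ge0.
  - exact: measurable_gamma_integrand.
  - by rewrite ltW// Gamma_gt0.
  apply: eq_integral => u _; have [u0|u0] := ltP 0 u; last first.
    rewrite integral0_eq; first by rewrite /gamma_integrand ltNge u0/= mulr0.
    by move=> v _; rewrite /f ltNge u0.
  have E v : f u v = expR (- u) * gamma_integrand (1 - a) u v.
    rewrite /f /gamma_integrand u0/=; case: ifPn => v0; last by rewrite mulr0.
    rewrite mulrDr mulr1 opprD expRD.
    have -> : 1 - a - 1 = - a by lra.
    by rewrite mulrCA.
  under eq_integral do rewrite E.
  rewrite ge0_integralM ?expR_ge0//; last 2 first.
  - exact: measurable_gamma_integrand.
  - by move=> v; exact: gamma_integrand_ge0.
  rewrite integral_gamma// /gamma_integrand u0 -EFinM; congr EFin.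
  have -> : - (1 - a) = a - 1 by lra.
  by rewrite mul1r; ring.
move=> ->; apply: eq_integral => v _; rewrite -EFinD.
have [v0|v0] := ltP 0 v; last first.
  rewrite integral0_eq; last by move=> u _; rewrite /f (ltNge _ v) v0 andbF.
  by rewrite /f1 /f2 !ltNge v0 (le_trans v0)//= addr0.
have E u : f u v = v `^ (- a) * gamma_integrand 1 (1 + v) u.
  rewrite /f /gamma_integrand v0 andbT; case: ifPn => u0; last by rewrite mulr0.
  by rewrite subrr powRr0 mul1r (mulrC u).
under eq_integral do rewrite E.
rewrite ge0_integralM ?powR_ge0//; last 2 first.
- exact: measurable_gamma_integrand.
- by move=> u; exact: gamma_integrand_ge0.
rewrite integral_gamma ?addr_gt0// Gamma1 mul1r -EFinM powR_inv1 ?addr_ge0 ?ltW//.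
rewrite /f1 /f2 v0/=; congr EFin.
have [v1|v1] := leP v 1; last by rewrite addr0.
by rewrite add0r; have -> : 1 - a - 1 = - a by ring.
Qed.

End reflection_integral.

(** * Partial fractions of the cotangent *)

Section cotangent.
Context {R : realType}.
Implicit Types (x y : R) (n N : nat).

(** Partial fractions of pi cot(pi x), with the poles -n and n + 1 paired so that the series
    converges absolutely. *)
Definition cot_term n x : R := (n%:R + x)^-1 - (n%:R + 1 - x)^-1.
Definition cot_sum N x : R := \sum_(n < N) cot_term n x.
(** A telescoping majorant with partial sums at most 1; it controls both the terms and their
    increments in x. *)
Let d n : R := n.+1%:R^-1 - n.+2%:R^-1.

Let d_ge0 n : 0 <= d n.
Proof. by rewrite subr_ge0 lef_pV2 ?posrE ?ltr0n// ler_nat. Qed.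

Let sum_d N : \sum_(n < N) d n = 1 - N.+1%:R^-1.
Proof.
elim: N => [|N IH]; first by rewrite big_ord0 invr1 subrr.
by rewrite big_ord_recr /= IH /d; ring.
Qed.

Let cvg_d : cvgn (series d).
Proof.
have -> : series d = (fun N => 1 - N.+1%:R^-1).
  by apply/funext => N; rewrite /series /= big_mkord sum_d.
apply: is_cvgB; first exact: is_cvg_cst.
by apply/cvg_ex; exists 0; exact: cvg_harmonic.
Qed.

Let inv_itv n (z : R) : n.+1%:R <= z <= n.+2%:R -> n.+2%:R^-1 <= z^-1 <= n.+1%:R^-1.
Proof.
move=> /andP[h1 h2]; have z0 : 0 < z by apply: lt_le_trans h1; rewrite ltr0n.
by rewrite !lef_pV2 ?posrE ?ltr0n// h1 h2.
Qed.

Let cot_term_le n x : 0 <= x <= 1 -> `|cot_term n.+1 x| <= d n.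
Proof.
move=> /andP[x0 x1]; rewrite /cot_term /d.
have /inv_itv/andP[a1 a2] : n.+1%:R <= n.+1%:R + x <= n.+2%:R by rewrite -(natr1 n.+1); lra.
have /inv_itv/andP[b1 b2] : n.+1%:R <= n.+1%:R + 1 - x <= n.+2%:R by rewrite -(natr1 n.+1); lra.
move: a1 a2 b1 b2; move: (n.+1%:R + x)^-1 (n.+1%:R + 1 - x)^-1 (n.+2%:R^-1) (n.+1%:R^-1) => A B C D *.
by rewrite ler_norml; apply/andP; split; lra.
Qed.

Let inv_lip n (u v : R) : n.+1%:R <= u -> n.+1%:R <= v -> `|u^-1 - v^-1| <= 2 * `|u - v| * d n.
Proof.
move=> hu hv; have n0 : 0 < n.+1%:R :> R by rewrite ltr0n.
have u0 : 0 < u by exact: lt_le_trans hu.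
have v0 : 0 < v by exact: lt_le_trans hv.
have -> : u^-1 - v^-1 = (v - u) * (u^-1 * v^-1) by field; rewrite !gt_eqF.
rewrite normrM (_ : 2 * _ * _ = `|v - u| * (2 * d n)); last by rewrite distrC; ring.
rewrite ler_wpM2l//.
rewrite ger0_norm; last by rewrite mulr_ge0// invr_ge0 ltW.
apply: (@le_trans _ _ (n.+1%:R^-1 * n.+1%:R^-1)).
  by rewrite ler_pM ?invr_ge0 ?(ltW u0) ?(ltW v0)// lef_pV2 ?posrE.
rewrite /d.
have -> : n.+1%:R^-1 - n.+2%:R^-1 = n.+1%:R^-1 * n.+2%:R^-1 :> R.
  by rewrite -(natr1 n.+1); field; rewrite !gt_eqF// addr_gt0.
rewrite mulrCA ler_wpM2l ?invr_ge0 ?(ltW n0)//.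
rewrite -[leLHS]mul1r ler_pdivrMr// mulrAC ler_pdivlMr ?ltr0n// mul1r -natrM ler_nat.
by rewrite mul2n -addnn; rewrite addSn ltnS leq_addl.
Qed.

Let cot_term_lip n x y : 0 <= x <= 1 -> 0 <= y <= 1 ->
  `|cot_term n.+1 x - cot_term n.+1 y| <= 4 * `|x - y| * d n.
Proof.
move=> /andP[x0 x1] /andP[y0 y1]; rewrite /cot_term.
have h1 := @inv_lip n (n.+1%:R + x) (n.+1%:R + y).
have h2 := @inv_lip n (n.+1%:R + 1 - x) (n.+1%:R + 1 - y).
have e1 : n.+1%:R + x - (n.+1%:R + y) = x - y by ring.
have e2 : n.+1%:R + 1 - x - (n.+1%:R + 1 - y) = y - x by ring.
rewrite e1 in h1; rewrite e2 (distrC y) in h2.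
have {}h1 := h1 (ltac:(lra)) (ltac:(lra)).
have {}h2 := h2 (ltac:(lra)) (ltac:(lra)).
rewrite (_ : _ - _ = ((n.+1%:R + x)^-1 - (n.+1%:R + y)^-1) -
  ((n.+1%:R + 1 - x)^-1 - (n.+1%:R + 1 - y)^-1)); last by ring.
apply: (le_trans (ler_normB _ _)); lra.
Qed.

(** The term n = 0, which carries the poles at 0 and 1, is split off. What remains is 4-Lipschitz on
    [0, 1] for every N, and the bound passes to the limit, which gives continuity directly. *)
Let qs N x : R := \sum_(n < N) cot_term n.+1 x.

Let cvg_qs x : 0 <= x <= 1 -> cvgn (qs ^~ x).
Proof.
move=> x01.
have -> : qs ^~ x = series (fun n => cot_term n.+1 x).
  by apply/funext => N; rewrite /series /= big_mkord.
apply: normed_cvg; apply: (series_le_cvg _ _ _ cvg_d) => n; [exact: normr_ge0|exact: d_ge0|exact: cot_term_le].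
Qed.

Let q x := limn (qs ^~ x).

Let qs_lip N x y : 0 <= x <= 1 -> 0 <= y <= 1 -> `|qs N x - qs N y| <= 4 * `|x - y|.
Proof.
move=> x01 y01; rewrite /qs -sumrB (le_trans (ler_norm_sum _ _ _))//.
apply: (@le_trans _ _ (\sum_(n < N) 4 * `|x - y| * d n)).
  by apply: ler_sum => n _; exact: cot_term_lip.
rewrite -mulr_sumr sum_d ler_piMr ?mulr_ge0//. 
Qed.

Let q_lip x y : 0 <= x <= 1 -> 0 <= y <= 1 -> `|q x - q y| <= 4 * `|x - y|.
Proof.
move=> x01 y01.
have h : `|qs N x - qs N y| @[N --> \oo] --> `|q x - q y|.
  by apply: cvg_norm; apply: cvgB; exact: cvg_qs.
rewrite -(cvg_lim _ h)//; apply: limr_le; first by apply/cvg_ex; eexists; exact: h.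
by apply: nearW => N; exact: qs_lip.
Qed.

Let q0 : q 0 = 1.
Proof.
apply/cvg_lim => //.
have -> : qs ^~ 0 = (fun N => 1 - N.+1%:R^-1).
  apply/funext => N; rewrite -sum_d /qs; apply: eq_bigr => n _.
  by rewrite /cot_term /d addr0 subr0 natr1.
rewrite -[X in _ --> X]subr0; apply: cvgB; [exact: cvg_cst|exact: cvg_harmonic].
Qed.

Definition cot_series x := x^-1 - (1 - x)^-1 + q x.

Lemma cvg_cot_sum x : 0 <= x <= 1 -> cot_sum N x @[N --> \oo] --> cot_series x.
Proof.
move=> x01; rewrite -(cvg_shiftS (fun N => cot_sum N x)).
have -> : (fun N => cot_sum N.+1 x) = (fun N => x^-1 - (1 - x)^-1 + qs N x).
  by apply/funext => N; rewrite /cot_sum big_ord_recl /cot_term /= !add0r.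
by apply: cvgD; [exact: cvg_cst|exact: cvg_qs].
Qed.

(** Doubling the denominators turns the terms n at x / 2 and at (x + 1) / 2 into twice the terms 2n
    and 2n + 1 at x, with their negative parts exchanged. *)
Lemma cot_series_dup x : 0 <= x <= 1 ->
  cot_series (x / 2) + cot_series ((x + 1) / 2) = 2 * cot_series x.
Proof.
move=> /andP[x0 x1].
have h1 := @cvg_cot_sum (x / 2) (ltac:(lra)).
have h2 := @cvg_cot_sum ((x + 1) / 2) (ltac:(lra)).
have h3 := @cvg_cot_sum x (ltac:(lra)).
have E N : cot_sum N (x / 2) + cot_sum N ((x + 1) / 2) = 2 * cot_sum N.*2 x.
  rewrite /cot_sum; elim: N => [|N IH]; first by rewrite !big_ord0 addr0 mulr0.
  rewrite doubleS !big_ord_recr /= addrACA IH 2!mulrDr -[in RHS]addrA; congr (_ + _).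
  rewrite /cot_term -(natr1 N.*2) -mul2n natrM.
  have inv2 (z : R) : 2 * z^-1 = (z / 2)^-1 by rewrite invfM invrK mulrC.
  rewrite !mulrBr !inv2.
  set A := (X in X - _ + _ = _); set B := (X in _ - X + _ = _).
  have e1 : (2 * N%:R + x) / 2 = N%:R + x / 2 by lra.
  have e2 : (2 * N%:R + 1 - x) / 2 = N%:R + 1 - (x + 1) / 2 by lra.
  have e3 : (2 * N%:R + 1 + x) / 2 = N%:R + (x + 1) / 2 by lra.
  have e4 : (2 * N%:R + 1 + 1 - x) / 2 = N%:R + 1 - x / 2 by lra.
  rewrite e1 e2 e3 e4; rewrite /A /B; ring.
have h4 : 2 * cot_sum N.*2 x @[N --> \oo] --> 2 * cot_series x.
  apply: cvgM; first exact: cvg_cst.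
  apply: (cvg_comp (fun N => N.*2) (fun N => cot_sum N x) _ h3).
  apply/cvgnyPge => A; near=> N; rewrite (@leq_trans N)//; last by rewrite -addnn leq_addr.
  by near: N; exact: nbhs_infty_ge.
have h5 : cot_sum N (x / 2) + cot_sum N ((x + 1) / 2) @[N --> \oo] -->
    cot_series (x / 2) + cot_series ((x + 1) / 2) by exact: cvgD.
rewrite (funext E) in h5.
by rewrite -(cvg_lim (@Rhausdorff R) h5) (cvg_lim (@Rhausdorff R) h4).
Unshelve. all: by end_near. Qed.

Lemma cot_series_onem x : 0 <= x <= 1 -> cot_series (1 - x) = - cot_series x.
Proof.
move=> /andP[x0 x1].
have h1 := @cvg_cot_sum (1 - x) (ltac:(lra)).
have h3 := @cvg_cot_sum x (ltac:(lra)).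
rewrite -(cvg_lim (@Rhausdorff R) h1); apply: (cvg_lim (@Rhausdorff R)).
have -> : (fun N => cot_sum N (1 - x)) = (fun N => - cot_sum N x).
  apply/funext => N; rewrite /cot_sum -sumrN; apply: eq_bigr => n _.
  by rewrite /cot_term [in RHS]opprB; congr (_^-1 - _^-1); ring.
exact: cvgN.
Qed.

(** The value q 0 = 1 cancels 1 / (1 - x) at x = 0. Of the constant 6, the part 4 is the Lipschitz
    constant of q and 2 bounds 1 / (1 - x). *)
Lemma cot_series_near0 x : 0 < x <= 2^-1 -> `|cot_series x - x^-1| <= 6 * x.
Proof.
move=> /andP[x0 x1].
have h := @q_lip x 0 (ltac:(lra)) (ltac:(lra)).
rewrite q0 subr0 (gtr0_norm x0) in h.
have -> : cot_series x - x^-1 = (q x - 1) - x * (1 - x)^-1.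
  by rewrite /cot_series; field; rewrite ?gt_eqF//; lra.
apply: (le_trans (ler_normB _ _)).
suff : `|x / (1 - x)| <= 2 * x by lra.
have x10 : 0 < 1 - x by lra.
rewrite ger0_norm; last by rewrite divr_ge0 ?ltW.
rewrite ler_pdivrMr//; nra.
Qed.

Lemma continuous_cot_series x : 0 < x < 1 -> {for x, continuous cot_series}.
Proof.
move=> /andP[x0 x1].
apply: continuousD; last first.
  apply/cvgrPdist_le => e e0; near=> y.
  have y01 : 0 <= y <= 1.
    apply/andP; split; rewrite ltW//; near: y.
      exact: lt_nbhsr.
    exact: lt_nbhsl.
  rewrite (le_trans (q_lip _ y01))//; first by rewrite !ltW.
  rewrite mulrC -ler_pdivlMr//.
  by near: y; apply: cvgr_dist_le => //; rewrite divr_gt0.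
apply: continuousB.
  by apply: inv_continuous; rewrite gt_eqF.
apply: (@continuous_comp _ _ _ (fun y : R => 1 - y) GRing.inv).
  by apply: continuousB => //; exact: cst_continuous.
by apply: inv_continuous; rewrite gt_eqF// subr_gt0.
Unshelve. all: by end_near. Qed.

End cotangent.

(** * The Herglotz comparison and Euler's reflection formula *)

Section reflection.
Context {R : realType}.
Implicit Types (x : R).

Definition cotpi x : R := pi * cos (pi * x) / sin (pi * x).

Lemma sin_pi_gt0 x : 0 < x < 1 -> 0 < sin (pi * x).
Proof.
move=> /andP[x0 x1]; apply: sin_gt0_pi; rewrite mulr_gt0 ?pi_gt0//=.
by rewrite gtr_pMr// pi_gt0.
Qed.

Lemma cotpi_onem x : cotpi (1 - x) = - cotpi x.
Proof.
rewrite /cotpi mulrBr mulr1 cosB sinB cospi sinpi.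
by rewrite !mul0r !mulN1r addr0 sub0r opprK mulrN mulNr.
Qed.

Lemma cotpi_dup x : 0 < x < 1 -> cotpi (x / 2) + cotpi ((x + 1) / 2) = 2 * cotpi x.
Proof.
move=> /andP[x0 x1].
have s0 := @sin_pi_gt0 (x / 2) (ltac:(lra)).
have s1 := @sin_pi_gt0 ((x + 1) / 2) (ltac:(lra)).
have e1 : pi * ((x + 1) / 2) = pi * (x / 2) + pi / 2 by rewrite -mulrDr; congr (_ * _); lra.
have e2 : pi * x = pi * (x / 2) *+ 2 by rewrite mulr2n -mulrDr; congr (_ * _); lra.
rewrite e1 in s1.
rewrite /cotpi e1 e2 cosDpihalf sinDpihalf cos_mulr2n sin_mulr2n.
rewrite sinDpihalf in s1.
move: s0 s1; set c := cos _; set s := sin _ => s0 s1.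
have cs : c ^+ 2 + s ^+ 2 = 1 by rewrite cos2Dsin2.
have -> : c ^+ 2 *+ 2 - 1 = c ^+ 2 - s ^+ 2 by rewrite -cs; ring.
by field; rewrite !gt_eqF.
Qed.

Lemma continuous_cotpi x : 0 < x < 1 -> {for x, continuous cotpi}.
Proof.
move=> x01; have s0 := sin_pi_gt0 x01.
have cpi : {for x, continuous (fun y : R => pi * y)}.
  by apply: continuousM => //; exact: cst_continuous.
apply: continuousM.
  apply: continuousM; first exact: cst_continuous.
  by apply: (@continuous_comp _ _ _ (fun y : R => pi * y) cos) => //; exact: continuous_cos.
apply: (@continuous_comp _ _ _ (fun y : R => sin (pi * y)) GRing.inv).
  by apply: (@continuous_comp _ _ _ (fun y : R => pi * y) sin) => //; exact: continuous_sin.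
by apply: inv_continuous; rewrite gt_eqF.
Qed.

(** With t = pi x the difference is - pi (sin t - t cos t) / (t sin t). The derivative of the
    numerator is t sin t, so the mean value theorem turns the numerator into c sin(c) t with 0 < c <
    t; as t < pi / 2, both c and sin c are at most their values at t. *)
Lemma cotpi_near0 x : 0 < x < 2^-1 -> `|cotpi x - x^-1| <= pi ^+ 2 * x.
Proof.
move=> /andP[x0 x1]; have pi0 := pi_gt0 R.
pose t := pi * x; have t0 : 0 < t by rewrite mulr_gt0.
have tpi : t < pi / 2 by rewrite /t ltr_pM2l.
have s0 : 0 < sin t by apply: sin_pi_gt0; lra.
have [c /[!in_itv]/=/andP[c0 ct] E] : exists2 c, c \in `]0, t[ &
   (sin t - t * cos t) - (sin 0 - 0 * cos 0) = c * sin c * (t - 0).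
  apply: (@MVT _ (fun t => sin t - t * cos t) (fun t => t * sin t)) => //.
    move=> y _; apply: is_derive_eq; rewrite /GRing.scale/=; ring.
  apply: continuous_subspaceT => y.
  apply: cvgB; first exact: continuous_sin.
  by apply: cvgM => //; exact: continuous_cos.
rewrite sin0 mul0r !subr0 in E.
have sc : 0 < sin c <= sin t.
  apply/andP; split; first by apply: sin_gt0_pi; rewrite c0/=; lra.
  by rewrite ltW// ltr_sin// in_itv/=; lra.
have -> : cotpi x - x^-1 = - pi * ((sin t - t * cos t) / (t * sin t)).
  have aux (p c' s : R) : p != 0 -> s != 0 ->
      p * c' / s - x^-1 = - p * ((s - p * x * c') / (p * x * s)).
    by move=> p_neq0 s_neq0; field; rewrite p_neq0 s_neq0 gt_eqF.
  by rewrite /cotpi /t; apply: aux; rewrite gt_eqF.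
have -> : pi ^+ 2 * x = pi * t by rewrite /t; ring.
have [/andP[sc0 sct] tne] := (sc, lt0r_neq0 t0).
rewrite normrM normrN (gtr0_norm pi0) ler_pM2l// E ger0_norm; last first.
  by rewrite divr_ge0 ?mulr_ge0 ?ltW.
rewrite ler_pdivrMr; last exact: mulr_gt0.
have -> : c * sin c * t = t * (c * sin c) by ring.
by rewrite ler_pM2l//; apply: ler_pM; [exact: ltW|exact: ltW|exact: ltW|exact: sct].
Qed.

(* Herglotz trick: the difference H of the two cotangents is continuous on
   [0, 1], odd about 1/2 and satisfies 2 H x = H (x / 2) + H ((x + 1) / 2), so
   its maximum is also taken at x / 2 ^ n for all n, hence is H 0 = 0. *)
Let h x := cot_series x - cotpi x.
Let H x := if 0 < x < 1 then h x else 0.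

Let h_near0 x : 0 < x < 2^-1 -> `|h x| <= (6 + pi ^+ 2) * x.
Proof.
move=> /andP[x0 x1].
have h1 := @cot_series_near0 _ x (ltac:(lra)).
have h2 := @cotpi_near0 x (ltac:(lra)).
have -> : h x = (cot_series x - x^-1) - (cotpi x - x^-1) by rewrite /h; ring.
by rewrite (le_trans (ler_normB _ _))// mulrDl lerD.
Qed.

Let H_onem x : H (1 - x) = - H x.
Proof.
rewrite /H; have [/andP[x0 x1]|x01] := boolP (0 < x < 1).
  rewrite ifT; last by lra.
  rewrite /h cot_series_onem ?cotpi_onem; last by rewrite !ltW.
  by rewrite opprB opprK addrC.
rewrite ifF ?oppr0//; apply/negbTE; apply: contra x01; lra.
Qed.

Let H_dup x : 0 < x < 1 -> 2 * H x = H (x / 2) + H ((x + 1) / 2).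
Proof.
move=> x01; have /andP[x0 x1] := x01.
rewrite /H x01 !ifT; [|lra|lra].
have := cotpi_dup x01; have := @cot_series_dup _ x (ltac:(lra)); rewrite /h.
by move=> E1 E2; lra.
Qed.

Let H_cvg0 : H x @[x --> 0^'+] --> 0.
Proof.
apply: (@squeeze_cvgr _ _ _ _ (fun x => - ((6 + pi ^+ 2) * x)) (fun x => (6 + pi ^+ 2) * x)).
- near=> x.
  have x0 : 0 < x by [].
  have x1 : x < 2^-1 by near: x; apply: nbhs_right_lt.
  by rewrite -ler_norml /H ifT ?h_near0 ?x0//; lra.
- rewrite -[X in _ --> X]oppr0 -[X in _ --> - X](mulr0 (6 + pi ^+ 2)).
  apply: cvgN; apply: cvgM; first exact: cvg_cst.
  exact: (cvg_at_right_filter (f := id)).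
- rewrite -[X in _ --> X](mulr0 (6 + pi ^+ 2)).
  apply: cvgM; first exact: cvg_cst.
  exact: (cvg_at_right_filter (f := id)).
Unshelve. all: by end_near. Qed.

Let H_continuous : {within `[0, 1], continuous H}.
Proof.
apply/(continuous_within_itvP _ ltr01); split.
- move=> x; rewrite in_itv/= => x01; have /andP[x0 x1] := x01.
  have : {for x, continuous h}.
    by apply: continuousB; [exact: continuous_cot_series|exact: continuous_cotpi].
  rewrite /prop_for /continuous_at {2}/H x01; apply: cvg_trans.
  apply: near_eq_cvg; near=> y; rewrite /H ifT//.
  apply/andP; split; near: y.
    exact: lt_nbhsr.
  exact: lt_nbhsl.
- by rewrite {2}/H ltxx/=.
- rewrite {2}/H ltxx andbF.
  (* Oddness about 1/2 carries the limit at 0 over to the endpoint 1. *)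
  have -> : H = (fun x => - H (1 - x)) by apply/funext => x; rewrite H_onem opprK.
  rewrite -oppr0; apply: cvgN.
  apply: (@cvg_comp _ _ _ (fun x => 1 - x) H _ (0^'+)) => //.
  move=> A /= [e e0 Ae]; exists e => //= y /= ye y1; apply: Ae => /=; last by rewrite subr_gt0.
  by rewrite sub0r opprB; rewrite distrC in ye.
Unshelve. all: by end_near. Qed.

Let H_le0 x : 0 <= x <= 1 -> H x <= 0.
Proof.
move=> x01.
have [c c01 Hc] := EVT_max (@ler01 R) H_continuous.
have {}Hc y : 0 <= y <= 1 -> H y <= H c by move=> y01; apply: Hc; rewrite in_itv/=.
apply: (le_trans (Hc _ x01)); rewrite leNgt; apply/negP => Hc0.
have c0 : 0 < c < 1 by move: Hc0; rewrite /H; case: ifP => //; rewrite ltxx.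
have {c01}/andP[c0' c1'] := c0.
have Hn n : 0 < c / 2 ^+ n < 1 /\ H (c / 2 ^+ n) = H c.
  elim: n => [|n [/andP[IH1 IH2] IH]]; first by rewrite expr0 divr1.
  rewrite exprS invfM mulrCA mulrC.
  move: IH1 IH2 IH; set y := c / _ => IH1 IH2 IH; split; first lra.
  have E1 := @H_dup y (ltac:(lra)); have E2 := @Hc (y / 2) (ltac:(lra)).
  have E3 := @Hc ((y + 1) / 2) (ltac:(lra)); rewrite IH in E1; lra.
have : H (c / 2 ^+ n) @[n --> \oo] --> 0.
  move/cvg_at_rightP : H_cvg0; apply; split.
    by move=> n; have [/andP[]] := Hn n.
  rewrite -[X in _ --> X](mulr0 c); apply: cvgM; first exact: cvg_cst.
  under eq_fun do rewrite -exprVn.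
  by apply: cvg_expr; rewrite ger0_norm// invf_lt1// ltr1n.
rewrite (_ : (fun n => H (c / 2 ^+ n)) = (fun=> H c)); last by apply/funext => n; rewrite (Hn n).2.
move/(cvg_lim (@Rhausdorff R)); rewrite lim_cst// => E.
by rewrite E ltxx in Hc0.
Qed.

(** The bound H <= 0 at x and, through oddness, at 1 - x gives both inequalities. *)
Lemma cot_seriesE x : 0 < x < 1 -> cot_series x = cotpi x.
Proof.
move=> x01; have /andP[x0 x1] := x01.
have h1 := @H_le0 x (ltac:(lra)).
have := @H_le0 (1 - x) (ltac:(lra)); rewrite H_onem => h2.
have : H x = 0 by lra.
by rewrite /H x01 /h; lra.
Qed.

(** The alternating series of [GammaM_alt] is half the difference of the partial fractions at a / 2
    and (a + 1) / 2. With u = pi a / 2 this is pi (cot u + tan u) / 2 = pi / sin(2u). *)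
Lemma Gamma_reflection (a : R) : 0 < a -> a < 1 ->
  Gamma (1 - a) * Gamma a = pi / sin (a * pi).
Proof.
move=> a0 a1.
have G := GammaM_alt a0 a1.
have h1 := @cvg_cot_sum _ (a / 2) (ltac:(lra)).
have h2 := @cvg_cot_sum _ ((a + 1) / 2) (ltac:(lra)).
have E M : beta_alt a M + beta_alt (1 - a) M = 2^-1 * (cot_sum M (a / 2) - cot_sum M ((a + 1) / 2)).
  rewrite /beta_alt /cot_sum -big_split/= -sumrB mulr_sumr; apply: eq_bigr => m _.
  rewrite /cot_term -mul2n natrM.
  have inv2 (z : R) : 2^-1 * z^-1 = (2 * z)^-1 by rewrite invfM.
  rewrite !mulrBr !inv2.
  have -> : 2 * (m%:R + a / 2) = a + 2 * m%:R by lra.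
  have -> : 2 * (m%:R + 1 - a / 2) = 1 - a + 2 * m%:R + 1 by lra.
  have -> : 2 * (m%:R + (a + 1) / 2) = a + 2 * m%:R + 1 by lra.
  have -> : 2 * (m%:R + 1 - (a + 1) / 2) = 1 - a + 2 * m%:R by lra.
  ring.
have h3 : 2^-1 * (cot_sum M (a / 2) - cot_sum M ((a + 1) / 2)) @[M --> \oo] -->
   2^-1 * (cot_series (a / 2) - cot_series ((a + 1) / 2)).
  by apply: cvgM; [exact: cvg_cst|exact: cvgB].
rewrite (funext E) in G.
rewrite -(cvg_lim (@Rhausdorff R) G) (cvg_lim (@Rhausdorff R) h3).
rewrite !cot_seriesE; [|lra|lra].
have s0 := @sin_pi_gt0 (a / 2) (ltac:(lra)).
have s1 := @sin_pi_gt0 ((a + 1) / 2) (ltac:(lra)).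
have e1 : pi * ((a + 1) / 2) = pi * (a / 2) + pi / 2 by rewrite -mulrDr; congr (_ * _); lra.
have e2 : a * pi = pi * (a / 2) *+ 2 by rewrite mulr2n -mulrDr mulrC; congr (_ * _); lra.
rewrite /cotpi e2; rewrite e1 sinDpihalf in s1; rewrite e1 cosDpihalf sinDpihalf sin_mulr2n.
move: s0 s1; set c := cos _; set s := sin _ => s0 s1.
have cs : c ^+ 2 + s ^+ 2 = 1 by rewrite cos2Dsin2.
rewrite (_ : 2^-1 * _ = pi * (c ^+ 2 + s ^+ 2) / ((c * s) *+ 2)).
  by rewrite cs mulr1.
by field; rewrite !gt_eqF.
Qed.

Lemma C0E (a : R) : 0 < a -> a < 1 -> C0 a = (Gamma (1 - a) * Gamma a)^-1.
Proof. by move=> a0 a1; rewrite Gamma_reflection// invfM invrK mulrC. Qed.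

End reflection.

(** * Uniqueness of Laplace transforms *)

Section laplace_uniqueness.
Context {R : realType}.
Local Notation mu := (@lebesgue_measure R).

(** The bound on k is only asked where f is nonzero, which admits multipliers such as e^(-n x) that
    are bounded on the support alone. *)
Lemma integrableM_bounded (k f : R -> R) (M : R) : measurable_fun [set: R] k ->
  mu.-integrable setT (EFin \o f) -> (forall x, f x != 0 -> `|k x| <= M) ->
  mu.-integrable setT (EFin \o (fun x => k x * f x)).
Proof.
move=> mk fi kM; have mf : measurable_fun [set: R] f by apply/measurable_EFinP; exact: measurable_int fi.
apply: (@le_integrable _ _ _ mu setT measurableT _ (fun x => (M * `|f x|)%:E)).
- by apply/measurable_EFinP; meas.
- move=> x _ /=; rewrite lee_fin normrM.
  have [->|f0] := eqVneq (f x) 0; first by rewrite normr0 !mulr0 normr0.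
  rewrite normrM normr_id ler_wpM2r// (le_trans (kM _ f0))// ler_norm//.
- rewrite (_ : (fun x => _) = (fun x => M%:E * (`|f x|)%:E)%E)//.
  by apply: integrableZl => //; exact: integrable_norm.
Qed.

Lemma cvg_expRN_natr (d : R) : 0 < d -> expR (- (m%:R * d)) @[m --> \oo] --> 0.
Proof.
move=> d0.
have h : expR (- (r * d)) @[r --> +oo] --> (0 : R).
  exact: (cvg_comp (fun r => r * d) (fun y => expR (- y)) (gt0_cvgMly d0 cvg_id) (@cvgr_expR R)).
exact: (cvg_comp (fun m : nat => m%:R) (fun r => expR (- (r * d))) (@cvgr_idn R) h).
Qed.

Lemma bernoulli_ineq (u : R) (c : nat) : 0 <= u <= 1 -> 1 - c%:R * u <= (1 - u) ^+ c.
Proof.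
move=> /andP[u0 u1]; elim: c => [|c IH]; first by rewrite mul0r subr0 expr0.
rewrite exprS -natr1.
have h : (1 - u) * (1 - c%:R * u) <= (1 - u) * (1 - u) ^+ c by rewrite ler_wpM2l// subr_ge0.
apply: le_trans h; have : 0 <= c%:R :> R by []. nra.
Qed.

(** Both bounds pass through e^(-c u); the reciprocal form shows decay as soon as c u is large. *)
Lemma onemX_le (u : R) (c : nat) : 0 <= u <= 1 -> (1 - u) ^+ c <= (1 + c%:R * u)^-1.
Proof.
move=> /andP[u0 u1]; have cu : 0 <= c%:R * u by rewrite mulr_ge0.
apply: (@le_trans _ _ (expR (- (c%:R * u)))).
  rewrite -mulrN expRM_natl lerXn2r ?nnegrE ?expR_ge0// ?subr_ge0//.
  exact: expR_ge1Dx.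
rewrite expRN lef_pV2 ?posrE ?expR_gt0 ?expR_ge1Dx//.
by rewrite ltr_wpDr.
Qed.

Variable f : R -> R.
Hypothesis fi : mu.-integrable setT (EFin \o f).
Hypothesis f_le0 : forall x : R, x <= 0 -> f x = 0.
Hypothesis laplace0 : forall n : nat, \int[mu]_x (expR (- (n%:R * x)) * f x) = 0.

Let mf : measurable_fun [set: R] f.
Proof. by apply/measurable_EFinP; exact: measurable_int fi. Qed.

(* As m tends to infinity, (1 - e^(-mx))^c with c ~ e^(mT) tends to the
   indicator of x > T, and it is a polynomial in e^(-x). *)
Let kern (n m c : nat) (x : R) := expR (- (n%:R * x)) * (1 - expR (- (m%:R * x))) ^+ c.

Let expRN_itv (n : nat) (x : R) : 0 < x -> 0 <= expR (- (n%:R * x)) <= 1.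
Proof. by move=> x0; rewrite expR_ge0/= -expR0 ler_expR oppr_le0 mulr_ge0// ltW. Qed.

Let kern_le1 (n m c : nat) (x : R) : 0 < x -> `|kern n m c x| <= 1.
Proof.
move=> x0; rewrite /kern normrM normrX -[leRHS](mulr1 1); apply: ler_pM => //.
  by have /andP[h1 h2] := expRN_itv n x0; rewrite ger0_norm.
have /andP[h1 h2] := expRN_itv m x0; rewrite exprn_ile1// ger0_norm ?subr_ge0//. 
Qed.

Let mkern n m c : measurable_fun [set: R] (kern n m c).
Proof. rewrite /kern; meas. Qed.

Let kern_integrable n m c : mu.-integrable setT (EFin \o (fun x => kern n m c x * f x)).
Proof.
apply: (@integrableM_bounded _ _ 1) => // x fx; apply: kern_le1.
by rewrite ltNge; apply: contra fx => /f_le0 ->.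
Qed.

(** Expanding one factor gives [kern n m c.+1] = [kern n m c] - [kern (n + m) m c], so induction on
    c for all n at once reduces to [laplace0]. *)
Let integral_kern n m c : \int[mu]_x (kern n m c x * f x) = 0.
Proof.
elim: c n => [|c IH] n.
  by rewrite -(laplace0 n); apply: eq_Rintegral => x _; rewrite /kern expr0 mulr1.
rewrite -(subr0 0) -{1}(IH n) -(IH (n + m)%N) -RintegralB//.
apply: eq_Rintegral => x _; rewrite /kern exprS.
have -> : expR (- ((n + m)%:R * x)) = expR (- (n%:R * x)) * expR (- (m%:R * x)).
  by rewrite -expRD natrD; congr expR; ring.
ring.
Qed.

Let step (T : R) (m : nat) (x : R) := kern 0 m (Num.truncn (expR (m%:R * T))).+1 x.

Let stepE T m x : step T m x = (1 - expR (- (m%:R * x))) ^+ (Num.truncn (expR (m%:R * T))).+1.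
Proof. by rewrite /step /kern mul0r oppr0 expR0 mul1r. Qed.

(** Bernoulli's inequality gives the lower bound 1 - c u with u = e^(-mx). Here c u is at most
    e^(-m(x-T)) + e^(-mx), the second term being the cost of rounding e^(mT) up to an integer. *)
Let cvg_step_gt (T x : R) : 0 < x -> T < x -> step T m x @[m --> \oo] --> (1 : R).
Proof.
move=> x0 Tx.
apply: (@squeeze_cvgr _ _ _ _ (fun m : nat => 1 - (expR (- (m%:R * (x - T))) + expR (- (m%:R * x)))) (fun=> 1)).
- near=> m; have /andP[u0 u1] := expRN_itv m x0.
  rewrite stepE exprn_ile1 ?subr_ge0 ?gerBl// andbT.
  apply: (le_trans _ (bernoulli_ineq _ _)); last by rewrite u0.
  rewrite lerD2l lerN2 mulrBr opprB expRD -[X in _ + X]mul1r -mulrDl ler_wpM2r//.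
  by rewrite -natr1 lerD2r truncn_le expR_ge0.
- rewrite -[X in _ --> X]subr0 -[X in _ --> _ - X](addr0 0); apply: cvgB; first exact: cvg_cst.
  by apply: cvgD; apply: cvg_expRN_natr; rewrite ?subr_gt0.
- exact: cvg_cst.
Unshelve. all: by end_near. Qed.

Let cvg_step_lt (T x : R) : 0 < x -> x < T -> step T m x @[m --> \oo] --> (0 : R).
Proof.
move=> x0 Tx.
apply: (@squeeze_cvgr _ _ _ _ (fun=> 0) (fun m : nat => expR (- (m%:R * (T - x))))).
- near=> m; have /andP[u0 u1] := expRN_itv m x0.
  rewrite stepE exprn_ge0 ?subr_ge0//=.
  apply: (le_trans (onemX_le _ _)); first by rewrite u0.
  have cu0 : 0 < 1 + (Num.truncn (expR (m%:R * T))).+1%:R * expR (- (m%:R * x)).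
    by apply: ltr_wpDr => //; exact: mulr_ge0.
  rewrite [leRHS]expRN lef_pV2 ?posrE ?expR_gt0//.
  have lt : expR (m%:R * T) <= (Num.truncn (expR (m%:R * T))).+1%:R.
    by rewrite ltW// truncnS_gt.
  apply: (@le_trans _ _ (expR (m%:R * T) * expR (- (m%:R * x)))).
    by rewrite -expRD ler_expR; lra.
  by apply: (@le_trans _ _ ((Num.truncn (expR (m%:R * T))).+1%:R * expR (- (m%:R * x)))); [rewrite ler_wpM2r|rewrite lerDr].
- exact: cvg_cst.
- by apply: cvg_expRN_natr; rewrite subr_gt0.
Unshelve. all: by end_near. Qed.

(** Each [step] integrates f to 0, so by dominated convergence f has integral 0 beyond T; removing
    this from the total integral, which is 0 by [laplace0] at n = 0, leaves the left ray. *)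
Lemma integral_ray_eq0 (T : R) : \int[mu]_(x in `]-oo, T]) f x = 0.
Proof.
pose g (x : R) := if T < x then f x else 0.
have mg : measurable_fun [set: R] g by rewrite /g; meas.
have negT : mu.-negligible [set T].
  by exists [set T]; split => //; rewrite lebesgue_measure_set1.
have mstep m : measurable_fun [set: R] (fun x => (step T m x * f x)%:E).
  exact: (measurable_int mu (kern_integrable _ _ _)).
have : (\int[mu]_x (step T m x * f x)%:E)%E @[m --> \oo] --> (\int[mu]_x (g x)%:E)%E.
  have [//|||//||//] := @dominated_convergence _ _ R mu setT measurableT
    (fun m x => (step T m x * f x)%:E) (EFin \o g) (fun x => (`|f x|)%:E).
  - exact/measurable_EFinP.
  - case: negT => N [mN N0 NT]; exists N; split => // x /= xN; apply: NT => /=.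
    apply: contrapT => /eqP xT; apply: xN => _.
    apply: cvg_EFin; first exact: nearW.
    rewrite /g; have [x0|x0] := leP x 0.
      by rewrite f_le0// if_same; under eq_fun do rewrite mulr0; exact: cvg_cst.
    case: (ltgtP T x) xT => [Tx _|xT _|_ //].
      rewrite -[X in _ --> X]mul1r; apply: cvgM; [exact: cvg_step_gt|exact: cvg_cst].
    rewrite -[X in _ --> X](mul0r (f x)); apply: cvgM; [exact: cvg_step_lt|exact: cvg_cst].
  - exact: integrable_norm.
  - apply: aeW => x m _; rewrite /= lee_fin normrM.
    have [x0|x0] := leP x 0; first by rewrite f_le0// normr0 mulr0.
    by rewrite ler_piMl//; exact: kern_le1.
rewrite (_ : (fun m => _) = (fun=> 0%E)); last first.
  apply/funext => m; have := integral_kern 0 m (Num.truncn (expR (m%:R * T))).+1.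
  by rewrite /Rintegral => E; rewrite -[LHS]fineK ?E//; exact: (integrable_fin_num measurableT (kern_integrable _ _ _)).
move=> /(cvg_lim (@ereal_hausdorff R)); rewrite lim_cst// => Ig.
have gi : mu.-integrable setT (EFin \o g).
  rewrite (_ : g = (fun x => (if T < x then 1 else 0) * f x)); last first.
    by apply/funext => x; rewrite /g; case: ifP; rewrite ?mul1r ?mul0r.
  apply: (@integrableM_bounded _ _ 1) => //; first meas.
  by move=> x _; case: ifP => _; rewrite ?normr1 ?normr0.
rewrite Rintegral_mkcond.
rewrite (_ : f \_ _ = fun x => f x - g x).
  rewrite RintegralB// [X in _ - X]/Rintegral -Ig subr0 -(laplace0 0).
  by apply: eq_Rintegral => x _; rewrite mul0r oppr0 expR0 mul1r.
apply/funext => x; rewrite patchE /g.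
have [xT|Tx] := leP x T; first by rewrite mem_set ?subr0//= in_itv.
by rewrite memNset ?subrr//= in_itv/= leNgt Tx.
Qed.

(** The indefinite integral of f vanishes identically, and by Lebesgue differentiation its
    derivative is f almost everywhere. *)
Lemma laplace_eq0 : {ae mu, forall x, f x = 0}.
Proof.
have fl : locally_integrable [set: R] f by apply: open_integrable_locally => //; exact: openT.
have fy y : mu.-integrable `]-oo, y] (EFin \o f) by exact: integrableS fi.
have := FTC1Ny fy fl; apply: filterS; first exact: (ae_filter_ringOfSetsType mu).
move=> x [_]; rewrite (_ : (fun y => Rintegral _ _ _) = cst 0).
  by rewrite derive1_cst => <-.
by apply/funext => y; exact: integral_ray_eq0.
Qed.

End laplace_uniqueness.

(** * Fubini's theorem under a product bound u(x) v(y) *)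

Section fubini_dominated.
Context {R : realType}.
Local Notation mu := (@lebesgue_measure R).
Variables (f : R -> R -> R) (u v : R -> R).
Hypothesis mf : measurable_fun [set: R * R] (fun z => f z.1 z.2).
Hypothesis u0 : forall x, 0 <= u x.
Hypothesis v0 : forall x, 0 <= v x.
Hypothesis ui : mu.-integrable setT (EFin \o u).
Hypothesis vi : mu.-integrable setT (EFin \o v).
Hypothesis fuv : forall x y, `|f x y| <= u x * v y.

Let mfx x : measurable_fun [set: R] (f x).
Proof. exact: (measurable_fun_pair2 (f := fun z => f z.1 z.2)). Qed.

Let mfy y : measurable_fun [set: R] (f ^~ y).
Proof. exact: (measurable_fun_pair1 (f := fun z => f z.1 z.2)). Qed.

Lemma integrable_dom1 x : mu.-integrable setT (EFin \o f x).
Proof.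
apply: (@le_integrable _ _ _ mu setT measurableT _ (fun y => ((u x)%:E * (v y)%:E)%E)).
- by apply/measurable_EFinP; exact: mfx.
- by move=> y _ /=; rewrite lee_fin (le_trans (fuv x y))// ler_norm.
- exact: integrableZl.
Qed.

Lemma integrable_dom2 y : mu.-integrable setT (EFin \o f ^~ y).
Proof.
apply: (@le_integrable _ _ _ mu setT measurableT _ (fun x => ((v y)%:E * (u x)%:E)%E)).
- by apply/measurable_EFinP; exact: mfy.
- by move=> x _ /=; rewrite lee_fin (le_trans (fuv x y))// mulrC ler_norm.
- exact: integrableZl.
Qed.

Let fi : (mu \x mu)%E.-integrable setT (fun z => (f z.1 z.2)%:E).
Proof.
apply/integrable12ltyP; first exact/measurable_EFinP.
have mu_ : measurable_fun [set: R] u by apply/measurable_EFinP; exact: measurable_int ui.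
have mv_ : measurable_fun [set: R] v by apply/measurable_EFinP; exact: measurable_int vi.
have Iv : (\int[mu]_y (v y)%:E)%E = (\int[mu]_y v y)%:E.
  by rewrite /Rintegral fineK//; exact: integrable_fin_num.
apply: (@le_lt_trans _ _ (\int[mu]_x ((\int[mu]_y v y) * u x)%:E)%E); last first.
  rewrite ge0_integralM//; last exact: Rintegral_ge0.
  by move/integrableP : ui => [_]; under eq_integral do rewrite /= ger0_norm//;
    move=> h; rewrite lte_mul_pinfty// lee_fin; exact: Rintegral_ge0.
apply: ge0_le_integral => //.
- by move=> x _; apply: integral_ge0.
- have mabs : measurable_fun [set: R * R] (fun z => `|(f z.1 z.2)%:E|%E).
    by apply/measurableT_comp => //; exact/measurable_EFinP.
  exact: (measurable_fun_fubini_tonelli_F (m2 := mu) _ mabs (fun z => abse_ge0 _)).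
- by apply/measurable_EFinP; meas.
- move=> x _; rewrite mulrC EFinM -Iv -ge0_integralM//.
  apply: ge0_le_integral => //.
  + by apply/measurableT_comp => //; apply/measurable_EFinP; exact: mfx.
  + by apply/measurable_EFinP; meas.
  + by move=> y _; rewrite lee_fin.
Qed.

Let Ix x : ((\int[mu]_y f x y)%:E = \int[mu]_y (f x y)%:E)%E.
Proof. by rewrite /Rintegral fineK//; apply: integrable_fin_num => //; exact: integrable_dom1. Qed.

Let Iy y : ((\int[mu]_x f x y)%:E = \int[mu]_x (f x y)%:E)%E.
Proof. by rewrite /Rintegral fineK//; apply: integrable_fin_num => //; exact: integrable_dom2. Qed.

Lemma fubini_dom : \int[mu]_x \int[mu]_y f x y = \int[mu]_y \int[mu]_x f x y.
Proof.
rewrite /Rintegral; congr fine.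
under eq_integral do rewrite -/(Rintegral _ _ _) Ix.
under [RHS]eq_integral do rewrite -/(Rintegral _ _ _) Iy.
exact: (Fubini fi).
Qed.

Lemma integrable_fubini_dom : mu.-integrable setT (EFin \o (fun x => \int[mu]_y f x y)).
Proof.
rewrite (_ : _ \o _ = fubini_F mu (fun z => (f z.1 z.2)%:E)).
  exact: integrable_fubini_F.
by apply/funext => x /=; rewrite Ix.
Qed.

End fubini_dominated.

(** * Comparing one-sided limits of functions that agree almost everywhere *)

Section ae_limits.
Context {R : realType}.
Local Notation mu := (@lebesgue_measure R).

Lemma ae_itv_ex (P : R -> Prop) (u v : R) : u < v -> {ae mu, forall x, P x} ->
  exists x, u < x < v /\ P x.
Proof.
move=> uv [N [mN N0 PN]]; apply: contrapT => h.
have : (mu `]u, v[ <= mu N)%E.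
  apply: le_measure; [by rewrite inE|by rewrite inE|].
  move=> x /=; rewrite in_itv/= => xuv; apply: PN => /= Px.
  by apply: h; exists x; split.
rewrite N0 lebesgue_measure_itv/= lte_fin uv -EFinB lee_fin; lra.
Qed.

(** A null set contains no interval, so points of agreement exist arbitrarily close to x. The
    one-sided form serves at endpoints such as 0, where agreement is only known on one side. *)
Lemma ae_eq_cvg_right (f g : R -> R) (x l l' : R) :
  f y @[y --> x^'+] --> l -> g y @[y --> x^'+] --> l' ->
  {ae mu, forall y, x < y -> f y = g y} -> l = l'.
Proof.
move=> fl gl fg; apply/eqP; rewrite -subr_eq0 -normr_eq0; apply/eqP.
apply/eqP; rewrite eq_le normr_ge0 andbT; apply/ler_addgt0Pr => e e0; rewrite add0r.
have e2 : 0 < e / 2 by rewrite divr_gt0.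
have : \forall y \near x^'+, `|l - f y| < e / 2 /\ `|l' - g y| < e / 2.
  move/cvgrPdist_lt : fl => /(_ _ e2) H1; move/cvgrPdist_lt : gl => /(_ _ e2) H2.
  by near=> y; split; [near: y; exact: H1|near: y; exact: H2].
move=> [d /= d0 H].
have [y [/andP[xy yd] /(_ xy) fgy]] := @ae_itv_ex _ x (x + d) (ltac:(lra)) fg.
have [] := H y; [by rewrite /= ltr0_norm; lra|exact: xy|].
rewrite fgy => h1 h2; rewrite (_ : l - l' = (l - g y) - (l' - g y)); last by ring.
apply: (le_trans (ler_normB _ _)); lra.
Unshelve. all: by end_near. Qed.

Lemma ae_eq_cvg_left (f g : R -> R) (x l l' : R) :
  f y @[y --> x^'-] --> l -> g y @[y --> x^'-] --> l' ->
  {ae mu, forall y, y < x -> f y = g y} -> l = l'.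
Proof.
move=> fl gl fg; apply/eqP; rewrite -subr_eq0 -normr_eq0; apply/eqP.
apply/eqP; rewrite eq_le normr_ge0 andbT; apply/ler_addgt0Pr => e e0; rewrite add0r.
have e2 : 0 < e / 2 by rewrite divr_gt0.
have : \forall y \near x^'-, `|l - f y| < e / 2 /\ `|l' - g y| < e / 2.
  move/cvgrPdist_lt : fl => /(_ _ e2) H1; move/cvgrPdist_lt : gl => /(_ _ e2) H2.
  by near=> y; split; [near: y; exact: H1|near: y; exact: H2].
move=> [d /= d0 H].
have [y [/andP[xy yd] /(_ yd) fgy]] := @ae_itv_ex _ (x - d) x (ltac:(lra)) fg.
have [] := H y; [by rewrite /= gtr0_norm; lra|exact: yd|].
rewrite fgy => h1 h2; rewrite (_ : l - l' = (l - g y) - (l' - g y)); last by ring.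
apply: (le_trans (ler_normB _ _)); lra.
Unshelve. all: by end_near. Qed.

End ae_limits.

(** * The Cauchy kernel *)

Section cauchy_kernel.
Context {R : realType}.
Local Notation mu := (@lebesgue_measure R).

Definition cauchy_kernel (l s : R) : R := l / (l ^+ 2 + s ^+ 2).

Lemma cauchy_kernel_ge0 (l s : R) : 0 < l -> 0 <= cauchy_kernel l s.
Proof. by move=> l0; apply: divr_ge0; [exact: ltW|rewrite addr_ge0 ?sqr_ge0]. Qed.

Lemma measurable_cauchy_kernel (l : R) : measurable_fun [set: R] (cauchy_kernel l).
Proof. rewrite /cauchy_kernel; meas. Qed.

Lemma integral_cauchy_kernel (l : R) : 0 < l ->
  (\int[mu]_s (cauchy_kernel l s)%:E = pi%:E)%E.
Proof.
move=> l0.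
have pos (s : R) : 0 < l ^+ 2 + s ^+ 2 by rewrite ltr_wpDr ?sqr_ge0// exprn_gt0.
rewrite (@ge0_FTC_T _ _ (fun s => atan (l^-1 * s)) (- (pi / 2)) (pi / 2)).
- by congr EFin; rewrite opprK -splitr.
- move=> s; split; first exact: cauchy_kernel_ge0.
    apply: cvgM; first exact: cvg_cst.
    apply: (@continuous_comp _ _ _ (fun y : R => l ^+ 2 + y ^+ 2) GRing.inv).
      by apply: cvgD; [exact: cvg_cst|exact: exprn_continuous].
    by apply: inv_continuous; rewrite gt_eqF.
  apply: is_derive_eq.
  rewrite /cauchy_kernel /GRing.scale/= mulr1.
  have h : 1 + (l^-1 * s) ^+ 2 = (l ^+ 2 + s ^+ 2) / l ^+ 2 by field; rewrite gt_eqF.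
  by rewrite h; field; rewrite !gt_eqF.
- apply/cvgNy_compNP.
  rewrite (_ : _ \o _ = fun x => - atan (l^-1 * x)); last by apply/funext => x /=; rewrite mulrN atanN.
  apply: cvgN; apply: (cvg_comp (fun x => l^-1 * x) atan _ (@cvgy_atan R)).
  by apply: gt0_cvgMry; rewrite ?invr_gt0//; exact: cvg_id.
- apply: (cvg_comp (fun x => l^-1 * x) atan _ (@cvgy_atan R)).
  by apply: gt0_cvgMry; rewrite ?invr_gt0//; exact: cvg_id.
Qed.

Lemma integrable_cauchy_kernel (l : R) : 0 < l ->
  mu.-integrable setT (EFin \o cauchy_kernel l).
Proof.
move=> l0; apply: ge0_integrable (integral_cauchy_kernel l0).
  exact: measurable_cauchy_kernel.
by move=> s; exact: cauchy_kernel_ge0.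
Qed.

Definition exp_ray (p x : R) : R := if 0 < x then expR (- (p * x)) else 0.

Lemma exp_ray_ge0 (p x : R) : 0 <= exp_ray p x.
Proof. by rewrite /exp_ray; case: ifP => // _; exact: expR_ge0. Qed.

Lemma measurable_exp_ray (p : R) : measurable_fun [set: R] (exp_ray p).
Proof. rewrite /exp_ray; meas. Qed.

Lemma integral_exp_ray (p : R) : 0 < p -> (\int[mu]_x (exp_ray p x)%:E = (p^-1)%:E)%E.
Proof.
move=> p0; have := integral_gamma (@ltr01 R) p0.
rewrite Gamma1 mul1r powR_inv1 ?(ltW p0)// => <-; apply: eq_integral => x _.
by rewrite /exp_ray /gamma_integrand subrr powRr0 mul1r.
Qed.

Lemma integrable_exp_ray (p : R) : 0 < p -> mu.-integrable setT (EFin \o exp_ray p).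
Proof.
move=> p0; apply: ge0_integrable (integral_exp_ray p0); first exact: measurable_exp_ray.
exact: exp_ray_ge0.
Qed.

Lemma Rintegral_exp_ray (p : R) : 0 < p -> \int[mu]_x exp_ray p x = p^-1.
Proof. by move=> p0; rewrite /Rintegral integral_exp_ray. Qed.

Lemma integrable_exp_ray_cos (p s : R) : 0 < p ->
  mu.-integrable setT (EFin \o (fun x => cos (s * x) * exp_ray p x)).
Proof.
move=> p0; apply: (@integrableM_bounded _ _ _ 1); [meas|exact: integrable_exp_ray|].
by move=> x _; rewrite ler_norml cos_geN1 cos_le1.
Qed.

Lemma Rintegral_exp_ray_cos (p s : R) : 0 < p ->
  \int[mu]_x (cos (s * x) * exp_ray p x) = cauchy_kernel p s.
Proof.
move=> p0.
have pos : 0 < p ^+ 2 + s ^+ 2 by rewrite ltr_wpDr ?sqr_ge0// exprn_gt0.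
(* Adding [exp_ray] makes the integrand e^(-px) (1 + cos(sx)) nonnegative, as the fundamental
   theorem above requires; its integral 1 / p is cancelled at the end. *)
have : \int[mu]_x (cos (s * x) * exp_ray p x + exp_ray p x) = cauchy_kernel p s + p^-1.
  rewrite /Rintegral.
  transitivity (fine (\int[mu]_x (if 0 < x then expR (- (p * x)) * (1 + cos (s * x)) else 0)%:E)).
    by congr fine; apply: eq_integral => x _; rewrite /exp_ray; case: ifP => _; congr EFin; ring.
  rewrite integral_if_oy.
  pose F (x : R) := expR (- (p * x)) * (- p^-1 + (s * sin (s * x) - p * cos (s * x)) / (p ^+ 2 + s ^+ 2)).
  rewrite (@ge0_FTC_oy _ _ F 0 (F 0) 0).
  - rewrite /= /F !mulr0 sin0 cos0 mulr0 sub0r mulr1 oppr0 expR0 mul1r /cauchy_kernel; ring.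
  - move=> x _; split.
    + rewrite mulr_ge0 ?expR_ge0//; have := cos_geN1 (s * x); lra.
    + apply: cvgM.
        apply: (@continuous_comp _ _ _ (fun y : R => - (p * y)) expR); last exact: continuous_expR.
        by apply: cvgN; apply: cvgM => //; exact: cvg_cst.
      apply: cvgD; first exact: cvg_cst.
      apply: (@continuous_comp _ _ _ (fun y : R => s * y) cos); last exact: continuous_cos.
      by apply: cvgM => //; exact: cvg_cst.
    + apply: is_derive_eq; rewrite /GRing.scale/=.
      by field; rewrite !gt_eqF.
  - apply: cvg_at_right_filter; apply: differentiable_continuous; apply/derivable1_diffP.
    exact: ex_derive.
  - pose K := p^-1 + (`|s| + p) / (p ^+ 2 + s ^+ 2).
    have h : expR (- (p * x)) @[x --> +oo] --> (0 : R).
      exact: (cvg_comp (fun r => p * r) (fun y => expR (- y)) (gt0_cvgMry p0 cvg_id) (@cvgr_expR R)).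
    have FK x : `|F x| <= expR (- (p * x)) * K.
      rewrite /F normrM (ger0_norm (expR_ge0 _)) ler_wpM2l ?expR_ge0//.
      rewrite (le_trans (ler_normD _ _))// normrN ger0_norm ?invr_ge0 ?(ltW p0)// lerD2l.
      rewrite normrM (ger0_norm (x := _^-1)) ?invr_ge0 ?(ltW pos)// ler_wpM2r ?invr_ge0 ?(ltW pos)//.
      rewrite (le_trans (ler_normB _ _))// !normrM (gtr0_norm p0) lerD// ler_piMr// ?(ltW p0)//.
        by rewrite ler_norml sin_geN1 sin_le1.
      by rewrite ler_norml cos_geN1 cos_le1.
    apply: (@squeeze_cvgr _ _ _ _ (fun x => - (expR (- (p * x)) * K)) (fun x => expR (- (p * x)) * K)).
    + by apply: nearW => x; rewrite -ler_norml.
    + by rewrite -[X in _ --> X]oppr0 -[X in _ --> - X](mul0r K); apply: cvgN; apply: cvgM => //; exact: cvg_cst.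
    + by rewrite -[X in _ --> X](mul0r K); apply: cvgM => //; exact: cvg_cst.
rewrite RintegralD//; last 2 first.
- exact: integrable_exp_ray_cos.
- exact: integrable_exp_ray.
by rewrite Rintegral_exp_ray//; apply: addIr.
Qed.

Definition cauchy_fourier (l x : R) : R := \int[mu]_s (cos (s * x) * cauchy_kernel l s).

Lemma integrable_cos_cauchy (l x : R) : 0 < l ->
  mu.-integrable setT (EFin \o (fun s => cos (s * x) * cauchy_kernel l s)).
Proof.
move=> l0; apply: (@integrableM_bounded _ _ _ 1); [meas|exact: integrable_cauchy_kernel|].
by move=> s _; rewrite ler_norml cos_geN1 cos_le1.
Qed.

Lemma continuous_cauchy_fourier (l x : R) : 0 < l -> {for x, continuous (cauchy_fourier l)}.
Proof.
move=> l0.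
have := @continuity_under_integral R _ _ mu (fun x s => cos (s * x) * cauchy_kernel l s) setT measurableT
  (x - 1) (x + 1) _ _ (cauchy_kernel l) (integrable_cauchy_kernel l0) _.
apply.
- by move=> y _; exact: integrable_cos_cauchy.
- apply: aeW => s _ y _ /=; apply: cvgM; last exact: cvg_cst.
  apply: (@continuous_comp _ _ _ (fun y => s * y) cos); last exact: continuous_cos.
  by apply: cvgM => //; exact: cvg_cst.
- move=> y _; apply: aeW => s _; rewrite normrM (ger0_norm (cauchy_kernel_ge0 _ l0)).
  by rewrite ler_piMl ?cauchy_kernel_ge0// ler_norml cos_geN1 cos_le1.
- by rewrite inE/= in_itv/=; apply/andP; split; lra.
Qed.

(* The Fourier transform of the Cauchy kernel is identified through its Laplace
   transform, which only involves rational functions. *)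
Lemma laplace_cauchy_fourier (l p : R) : 0 < l -> l < p ->
  \int[mu]_x (exp_ray p x * cauchy_fourier l x) = pi / (p + l).
Proof.
move=> l0 lp; have p0 : 0 < p by exact: lt_trans lp.
have posp (s : R) : 0 < p ^+ 2 + s ^+ 2 by rewrite ltr_wpDr ?sqr_ge0// exprn_gt0.
have posl (s : R) : 0 < l ^+ 2 + s ^+ 2 by rewrite ltr_wpDr ?sqr_ge0// exprn_gt0.
have pl : 0 < p ^+ 2 - l ^+ 2 by rewrite subr_gt0 ltrXn2r ?nnegrE ?ltW.
transitivity (\int[mu]_x \int[mu]_s (exp_ray p x * (cos (s * x) * cauchy_kernel l s))).
  apply: eq_Rintegral => x _; rewrite RintegralZl//; exact: integrable_cos_cauchy.
rewrite (@fubini_dom _ _ (exp_ray p) (cauchy_kernel l)); first last.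
- move=> x s; rewrite normrM (ger0_norm (exp_ray_ge0 _ _)) ler_wpM2l ?exp_ray_ge0//.
  rewrite normrM (ger0_norm (cauchy_kernel_ge0 _ l0)).
  by rewrite ler_piMl ?cauchy_kernel_ge0// ler_norml cos_geN1 cos_le1.
- exact: integrable_cauchy_kernel.
- exact: integrable_exp_ray.
- by move=> x; exact: cauchy_kernel_ge0.
- exact: exp_ray_ge0.
- rewrite /exp_ray /cauchy_kernel; meas.
(* Partial fractions in s^2 for the product of the kernels of parameters l and p; they need p and l
   distinct, which l < p ensures. *)
transitivity (\int[mu]_s ((l * p / (p ^+ 2 - l ^+ 2)) * (l^-1 * cauchy_kernel l s - p^-1 * cauchy_kernel p s))).
  apply: eq_Rintegral => s _.
  transitivity (\int[mu]_x (cauchy_kernel l s * (cos (s * x) * exp_ray p x))).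
    by apply: eq_Rintegral => x _; ring.
  rewrite RintegralZl//; last exact: integrable_exp_ray_cos.
  rewrite Rintegral_exp_ray_cos// /cauchy_kernel; field.
  by rewrite !gt_eqF.
have il := integrable_cauchy_kernel l0; have ip := integrable_cauchy_kernel p0.
have Ml : mu.-integrable setT (EFin \o (fun s => l^-1 * cauchy_kernel l s)) by exact: (integrableZl measurableT _ il).
have Mp : mu.-integrable setT (EFin \o (fun s => p^-1 * cauchy_kernel p s)) by exact: (integrableZl measurableT _ ip).
rewrite RintegralZl//; last exact: (integrableB measurableT Ml Mp).
have El : \int[mu]_x (l^-1 * cauchy_kernel l x) = l^-1 * pi.
  by rewrite RintegralZl// /Rintegral integral_cauchy_kernel.
have Ep : \int[mu]_x (p^-1 * cauchy_kernel p x) = p^-1 * pi.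
  by rewrite RintegralZl// /Rintegral integral_cauchy_kernel.
rewrite RintegralB// El Ep; move: (pi : R) => c.
field; rewrite !gt_eqF//; lra.
Qed.

Lemma cauchy_fourierE (l x : R) : 0 < l -> 0 <= x -> cauchy_fourier l x = pi * expR (- (l * x)).
Proof.
move=> l0 x0.
(* The rate l + 1 makes the difference integrable, and n + l + 1 > l meets the hypothesis of
   [laplace_cauchy_fourier] for every n. *)
pose f (x : R) := exp_ray (l + 1) x * (cauchy_fourier l x - pi * expR (- (l * x))).
have mF : measurable_fun [set: R] (cauchy_fourier l).
  by apply: continuous_measurable_fun => y; exact: continuous_cauchy_fourier.
have Fle y : `|cauchy_fourier l y| <= pi.
  rewrite (le_trans (le_normr_Rintegral measurableT (integrable_cos_cauchy y l0)))//.
  rewrite -[leRHS](_ : \int[mu]_s (cauchy_kernel l s) = _); last by rewrite /Rintegral integral_cauchy_kernel.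
  apply: le_Rintegral => //.
  - exact: (integrable_norm (integrable_cos_cauchy y l0)).
  - exact: integrable_cauchy_kernel.
  - move=> s _; rewrite normrM (ger0_norm (cauchy_kernel_ge0 _ l0)).
    by rewrite ler_piMl ?cauchy_kernel_ge0// ler_norml cos_geN1 cos_le1.
have iF p : 0 < p -> mu.-integrable setT (EFin \o (fun x => exp_ray p x * cauchy_fourier l x)).
  move=> p0; rewrite (_ : (fun x => _) = fun x => cauchy_fourier l x * exp_ray p x); last by apply/funext => y; rewrite mulrC.
  by apply: (@integrableM_bounded _ _ _ pi) => //; exact: integrable_exp_ray.
have fE n y : expR (- (n%:R * y)) * f y =
    exp_ray (n%:R + l + 1) y * cauchy_fourier l y - pi * exp_ray (n%:R + l + 1 + l) y.
  rewrite /f /exp_ray; case: ifP => _; last by rewrite !mul0r !mulr0 subr0.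
  by rewrite mulrA -expRD mulrBr (mulrCA _ pi) -expRD; congr (expR _ * _ - _ * expR _); ring.
have n0 n : 0 < n%:R + l + 1 :> R by rewrite addr_gt0// ltr_wpDl.
have n1 n : 0 < n%:R + l + 1 + l :> R by rewrite addr_gt0.
have iE n : mu.-integrable setT (EFin \o (fun y => pi * exp_ray (n%:R + l + 1 + l) y)).
  by exact: (integrableZl measurableT _ (integrable_exp_ray (n1 n))).
have fi : mu.-integrable setT (EFin \o f).
  rewrite (_ : f = fun y => expR (- (0%:R * y)) * f y); last by apply/funext => y; rewrite mul0r oppr0 expR0 mul1r.
  rewrite (_ : _ \o _ = (fun y => (exp_ray (0%:R + l + 1) y * cauchy_fourier l y)%:E - (pi * exp_ray (0%:R + l + 1 + l) y)%:E)%E); last first.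
    by apply/funext => y /=; rewrite fE.
  exact: (integrableB measurableT (iF _ (n0 0%N)) (iE 0%N)).
have f_le0 y : y <= 0 -> f y = 0 by move=> y0; rewrite /f /exp_ray ltNge y0/= mul0r.
have := laplace_eq0 fi f_le0.
have L0 (n : nat) : \int[mu]_x (expR (- (n%:R * x)) * f x) = 0.
  under eq_Rintegral do rewrite fE.
  rewrite RintegralB//; last exact: iF.
  rewrite laplace_cauchy_fourier//; last by rewrite -addrA addrCA ltrDl ltr_wpDl.
  by rewrite RintegralZl ?Rintegral_exp_ray// ?subrr//; exact: integrable_exp_ray.
move=> /(_ L0) f0.
(* Both sides are continuous, so equality at almost every y > 0 extends to all x >= 0, the point 0
   included. *)
apply: (@ae_eq_cvg_right _ (cauchy_fourier l) (fun y => pi * expR (- (l * y))) x).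
- by apply: cvg_at_right_filter; exact: continuous_cauchy_fourier.
- apply: cvg_at_right_filter; apply: cvgM; first exact: cvg_cst.
  apply: (@continuous_comp _ _ _ (fun y : R => - (l * y)) expR); last exact: continuous_expR.
  by apply: cvgN; apply: cvgM => //; exact: cvg_cst.
- apply: filterS f0; first exact: (ae_filter_ringOfSetsType mu).
  move=> y; rewrite /f => /eqP; rewrite mulf_eq0 => /orP[|/eqP h xy]; last by lra.
  move=> + xy; rewrite /exp_ray (le_lt_trans x0 xy) => /eqP h.
  by have := expR_gt0 (- ((l + 1) * y)); rewrite h ltxx.
Qed.

End cauchy_kernel.

(** * The characteristic function *)

Section levy_series.
Context {R : realType}.
Local Notation mu := (@lebesgue_measure R).
Variable a : R.
Hypotheses (a_gt0 : 0 < a) (a_lt1 : a < 1).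

(* The coefficients a / (n - a) of the series of 1 / phi are the moments of
   this weight. *)
Definition levy_weight (y : R) : R := if 0 < y < 1 then a * y `^ (- a - 1) else 0.

Lemma levy_weight_ge0 y : 0 <= levy_weight y.
Proof. by rewrite /levy_weight; case: ifP => // _; rewrite mulr_ge0 ?powR_ge0// ltW. Qed.

Lemma measurable_levy_weight : measurable_fun [set: R] levy_weight.
Proof. rewrite /levy_weight; meas. Qed.

Lemma integral_levy_weight_powR (p : R) : a < p ->
  (\int[mu]_y (levy_weight y * y `^ p)%:E = (a / (p - a))%:E)%E.
Proof.
move=> ap; have pa : 0 < p - a by rewrite subr_gt0.
have := integral_powR_0 pa (@ltr01 R); rewrite powR1 mul1r -integral_if_oo => h.
rewrite EFinM -h -ge0_integralM ?(ltW a_gt0)//; first last.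
- by move=> y; case: ifP => // _; exact: powR_ge0.
- meas.
apply: eq_integral => y _; rewrite /levy_weight; case: ifP => [/andP[y0 _]|]; last by rewrite mul0r mulr0.
rewrite -mulrA -powRD; last by rewrite (gt_eqF y0) implybT.
by congr (_ * _ `^ _)%:E; ring.
Qed.

Lemma integral_levy_weightX (n : nat) : (0 < n)%N ->
  (\int[mu]_y (levy_weight y * y ^+ n)%:E = (a / (n%:R - a))%:E)%E.
Proof.
move=> n0; rewrite -integral_levy_weight_powR; last by rewrite (lt_le_trans a_lt1)// ler1n.
apply: eq_integral => y _; rewrite /levy_weight; case: ifP => [/andP[y0 _]|]; last by rewrite !mul0r.
by rewrite powR_mulrn// ltW.
Qed.

Lemma integrable_levy_weight_powR (p : R) : a < p ->
  mu.-integrable setT (EFin \o (fun y => levy_weight y * y `^ p)).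
Proof.
move=> ap; apply: ge0_integrable (integral_levy_weight_powR ap).
  have mw := measurable_levy_weight; meas.
by move=> y; rewrite mulr_ge0 ?levy_weight_ge0 ?powR_ge0.
Qed.

Lemma integrable_levy_weightX (n : nat) : (0 < n)%N ->
  mu.-integrable setT (EFin \o (fun y => levy_weight y * y ^+ n)).
Proof.
move=> n0; apply: ge0_integrable (integral_levy_weightX n0).
  have mw := measurable_levy_weight; meas.
move=> y; rewrite /levy_weight; case: ifP => [/andP[y0 y1]|_]; last by rewrite mul0r.
by rewrite mulr_ge0 ?exprn_ge0 ?(ltW y0)// mulr_ge0 ?powR_ge0// ltW.
Qed.

(** As the sums start at n = 1, they are at most B y for 0 < y < 1; this factor y makes the singular
    weight integrable and yields the dominating function for the exchange of sum and integral. *)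
Lemma cvg_levy_series (c : nat -> R) (B : R) (f : R -> R) :
  (forall N, \sum_(1 <= n < N) `|c n| <= B) -> measurable_fun [set: R] f ->
  (forall y, 0 < y < 1 -> \sum_(1 <= n < N) (c n * y ^+ n) @[N --> \oo] --> f y) ->
  \sum_(1 <= n < N) (a / (n%:R - a) * c n) @[N --> \oo] --> \int[mu]_y (levy_weight y * f y).
Proof.
move=> cB mf cf.
have iw n : (0 < n)%N -> mu.-integrable setT (EFin \o (fun y => c n * (levy_weight y * y ^+ n))).
  by move=> n0; exact: (integrableZl measurableT _ (integrable_levy_weightX n0)).
pose S N y := levy_weight y * \sum_(1 <= n < N) (c n * y ^+ n).
have mw := measurable_levy_weight.
have mS N : measurable_fun [set: R] (S N).
  rewrite /S; apply: measurable_funM => //.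
  by apply: measurable_sum => n; meas.
have SE N : (\int[mu]_y (S N y)%:E = (\sum_(1 <= n < N) (a / (n%:R - a) * c n))%:E)%E.
  pose h n y := if n is 0%N then 0 else c n * (levy_weight y * y ^+ n).
  have ih n : mu.-integrable setT (EFin \o h n) by case: n => [|n]; [exact: integrable0|exact: iw].
  transitivity (\int[mu]_y (\sum_(1 <= n < N) (h n y)%:E))%E.
    apply: eq_integral => y _; rewrite /S mulr_sumr sumEFin; congr EFin.
    by apply: eq_big_nat => n; case: n => //= n _; rewrite mulrCA.
  rewrite integral_sum// -sumEFin; apply: eq_big_nat => n; case: n => //= n _.
  under eq_integral do rewrite EFinM.
  rewrite (integralZl measurableT (integrable_levy_weightX (ltn0Sn n))).
  by rewrite integral_levy_weightX// -EFinM mulrC.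
have Sle N y : `|S N y| <= B * (levy_weight y * y ^+ 1).
  rewrite /S /levy_weight; case: ifP => [/andP[y0 y1]|_]; last by rewrite !mul0r normr0 mulr0.
  rewrite mulrCA normrM ger0_norm ?mulr_ge0 ?powR_ge0 ?(ltW a_gt0)// ler_wpM2l ?mulr_ge0 ?powR_ge0 ?(ltW a_gt0)//.
  rewrite expr1 (le_trans (ler_norm_sum _ _ _))//.
  apply: (@le_trans _ _ (\sum_(1 <= n < N) `|c n| * y)); last by rewrite -mulr_suml ler_wpM2r// ltW.
  apply: ler_sum_nat => n /andP[n0 _]; rewrite normrM ler_wpM2l// normrX ger0_norm ?(ltW y0)//.
  by rewrite -[leRHS]expr1 ler_wiXn2l ?ltW.
have [//|||//||iwf _ H] := @dominated_convergence _ _ R mu setT measurableT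
  (fun N y => (S N y)%:E) (fun y => (levy_weight y * f y)%:E) (fun y => (B * (levy_weight y * y ^+ 1))%:E).
- by move=> N; apply/measurable_EFinP; exact: mS.
- by apply/measurable_EFinP; meas.
- apply: aeW => y _; apply: cvg_EFin; first exact: nearW.
  rewrite /S/levy_weight /=; case: ifPn => [y01|_].
    by apply: cvgM; [exact: cvg_cst|exact: cf].
  by rewrite mul0r; under eq_fun do rewrite mul0r; exact: cvg_cst.
- exact: (integrableZl measurableT _ (integrable_levy_weightX (ltn0Sn 0))).
- by apply: aeW => y N _; rewrite lee_fin.
have {}H : fine (\int[mu]_y (S N y)%:E)%E @[N --> \oo] --> \int[mu]_y (levy_weight y * f y).
  by apply: fine_cvg; rewrite fineK//; exact: integrable_fin_num.
by apply: cvg_trans H; apply: near_eq_cvg; apply: nearW => N; rewrite SE.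
Qed.

End levy_series.

Section complex_limit.
Context {R : realType}.

Lemma sqrt_sum_sqr_le (A B : R) : Num.sqrt (A ^+ 2 + B ^+ 2) <= `|A| + `|B|.
Proof.
rewrite -[leRHS]ger0_norm ?addr_ge0// -sqrtr_sqr ler_wsqrtr//.
rewrite -(real_normK (num_real A)) -(real_normK (num_real B)) sqrrD.
by rewrite -addrA lerD2l lerDr mulrn_wge0// mulr_ge0.
Qed.

Lemma cvg_complex (u v : nat -> R) (x y : R) : u n @[n --> \oo] --> x -> v n @[n --> \oo] --> y ->
  (fun n => (u n +i* v n)%C : (R[i])^o) @ \oo --> ((x +i* y)%C : (R[i])^o).
Proof.
move=> ux vy; apply/cvgrPdist_lt => e e0.
have /complex_realP [d ed] : e \is Num.real by exact: gtr0_real.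
have d0 : 0 < d by rewrite -ltcR -ed.
near=> n.
have h1 : `|x - u n| < d / 2 by near: n; move/cvgrPdist_lt : ux; apply; rewrite divr_gt0.
have h2 : `|y - v n| < d / 2 by near: n; move/cvgrPdist_lt : vy; apply; rewrite divr_gt0.
rewrite ed; apply: (@le_lt_trans _ _ (`|x - u n| + `|y - v n|)%:C%C); last by rewrite ltcR; lra.
rewrite normc_def lecR; exact: sqrt_sum_sqr_le.
Unshelve. all: by end_near. Qed.

Lemma expci (s : R) (n : nat) :
  ('i%C * s%:C%C) ^+ n / (n`!)%:R = (cos_coeff s n +i* sin_coeff s n)%C.
Proof.
have ii m : 'i%C ^+ m.*2 = ((-1) ^+ m)%:C%C :> R[i].
  by rewrite -mul2n exprM sqr_i rmorphXn rmorphN1.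
rewrite exprMn -(odd_double_half n); move: (odd n) (n./2) => b m.
case: b; rewrite ?add0n ?add1n.
  rewrite cos_coeff_odd -sin_coeff'E exprS ii.
  rewrite [RHS]complexE /= add0r.
  rewrite -!mulrA; congr (_ * _).
  by rewrite /sin_coeff' -(rmorph_nat (real_complex R)) -fmorphV -rmorphXn -!rmorphM mulrA.
rewrite sin_coeff_even ii.
rewrite -(rmorph_nat (real_complex R)) -fmorphV -rmorphXn -!rmorphM /= [RHS]complexr0.
by rewrite /cos_coeff /= odd_double mul1r doubleK.
Qed.

End complex_limit.

Section DM_exponent.
Context {R : realType}.
Local Notation mu := (@lebesgue_measure R).

Lemma series_exp_coeff_le (x : R) N : 0 <= x -> series (exp_coeff x) N <= expR x.
Proof.
move=> x0; rewrite /expR; apply: nondecreasing_cvgn_le; last exact: is_cvg_series_exp_coeff.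
apply/nondecreasing_seqP => n; rewrite !seriesEnat /= big_nat_recr//= lerDl /exp_coeff /=.
by rewrite divr_ge0// exprn_ge0.
Qed.

Lemma sum1_exp_coeff_le (c : nat -> R) (s : R) N : (forall n, `|c n| <= exp_coeff `|s| n) ->
  \sum_(1 <= n < N) `|c n| <= expR `|s|.
Proof.
move=> h; apply: le_trans (series_exp_coeff_le N (normr_ge0 s)).
case: N => [|N]; first by rewrite big_geq// /series /= big_geq.
rewrite /series/= [leRHS]big_ltn//; apply: (@le_trans _ _ (\sum_(1 <= n < N.+1) exp_coeff `|s| n)).
  exact: ler_sum_nat.
by rewrite lerDr /exp_coeff /= divr_ge0// exprn_ge0.
Qed.

Lemma norm_cos_coeff_le (s : R) n : `|cos_coeff s n| <= exp_coeff `|s| n.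
Proof.
rewrite /cos_coeff /exp_coeff /= !normrM normfV !normr_nat.
rewrite -exprnP !normrX normrN normr1 expr1n mulr1.
by case: (odd n) => /=; rewrite ?mul1r// !mul0r divr_ge0// exprn_ge0.
Qed.

Lemma norm_sin_coeff_le (s : R) n : `|sin_coeff s n| <= exp_coeff `|s| n.
Proof.
rewrite /sin_coeff /exp_coeff /= !normrM normfV !normr_nat.
rewrite !normrX normrN normr1 expr1n mulr1.
by case: (odd n) => /=; rewrite ?mul1r// !mul0r divr_ge0// exprn_ge0.
Qed.

Lemma cvg_cos_series (x : R) : series (cos_coeff x) @ \oo --> cos x.
Proof. by rewrite unlock; exact: is_cvg_series_cos_coeff. Qed.

Lemma cvg_sin_series (x : R) : series (sin_coeff x) @ \oo --> sin x.
Proof. by rewrite unlock; exact: is_cvg_series_sin_coeff. Qed.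

Lemma cvg_sum1 (c : nat -> R) (l : R) : series c @ \oo --> l ->
  \sum_(1 <= n < N) c n @[N --> \oo] --> l - c 0%N.
Proof.
move=> cl; have h : series c N - c 0%N @[N --> \oo] --> l - c 0%N.
  by apply: cvgB => //; exact: cvg_cst.
apply: cvg_trans h; apply: near_eq_cvg; near=> N.
have N0 : (0 < N)%N by near: N; exact: nbhs_infty_gt.
by rewrite /series/= big_ltn// addrC addrA addNr add0r.
Unshelve. all: by end_near. Qed.

Variable a : R.
Hypotheses (a_gt0 : 0 < a) (a_lt1 : a < 1).

(* 1 / phi s = 1 - levy_cos s - i * levy_sin s. *)
Definition levy_cos (s : R) := \int[mu]_y (levy_weight a y * (cos (s * y) - 1)).
Definition levy_sin (s : R) := \int[mu]_y (levy_weight a y * sin (s * y)).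

Lemma cvg_levy_cos (s : R) :
  \sum_(1 <= n < N) (a / (n%:R - a) * cos_coeff s n) @[N --> \oo] --> levy_cos s.
Proof.
apply: (cvg_levy_series a_gt0 a_lt1 (B := expR `|s|)).
- by move=> N; apply: sum1_exp_coeff_le => n; exact: norm_cos_coeff_le.
- meas.
- move=> y _; have := cvg_sum1 (@cvg_cos_series (s * y)).
  have -> : cos_coeff (s * y) 0 = 1 by rewrite /cos_coeff /= fact0 expr0z expr0 divr1 !mulr1.
  apply: cvg_trans; apply: near_eq_cvg; apply: nearW => N; apply: eq_bigr => n _.
  by rewrite /cos_coeff /= exprMn; ring.
Qed.

Lemma cvg_levy_sin (s : R) :
  \sum_(1 <= n < N) (a / (n%:R - a) * sin_coeff s n) @[N --> \oo] --> levy_sin s.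
Proof.
apply: (cvg_levy_series a_gt0 a_lt1 (B := expR `|s|)).
- by move=> N; apply: sum1_exp_coeff_le => n; exact: norm_sin_coeff_le.
- meas.
- move=> y _; have := cvg_sum1 (@cvg_sin_series (s * y)).
  have -> : sin_coeff (s * y) 0 = 0 by rewrite /sin_coeff /= !mul0r.
  rewrite subr0.
  apply: cvg_trans; apply: near_eq_cvg; apply: nearW => N; apply: eq_bigr => n _.
  by rewrite /sin_coeff /= exprMn; ring.
Qed.

Lemma sum_complex (u v : nat -> R) (r : seq nat) :
  \sum_(n <- r) ((u n +i* v n)%C) = ((\sum_(n <- r) u n) +i* (\sum_(n <- r) v n))%C.
Proof.
elim: r => [|n r IH]; first by rewrite !big_nil.
by rewrite !big_cons IH; simpc.
Qed.

(** Hence the real part of 1 / phi is at least 1: it is not 0, and the inverse in [DM_charfun] is a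
    genuine one. *)
Lemma levy_cos_le0 (s : R) : levy_cos s <= 0.
Proof.
rewrite /levy_cos /Rintegral.
rewrite (_ : (\int[mu]_y _)%E = \int[mu]_y (- (levy_weight a y * (1 - cos (s * y)))%:E))%E; last first.
  by apply: eq_integral => y _; rewrite -EFinN -mulrN opprB.
have w0 y : (0 <= (levy_weight a y * (1 - cos (s * y)))%:E)%E.
  by rewrite lee_fin mulr_ge0 ?levy_weight_ge0// subr_ge0 cos_le1.
by rewrite integral_ge0N// fineN oppr_le0 fine_ge0// integral_ge0.
Qed.

Lemma DM_charfunE (s : R) (c d : R) : (c +i* d)%C = DM_charfun a s ->
  c * (1 - levy_cos s) + d * levy_sin s = 1.
Proof.
rewrite /DM_charfun.
set L := lim _; have -> : L = ((levy_cos s +i* levy_sin s)%C : (R[i])^o).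
  apply/cvg_lim; first exact: norm_hausdorff.
  have := cvg_complex (@cvg_levy_cos s) (@cvg_levy_sin s).
  apply: cvg_trans; apply: near_eq_cvg; apply: nearW => N.
  rewrite -sum_complex; apply: eq_bigr => n _.
  by rewrite expci; simpc.
have h : (1 - (levy_cos s +i* levy_sin s))%C != 0 :> R[i].
  apply/eqP => /(congr1 (@complex.Re R)) /= h; have := levy_cos_le0 s; lra.
move=> E; have : (c +i* d)%C * (1 - (levy_cos s +i* levy_sin s))%C = 1 by rewrite E mulVf.
by move=> /(congr1 (@complex.Re R)) /=; simpc; lra.
Qed.

End DM_exponent.

(** * The Laplace transform of the density *)

Section bounds.
Context {R : realType}.
Local Notation mu := (@lebesgue_measure R).

Lemma measurable_fun_Rintegral (f : R -> R -> R) :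
  measurable_fun [set: R * R] (fun z => f z.1 z.2) ->
  measurable_fun [set: R] (fun x => \int[mu]_y f x y).
Proof.
move=> mf; apply: (measurableT_comp (f := fine)); first by [].
have mF : measurable_fun [set: R * R] (fun z => (f z.1 z.2)%:E) by exact/measurable_EFinP.
rewrite (_ : (fun x => _) = (fun x => fubini_F mu (fun z => (f z.1 z.2)%:E)^\+%E x -
   fubini_F mu (fun z => (f z.1 z.2)%:E)^\-%E x)%E); last first.
  apply/funext => x; rewrite [LHS]integralE /fubini_F; congr (adde _ (oppe _)); apply: eq_integral => y _.
    by rewrite !funeposE.
  by rewrite !funenegE.
apply: emeasurable_funB.
  exact: (measurable_fun_fubini_tonelli_F (m2 := mu) _ (measurable_funepos mF) (funepos_ge0 _)).
exact: (measurable_fun_fubini_tonelli_F (m2 := mu) _ (measurable_funeneg mF) (funeneg_ge0 _)).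
Qed.

Lemma ge0_integral_opp (f : R -> \bar R) : measurable_fun [set: R] f -> (forall x, 0 <= f x)%E ->
  (\int[mu]_x f (- x)%R = \int[mu]_x f x)%E.
Proof.
move=> mf f0.
have mN : measurable_fun [set: measurableTypeR R] (-%R : measurableTypeR R -> measurableTypeR R) by [].
rewrite [RHS](eq_measure_integral (pushforward mu (-%R : measurableTypeR R -> measurableTypeR R))); last first.
  by move=> A mA _; exact/esym/lebesgue_measureN.
by rewrite ge0_integral_pushforward//= preimage_setT.
Qed.

Lemma cos_lip (x y : R) : `|cos x - cos y| <= `|x - y|.
Proof.
wlog xy : x y / y < x.
  move=> H; case: (ltgtP x y) => [xy|xy|->]; last by rewrite !subrr.
    by rewrite distrC (distrC x); exact: H.
  exact: H.
have [c _ ->] : exists2 c, c \in `]y, x[ & cos x - cos y = - sin c * (x - y).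
  apply: (@MVT _ cos (fun x => - sin x)) => //.
  by apply: continuous_subspaceT => z; exact: continuous_cos.
by rewrite normrM normrN ler_piMl// ler_norml sin_geN1 sin_le1.
Qed.

Lemma sin_lip (x y : R) : `|sin x - sin y| <= `|x - y|.
Proof.
rewrite -!(cosBpihalf); apply: (le_trans (cos_lip _ _)).
by rewrite opprB addrA subrK.
Qed.

(** Interpolates between the bounds |u| and 2, which come from the Lipschitz constant and from the
    range of the trigonometric functions. *)
Lemma min2_le_powR (u b g : R) : 0 < g -> g <= 1 -> `|b| <= `|u| -> `|b| <= 2 -> `|b| <= 2 * `|u| `^ g.
Proof.
move=> g0 g1 bu b2; have [u1|u1] := leP `|u| 1.
  have [u_0|un0] := eqVneq u 0; first by move: bu; rewrite u_0 !normr0 => bu; apply: (le_trans bu); apply: mulr_ge0 => //; exact: powR_ge0.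
  rewrite (le_trans bu)//; apply: (@le_trans _ _ (`|u| `^ g)).
    by apply: ger1_powR => //; rewrite normr_gt0 un0.
  by rewrite ler_peMl ?powR_ge0// ler1n.
rewrite (le_trans b2)// ler_peMr// -(powRr0 `|u|).
by apply: ler_powR; [exact: ltW|exact: ltW].
Qed.

(** The kernel decays like s^(-2), so g < 1 leaves the integrable power s^(g-2) at infinity; [m1]
    and its mirror image dominate the two tails. *)
Lemma integrable_cauchy_kernel_powR (l g : R) : 0 < l -> 0 < g -> g < 1 ->
  mu.-integrable setT (EFin \o (fun s => cauchy_kernel l s * `|s| `^ g)).
Proof.
move=> l0 g0 g1.
pose m1 (s : R) : R := if 1 < s then s `^ (- (1 - g) - 1) else 0.
have m10 s : 0 <= m1 s by rewrite /m1; case: ifP => // _; exact: powR_ge0.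
have mm1 : measurable_fun [set: R] m1 by rewrite /m1; meas.
have mm1N : measurable_fun [set: R] (fun x => m1 (- x)).
  by apply: (measurableT_comp mm1); meas.
have I1 : (\int[mu]_s (m1 s)%:E = ((1 - g)^-1)%:E)%E.
  by rewrite /m1 integral_if_oy integral_powR_y ?subr_gt0// powR1 mul1r.
have I2 : (\int[mu]_s (m1 (- s))%:E = ((1 - g)^-1)%:E)%E.
  rewrite -I1 -[RHS]ge0_integral_opp//; exact/measurable_EFinP.
have i1 := ge0_integrable mm1 m10 I1.
have i2 := ge0_integrable mm1N (fun x => m10 (- x)) I2.
have ik := integrable_cauchy_kernel l0.
have mk := measurable_cauchy_kernel l.
apply: (@le_integrable _ _ _ mu setT measurableT _
  (EFin \o (fun s => cauchy_kernel l s + l * (m1 s + m1 (- s))))).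
- by apply/measurable_EFinP; meas.
- move=> s _ /=; rewrite lee_fin [leLHS]ger0_norm; last by rewrite mulr_ge0 ?cauchy_kernel_ge0 ?powR_ge0.
  rewrite [leRHS]ger0_norm; last by rewrite addr_ge0 ?cauchy_kernel_ge0// mulr_ge0 ?(ltW l0)// addr_ge0.
  have [s1|s1] := leP `|s| 1.
    apply: (@le_trans _ _ (cauchy_kernel l s)); last first.
      by rewrite lerDl mulr_ge0 ?(ltW l0)// addr_ge0.
    rewrite ler_piMr ?cauchy_kernel_ge0//.
    have [->|sn0] := eqVneq s 0; first by rewrite normr0 powR0 ?gt_eqF.
    apply: (@le_trans _ _ (1 `^ g)); last by rewrite powR1.
    by apply: ge0_ler_powR; rewrite ?nnegrE// ltW.
  apply: (@le_trans _ _ (l * `|s| `^ (- (1 - g) - 1))); last first.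
    apply: (@le_trans _ _ (l * (m1 s + m1 (- s)))); last by rewrite lerDr cauchy_kernel_ge0.
    rewrite ler_wpM2l ?(ltW l0)//.
    have [s0|s0] := leP 0 s.
      by rewrite ger0_norm// in s1 *; rewrite {1}/m1 s1 lerDl.
    by rewrite ltr0_norm// in s1 *; rewrite {2}/m1 s1 lerDr.
  rewrite /cauchy_kernel -mulrA ler_wpM2l ?(ltW l0)//.
  have s0 : 0 < `|s| by exact: lt_trans s1.
  have -> : `|s| `^ (- (1 - g) - 1) = (`|s| ^+ 2)^-1 * `|s| `^ g.
    rewrite -powR_mulrn ?(ltW s0)// -powRN -powRD; last by rewrite (gt_eqF s0) implybT.
    by congr (_ `^ _); rewrite mulr2n; ring.
  rewrite ler_wpM2r ?powR_ge0// lef_pV2 ?posrE ?exprn_gt0//; last first.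
    by rewrite ltr_wpDr ?sqr_ge0// exprn_gt0.
  by rewrite real_normK ?num_real// lerDr sqr_ge0.
- have i12 : mu.-integrable setT (EFin \o (fun s => m1 s + m1 (- s))) by exact: (integrableD measurableT i1 i2).
  have i3 : mu.-integrable setT (EFin \o (fun s => l * (m1 s + m1 (- s)))) by exact: (integrableZl measurableT _ i12).
  exact: (integrableD measurableT ik i3).
Qed.

End bounds.

Section laplace_identity.
Context {R : realType}.
Local Notation mu := (@lebesgue_measure R).
Variables (a : R) (g : R -> R).
Hypotheses (a_gt0 : 0 < a) (a_lt1 : a < 1).
Hypothesis g_ge0 : forall x, 0 <= g x.
Hypothesis g_int : mu.-integrable setT (EFin \o g).
Hypothesis g_le0 : forall x : R, x <= 0 -> g x = 0.

Definition fourier_cos (s : R) := \int[mu]_x (cos (s * x) * g x).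
Definition fourier_sin (s : R) := \int[mu]_x (sin (s * x) * g x).

Hypothesis levy_eq : forall s,
  fourier_cos s * (1 - levy_cos a s) + fourier_sin s * levy_sin a s = 1.

Let mg : measurable_fun [set: R] g.
Proof. by apply/measurable_EFinP; exact: measurable_int g_int. Qed.

Let m := \int[mu]_x g x.

Let m_ge0 : 0 <= m. Proof. exact: Rintegral_ge0. Qed.

Let integrable_bounded (k : R -> R) (M : R) : measurable_fun [set: R] k -> (forall x, `|k x| <= M) ->
  mu.-integrable setT (EFin \o (fun x => k x * g x)).
Proof. by move=> mk kM; apply: (@integrableM_bounded _ _ _ M). Qed.

Let le_bounded (k : R -> R) (M : R) : measurable_fun [set: R] k -> (forall x, `|k x| <= M) ->
  `|\int[mu]_x (k x * g x)| <= M * m.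
Proof.
move=> mk kM; have ik := integrable_bounded mk kM.
rewrite (le_trans (le_normr_Rintegral measurableT ik))// /m -RintegralZl//.
apply: le_Rintegral => //.
- exact: integrable_norm.
- exact: (integrableZl measurableT _ g_int).
- by move=> x _; rewrite normrM (ger0_norm (g_ge0 x)) ler_wpM2r.
Qed.

Let ic s : mu.-integrable setT (EFin \o (fun x => cos (s * x) * g x)).
Proof.
by apply: (@integrable_bounded _ 1) => [|x]; [meas|rewrite ler_norml cos_geN1 cos_le1].
Qed.

Let is_ s : mu.-integrable setT (EFin \o (fun x => sin (s * x) * g x)).
Proof.
by apply: (@integrable_bounded _ 1) => [|x]; [meas|rewrite ler_norml sin_geN1 sin_le1].
Qed.

Let fourier_cos_le s : `|fourier_cos s| <= m.
Proof.
rewrite -[leRHS]mul1r; apply: le_bounded => [|x]; [meas|by rewrite ler_norml cos_geN1 cos_le1].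
Qed.

Let fourier_sin_le s : `|fourier_sin s| <= m.
Proof.
rewrite -[leRHS]mul1r; apply: le_bounded => [|x]; [meas|by rewrite ler_norml sin_geN1 sin_le1].
Qed.

Let mfc : measurable_fun [set: R] fourier_cos.
Proof.
apply: (measurable_fun_Rintegral (f := fun s x => cos (s * x) * g x)).
by apply: measurable_funM; [meas|exact: (measurableT_comp mg measurable_snd)].
Qed.

Let mfs : measurable_fun [set: R] fourier_sin.
Proof.
apply: (measurable_fun_Rintegral (f := fun s x => sin (s * x) * g x)).
by apply: measurable_funM; [meas|exact: (measurableT_comp mg measurable_snd)].
Qed.

(** The real part of phi(s) (e^(isy) - 1), where phi is the Fourier transform of g. *)
Let D s y := fourier_cos s * (cos (s * y) - 1) - fourier_sin s * sin (s * y).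

Let DE s y : D s y = \int[mu]_x ((cos (s * (x + y)) - cos (s * x)) * g x).
Proof.
rewrite /D /fourier_cos /fourier_sin -!RintegralZr//.
have iA : mu.-integrable setT (EFin \o (fun x => cos (s * x) * g x * (cos (s * y) - 1))) by exact: (integrableZr measurableT _ (ic s)).
have iB : mu.-integrable setT (EFin \o (fun x => sin (s * x) * g x * sin (s * y))) by exact: (integrableZr measurableT _ (is_ s)).
rewrite -RintegralB//; apply: eq_Rintegral => x _.
by rewrite (mulrDr s) cosD; ring.
Qed.

(** Any exponent strictly between a and 1 would do: above a, y^gm is integrable against the weight;
    below 1, |s|^gm is integrable against the Cauchy kernel. *)
Let gm : R := (a + 1) / 2.
Let gm1 : gm < 1. Proof. exact: (midf_lt a_lt1).2. Qed.
Let agm : a < gm. Proof. exact: (midf_lt a_lt1).1. Qed.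
Let gm0 : 0 < gm. Proof. exact: lt_trans agm. Qed.

Let D_le s y : `|D s y| <= 4 * m * (`|s| `^ gm * `|y| `^ gm).
Proof.
rewrite -powRM// -normrM /D.
have h1 : `|cos (s * y) - 1| <= 2 * `|s * y| `^ gm.
  apply: min2_le_powR => //; first exact: ltW.
    by rewrite -cos0 (le_trans (cos_lip _ _))// subr0.
  by have := cos_geN1 (s * y); have := cos_le1 (s * y); move=> *; rewrite ler_norml; apply/andP; split; lra.
have h2 : `|sin (s * y)| <= 2 * `|s * y| `^ gm.
  apply: min2_le_powR => //; first exact: ltW.
    by have := sin_lip (s * y) 0; rewrite sin0 !subr0.
  by have := sin_geN1 (s * y); have := sin_le1 (s * y); move=> *; rewrite ler_norml; apply/andP; split; lra.
rewrite (le_trans (ler_normB _ _))// !normrM.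
have -> : 4 * m * (`|s| * `|y|) `^ gm = m * (2 * `|s * y| `^ gm) + m * (2 * `|s * y| `^ gm) by rewrite normrM; ring.
by apply: lerD; apply: ler_pM.
Qed.

Variable l : R.
Hypothesis l_gt0 : 0 < l.

Definition laplace := \int[mu]_x (exp_ray l x * g x).

Let k := cauchy_kernel l.
Let k_ge0 s : 0 <= k s. Proof. exact: cauchy_kernel_ge0. Qed.
Let mk : measurable_fun [set: R] k. Proof. exact: measurable_cauchy_kernel. Qed.
Let ik : mu.-integrable setT (EFin \o k). Proof. exact: integrable_cauchy_kernel. Qed.

Let integral_k_cos : \int[mu]_s (k s * fourier_cos s) = pi * laplace.
Proof.
transitivity (\int[mu]_s \int[mu]_x (k s * (cos (s * x) * g x))).
  by apply: eq_Rintegral => s _; rewrite RintegralZl.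
rewrite (@fubini_dom _ _ k g)//; first last.
- move=> s x; rewrite normrM (ger0_norm (k_ge0 s)) ler_wpM2l// normrM (ger0_norm (g_ge0 x)) ler_piMl//.
  by rewrite ler_norml cos_geN1 cos_le1.
- apply: measurable_funM; first exact: (measurableT_comp mk measurable_fst).
  by apply: measurable_funM; [meas|exact: (measurableT_comp mg measurable_snd)].
rewrite /laplace -RintegralZl//; last first.
  apply: (@integrable_bounded _ 1); first exact: measurable_exp_ray.
  move=> x; rewrite /exp_ray; case: ifPn => [x0|_]; last by rewrite normr0.
  by rewrite ger0_norm ?expR_ge0// -expR0 ler_expR oppr_le0 mulr_ge0 ?ltW.
apply: eq_Rintegral => x _; have [x0|x0] := leP x 0.
  rewrite g_le0// !mulr0; under eq_Rintegral do rewrite !mulr0.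
  by rewrite /Rintegral integral0.
transitivity (\int[mu]_s (g x * (cos (s * x) * k s))).
  by apply: eq_Rintegral => s _; ring.
rewrite RintegralZl//; last exact: integrable_cos_cauchy.
rewrite -/(cauchy_fourier l x) cauchy_fourierE ?(ltW x0)// /exp_ray x0; ring.
Qed.

(** Here the support of g in the positive half-line enters: for x, y > 0 the transform of the kernel
    at x + y is pi e^(-lx) e^(-ly), so the dependence on y factors out of the integral against g. *)
Let integral_k_D y : 0 < y -> \int[mu]_s (k s * D s y) = pi * (expR (- (l * y)) - 1) * laplace.
Proof.
move=> y0.
have mcc s : measurable_fun [set: R] (fun x => cos (s * (x + y)) - cos (s * x)) by meas.
have bcc s x : `|cos (s * (x + y)) - cos (s * x)| <= 2.
  rewrite (le_trans (ler_normB _ _))// (_ : 2 = 1 + 1)// lerD//.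
    by rewrite ler_norml cos_geN1 cos_le1.
  by rewrite ler_norml cos_geN1 cos_le1.
transitivity (\int[mu]_s \int[mu]_x (k s * ((cos (s * (x + y)) - cos (s * x)) * g x))).
  by apply: eq_Rintegral => s _; rewrite DE RintegralZl//; exact: (@integrable_bounded _ 2).
rewrite (@fubini_dom _ _ k (fun x => 2 * g x))//; first last.
- by move=> s x; rewrite normrM (ger0_norm (k_ge0 s)) ler_wpM2l// normrM (ger0_norm (g_ge0 x)) ler_wpM2r.
- exact: (integrableZl measurableT _ g_int).
- by move=> x; rewrite mulr_ge0.
- apply: measurable_funM; first exact: (measurableT_comp mk measurable_fst).
  by apply: measurable_funM; [meas|exact: (measurableT_comp mg measurable_snd)].
rewrite /laplace -RintegralZl//; last first.
  apply: (@integrable_bounded _ 1); first exact: measurable_exp_ray.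
  move=> x; rewrite /exp_ray; case: ifPn => [x0|_]; last by rewrite normr0.
  by rewrite ger0_norm ?expR_ge0// -expR0 ler_expR oppr_le0 mulr_ge0 ?ltW.
apply: eq_Rintegral => x _; have [x0|x0] := leP x 0.
  rewrite g_le0// !mulr0; under eq_Rintegral do rewrite !mulr0.
  by rewrite /Rintegral integral0.
transitivity (\int[mu]_s (g x * (cos (s * (x + y)) * k s - cos (s * x) * k s))).
  by apply: eq_Rintegral => s _; ring.
have i1 := integrable_cos_cauchy (x + y) l_gt0; have i2 := integrable_cos_cauchy x l_gt0.
rewrite RintegralZl//; last exact: (integrableB measurableT i1 i2).
rewrite RintegralB// -/(cauchy_fourier l x) -/(cauchy_fourier l (x + y)).
have xy0 : 0 <= x + y by rewrite addr_ge0 ?ltW.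
rewrite !cauchy_fourierE ?(ltW x0)// /exp_ray x0.
have -> : - (l * (x + y)) = - (l * x) + - (l * y) by ring.
rewrite expRD; ring.
Qed.

Lemma laplace_identity :
  laplace * (1 + \int[mu]_y (levy_weight a y * (1 - expR (- (l * y))))) = 1.
Proof.
have pi0 := pi_gt0 R.
have mw := measurable_levy_weight a.
have w0 y := levy_weight_ge0 a_gt0 y.
have iw1 := integrable_levy_weightX a_gt0 a_lt1 (ltn0Sn 0).
(* The weight times y is integrable, so every measurable function that is O(y) for y > 0 can be
   integrated against the weight. *)
have iwb (h : R -> R) (M : R) : measurable_fun [set: R] h -> (forall y, 0 < y -> `|h y| <= M * y) ->
    mu.-integrable setT (EFin \o (fun y => levy_weight a y * h y)).
  move=> mh hM; apply: (@le_integrable _ _ _ mu setT measurableT _ (EFin \o (fun y => M * (levy_weight a y * y ^+ 1)))).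
  - by apply/measurable_EFinP; meas.
  - move=> y _ /=; rewrite lee_fin; case: (ltP 0 y) => y0; last first.
      by rewrite /levy_weight ltNge y0/= !mul0r mulr0.
    rewrite normrM (ger0_norm (w0 y)) mulrCA normrM (ger0_norm (w0 y)) ler_wpM2l// expr1.
    by rewrite (le_trans (hM _ y0))// ler_norm.
  - exact: (integrableZl measurableT _ iw1).
have iwc s : mu.-integrable setT (EFin \o (fun y => levy_weight a y * (cos (s * y) - 1))).
  apply: (iwb _ `|s|); first meas.
  move=> y y0; rewrite -cos0 (le_trans (cos_lip _ _))// subr0 normrM (gtr0_norm y0)//.
have iws s : mu.-integrable setT (EFin \o (fun y => levy_weight a y * sin (s * y))).
  apply: (iwb _ `|s|); first meas.
  by move=> y y0; have := sin_lip (s * y) 0; rewrite sin0 !subr0 normrM (gtr0_norm y0).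
(* [levy_eq] with the integrals of [levy_cos] and [levy_sin] collected into one; only this
   combination satisfies the Hoelder bound [D_le] used for Fubini. *)
have ID s : 1 = fourier_cos s - \int[mu]_y (levy_weight a y * D s y).
  rewrite -(levy_eq s) /levy_cos /levy_sin.
  rewrite (_ : \int[mu]_y (levy_weight a y * D s y) =
     \int[mu]_y (fourier_cos s * (levy_weight a y * (cos (s * y) - 1)) -
       fourier_sin s * (levy_weight a y * sin (s * y)))); last first.
    by apply: eq_Rintegral => y _; rewrite /D; ring.
  rewrite RintegralB//; last 2 first.
    exact: (integrableZl measurableT _ (iwc s)).
    exact: (integrableZl measurableT _ (iws s)).
  by rewrite !RintegralZl//; ring.
have mD : measurable_fun [set: R * R] (fun z => D z.1 z.2).
  have m1 := measurableT_comp mfc (@measurable_fst _ _ R R).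
  have m2 := measurableT_comp mfs (@measurable_fst _ _ R R).
  rewrite /D; apply: measurable_funB; apply: measurable_funM => //; meas.
have mf : measurable_fun [set: R * R] (fun z => k z.1 * (levy_weight a z.2 * D z.1 z.2)).
  apply: measurable_funM; first exact: (measurableT_comp mk measurable_fst).
  by apply: measurable_funM => //; exact: (measurableT_comp mw measurable_snd).
(* The weight alone is not integrable at 0; the product bound for Fubini shares the Hoelder factor
   |s y|^gm between the two variables. *)
pose u s := 4 * m * (k s * `|s| `^ gm).
pose v y := levy_weight a y * y `^ gm.
have u0 s : 0 <= u s by apply: mulr_ge0; [exact: mulr_ge0|apply: mulr_ge0 => //; exact: powR_ge0].
have v0 y : 0 <= v y by apply: mulr_ge0 => //; exact: powR_ge0.
have iu : mu.-integrable setT (EFin \o u) by exact: (integrableZl measurableT _ (integrable_cauchy_kernel_powR l_gt0 gm0 gm1)).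
have iv : mu.-integrable setT (EFin \o v) by exact: integrable_levy_weight_powR.
have fuv s y : `|k s * (levy_weight a y * D s y)| <= u s * v y.
  rewrite normrM (ger0_norm (k_ge0 s)) normrM (ger0_norm (w0 y)).
  have [y0|y0] := ltP 0 y; last by rewrite /v /levy_weight ltNge y0/= !mul0r !mulr0.
  have -> : u s * v y = k s * (levy_weight a y * (4 * m * (`|s| `^ gm * `|y| `^ gm))).
    by rewrite /u /v (gtr0_norm y0); ring.
  by rewrite ler_wpM2l// ler_wpM2l.
have E1 : pi = pi * laplace - \int[mu]_s \int[mu]_y (k s * (levy_weight a y * D s y)).
  rewrite -integral_k_cos -[LHS](_ : \int[mu]_s k s = _); last by rewrite /Rintegral integral_cauchy_kernel.
  rewrite -RintegralB//; first last.
  - exact: (integrable_fubini_dom mf u0 v0 iu iv fuv).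
  - rewrite (_ : (fun s => k s * _) = fun s => fourier_cos s * k s); last by apply/funext => s; rewrite mulrC.
    by apply: (@integrableM_bounded _ _ _ m).
  apply: eq_Rintegral => s _; rewrite RintegralZl//; last first.
    rewrite (_ : (fun y => _) = fun y => fourier_cos s * (levy_weight a y * (cos (s * y) - 1)) -
       fourier_sin s * (levy_weight a y * sin (s * y))); last by apply/funext => y; rewrite /D; ring.
    have j1 : mu.-integrable setT (EFin \o (fun y => fourier_cos s * (levy_weight a y * (cos (s * y) - 1)))) by exact: (integrableZl measurableT _ (iwc s)).
    have j2 : mu.-integrable setT (EFin \o (fun y => fourier_sin s * (levy_weight a y * sin (s * y)))) by exact: (integrableZl measurableT _ (iws s)).
    exact: (integrableB measurableT j1 j2).
  by rewrite -mulrBr -ID mulr1.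
rewrite (fubini_dom mf u0 v0 iu iv fuv) in E1.
have E2 : \int[mu]_y \int[mu]_s (k s * (levy_weight a y * D s y)) =
   \int[mu]_y (- (pi * laplace) * (levy_weight a y * (1 - expR (- (l * y))))).
  apply: eq_Rintegral => y _; have [y0|y0] := ltP 0 y; last first.
    rewrite /levy_weight ltNge y0/= mul0r mulr0.
    by under eq_Rintegral do rewrite mul0r mulr0; rewrite /Rintegral integral0.
  transitivity (\int[mu]_s (levy_weight a y * (k s * D s y))).
    by apply: eq_Rintegral => s _; ring.
  rewrite RintegralZl//; last first.
    rewrite (_ : (fun s => _) = (fun s => D s y * k s)); last by apply/funext => s; rewrite mulrC.
    apply: (@integrableM_bounded _ _ _ (2 * m + m)) => //.
      by rewrite /D; apply: measurable_funB; apply: measurable_funM => //; meas.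
    move=> s _; rewrite /D (le_trans (ler_normB _ _))// !normrM; apply: lerD.
      rewrite mulrC; apply: ler_pM => //.
      rewrite (le_trans (ler_normB _ _))// normr1 (_ : 2 = 1 + 1)// lerD2r.
      by rewrite ler_norml cos_geN1 cos_le1.
    by rewrite -[leRHS]mulr1; apply: ler_pM => //; rewrite ler_norml sin_geN1 sin_le1.
  by rewrite integral_k_D//; ring.
rewrite E2 RintegralZl// in E1; last first.
  apply: (iwb _ l); first meas.
  move=> y y0; rewrite ger0_norm; last by rewrite subr_ge0 -expR0 ler_expR oppr_le0 mulr_ge0 ?ltW.
  by have := expR_ge1Dx (- (l * y)); lra.
apply: (mulfI (lt0r_neq0 pi0)); rewrite mulr1 [RHS]E1; ring.
Qed.

End laplace_identity.

(** * The exponent at positive real arguments *)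

Section levy_tail.
Context {R : realType}.
Local Notation mu := (@lebesgue_measure R).
Variable a : R.
Hypotheses (a_gt0 : 0 < a) (a_lt1 : a < 1).

Let a1_gt0 : 0 < 1 - a. Proof. by rewrite subr_gt0. Qed.

Lemma C0_gt0 : 0 < C0 a.
Proof. by rewrite C0E// invr_gt0 mulr_gt0 ?Gamma_gt0. Qed.

Definition levy_tail (l : R) := \int[mu]_y (if 1 < y then a * y `^ (- a - 1) * expR (- (l * y)) else 0).

Definition levy_tail_fun (y : R) := if 1 < y then a * y `^ (- a - 1) else 0.

Lemma levy_tail_fun_ge0 y : 0 <= levy_tail_fun y.
Proof. by rewrite /levy_tail_fun; case: ifP => // _; rewrite mulr_ge0 ?powR_ge0 ?ltW. Qed.

Lemma measurable_levy_tail_fun : measurable_fun [set: R] levy_tail_fun. Proof. rewrite /levy_tail_fun; meas. Qed.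

Let integral_tail : (\int[mu]_y (levy_tail_fun y)%:E = 1%:E)%E.
Proof.
have := integral_powR_y a_gt0 (@ltr01 R); rewrite powR1 mul1r -integral_if_oy => h.
rewrite (_ : 1 = a * a^-1); last by rewrite mulfV ?gt_eqF.
rewrite EFinM -h -ge0_integralM ?(ltW a_gt0)//; [|meas|by move=> y; case: ifP => // _; exact: powR_ge0].
by apply: eq_integral => y _; rewrite /levy_tail_fun; case: ifP; rewrite ?mulr0.
Qed.

Let itail : mu.-integrable setT (EFin \o levy_tail_fun).
Proof. exact: (ge0_integrable measurable_levy_tail_fun levy_tail_fun_ge0 integral_tail). Qed.

Lemma levy_tail_funE (l y : R) : (if 1 < y then a * y `^ (- a - 1) * expR (- (l * y)) else 0) = exp_ray l y * levy_tail_fun y.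
Proof.
rewrite /exp_ray /levy_tail_fun; case: ifPn => y1; last by rewrite mulr0.
by rewrite (lt_trans _ y1)// mulrC.
Qed.

Lemma exp_ray_le1 (l y : R) : 0 < l -> `|exp_ray l y| <= 1.
Proof.
move=> l0; rewrite ger0_norm ?exp_ray_ge0// /exp_ray; case: ifP => // y0.
by rewrite -expR0 ler_expR oppr_le0 mulr_ge0 ?ltW.
Qed.

Lemma integrable_exp_ray_levy_tail (l : R) : 0 < l -> mu.-integrable setT (EFin \o (fun y => exp_ray l y * levy_tail_fun y)).
Proof.
move=> l0; apply: (@integrableM_bounded _ _ _ 1) => //; first exact: measurable_exp_ray.
by move=> y _; exact: exp_ray_le1.
Qed.

(** Tonelli for l e^(-lt) a y^(-a-1) over 0 < t < y gives Gamma(1-a) l^a as the integral of a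
    y^(-a-1) (1 - e^(-ly)) over all y > 0. The part y > 1 of that integral is 1 - [levy_tail a l],
    because a y^(-a-1) has mass 1 there. *)
Lemma levy_exponentE (l : R) : 0 < l ->
  1 + \int[mu]_y (levy_weight a y * (1 - expR (- (l * y)))) = Gamma (1 - a) * l `^ a + levy_tail l.
Proof.
move=> l0.
pose f (y t : R) : R := if (0 < t) && (t < y) then l * expR (- (l * t)) * (a * y `^ (- a - 1)) else 0.
have f0 y t : 0 <= f y t.
  rewrite /f; case: ifP => // _.
  by apply: mulr_ge0; apply: mulr_ge0; rewrite ?expR_ge0 ?powR_ge0 ?ltW.
have mf : measurable_fun [set: R * R] (fun z => f z.1 z.2) by rewrite /f; meas.
have := tonelli mf f0.
have inner_y t : (\int[mu]_y (f y t)%:E = (l * gamma_integrand (1 - a) l t)%:E)%E.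
  have [t0|t0] := ltP 0 t; last first.
    rewrite integral0_eq; first by rewrite /gamma_integrand ltNge t0/= mulr0.
    by move=> y _; rewrite /f ltNge t0.
  have fE y : f y t = l * expR (- (l * t)) * a * (if t < y then y `^ (- a - 1) else 0).
    by rewrite /f t0/=; case: ifP => _; rewrite ?mulr0// -!mulrA.
  under eq_integral do rewrite fE.
  rewrite ge0_integralM; last 3 first.
  - by rewrite !mulr_ge0 ?expR_ge0 ?ltW.
  - meas.
  - by move=> y; case: ifP => // _; exact: powR_ge0.
  rewrite integral_if_oy integral_powR_y// /gamma_integrand t0 -EFinM; congr EFin.
  have -> : 1 - a - 1 = - a by ring.
  by field; rewrite gt_eqF.
have inner_t y : (\int[mu]_t (f y t)%:E =
    (if 0 < y then a * y `^ (- a - 1) * (1 - expR (- (l * y))) else 0)%:E)%E.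
  case: ifPn => [y0|]; last first.
    rewrite -leNgt => y0; rewrite integral0_eq// => t _; rewrite /f ifF//.
    by apply/negbTE/negP => /andP[t0 ty]; move: y0; rewrite leNgt (lt_trans t0).
  have fE t : f y t = a * y `^ (- a - 1) * (if 0 < t < y then l * expR (- (l * t)) else 0).
    by rewrite /f; case: ifP => _; rewrite ?mulr0// mulrC.
  under eq_integral do rewrite fE.
  rewrite ge0_integralM; last 3 first.
  - by rewrite !mulr_ge0 ?powR_ge0 ?ltW.
  - meas.
  - by move=> t; case: ifP => // _; rewrite mulr_ge0 ?expR_ge0 ?ltW.
  rewrite integral_if_oo (@ge0_FTC_oo _ _ (fun t => - expR (- (l * t))) 0 y (-1) (- expR (- (l * y))))//.
  - by rewrite -EFinM; congr EFin; ring.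
  - move=> t _; split.
    + by rewrite mulr_ge0 ?expR_ge0 ?ltW.
    + apply: cvgM; first exact: cvg_cst.
      apply: (@continuous_comp _ _ _ (fun t : R => - (l * t)) expR); last exact: continuous_expR.
      by apply: cvgN; apply: cvgM => //; exact: cvg_cst.
    + by apply: is_derive_eq; rewrite /GRing.scale/=; ring.
  - rewrite -[X in _ --> - X]expR0 -[X in _ --> - expR X]oppr0 -[X in _ --> - expR (- X)](mulr0 l).
    apply: cvgN; apply: cvg_at_right_filter.
    apply: (@continuous_comp _ _ _ (fun t : R => - (l * t)) expR); last exact: continuous_expR.
    by apply: cvgN; apply: cvgM => //; exact: cvg_cst.
  - apply: cvgN; apply: cvg_at_left_filter.
    apply: (@continuous_comp _ _ _ (fun t : R => - (l * t)) expR); last exact: continuous_expR.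
    by apply: cvgN; apply: cvgM => //; exact: cvg_cst.
under [X in _ = X -> _]eq_integral do rewrite inner_y.
rewrite ge0_integralM ?(ltW l0)//; last 2 first.
- exact: measurable_gamma_integrand.
- by move=> t; exact: gamma_integrand_ge0.
rewrite integral_gamma// -EFinM.
under eq_integral do rewrite inner_t.
have -> : l * (Gamma (1 - a) * l `^ (- (1 - a))) = Gamma (1 - a) * l `^ a.
  have -> : l `^ a = l * l `^ (- (1 - a)).
    rewrite -{2}(powRr1 (ltW l0)) -powRD; last by rewrite (gt_eqF l0) implybT.
    by congr (_ `^ _); ring.
  by ring.
pose h1 y := levy_weight a y * (1 - expR (- (l * y))).
pose h2 y := levy_tail_fun y * (1 - expR (- (l * y))).
have e1 y : 0 < y -> 0 <= 1 - expR (- (l * y)).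
  by move=> y0; rewrite subr_ge0 -expR0 ler_expR oppr_le0 mulr_ge0 ?ltW.
have h10 y : 0 <= h1 y.
  rewrite /h1 /levy_weight; case: ifP => [/andP[y0 _]|_]; last by rewrite mul0r.
  by rewrite mulr_ge0 ?e1// mulr_ge0 ?powR_ge0 ?ltW.
have h20 y : 0 <= h2 y.
  rewrite /h2 /levy_tail_fun; case: ifP => [y1|_]; last by rewrite mul0r.
  by rewrite mulr_ge0 ?e1 ?(lt_trans _ y1)// mulr_ge0 ?powR_ge0 ?ltW.
have mw := measurable_levy_weight a.
have mtl := measurable_levy_tail_fun.
have mh1 : measurable_fun [set: R] h1 by rewrite /h1; meas.
have mh2 : measurable_fun [set: R] h2 by rewrite /h2; meas.
have -> : (\int[mu]_y (if 0 < y then a * y `^ (- a - 1) * (1 - expR (- (l * y))) else 0)%:E =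
   \int[mu]_y (h1 y)%:E + \int[mu]_y (h2 y)%:E)%E.
  rewrite -ge0_integralD//; last 4 first.
  - by move=> y _; rewrite lee_fin.
  - exact/measurable_EFinP.
  - by move=> y _; rewrite lee_fin.
  - exact/measurable_EFinP.
  apply: ae_eq_integral => //.
  - apply/measurable_EFinP; meas.
  - by apply: emeasurable_funD; exact/measurable_EFinP.
  - exists [set (1 : R)]; split => //; first exact: lebesgue_measure_set1.
    move=> y /= ny; apply: contrapT => /eqP y1; apply: ny => _.
    rewrite -EFinD /h1 /h2 /levy_tail_fun /levy_weight; congr EFin.
    case: (ltgtP y 1) y1 => [yl _|yg _|_ //]; rewrite ?andbT ?andbF.
      by case: ifP => _; rewrite !mul0r ?addr0.
    by rewrite (lt_trans _ yg)// mul0r add0r.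
have ih2 : mu.-integrable setT (EFin \o h2).
  rewrite (_ : h2 = fun y => levy_tail_fun y - exp_ray l y * levy_tail_fun y).
    exact: (integrableB measurableT itail (integrable_exp_ray_levy_tail l0)).
  apply/funext => y; rewrite /h2 /exp_ray /levy_tail_fun; case: ifP => [y1|_]; last by rewrite mul0r mulr0 subr0.
  by rewrite (lt_trans _ y1)//; ring.
have I2 : \int[mu]_y h2 y = 1 - levy_tail l.
  rewrite (_ : h2 = fun y => levy_tail_fun y - exp_ray l y * levy_tail_fun y); last first.
    apply/funext => y; rewrite /h2 /exp_ray /levy_tail_fun; case: ifP => [y1|_]; last by rewrite mul0r mulr0 subr0.
    by rewrite (lt_trans _ y1)//; ring.
  rewrite RintegralB//; last exact: integrable_exp_ray_levy_tail.
  rewrite [X in X - _]/Rintegral integral_tail; congr (_ - _).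
  by apply: eq_Rintegral => y _; rewrite levy_tail_funE.
have F2 : (\int[mu]_y (h2 y)%:E = (1 - levy_tail l)%:E)%E.
  by rewrite -I2 /Rintegral fineK//; exact: integrable_fin_num.
rewrite F2 -/(h1 _).
have h1' : (0 <= \int[mu]_y (h1 y)%:E)%E by apply: integral_ge0 => y _; rewrite lee_fin.
rewrite /Rintegral; case: (\int[mu]_y (h1 y)%:E)%E h1' => [r _|//|//] /= [E].
lra.
Qed.

End levy_tail.

(** * The renewal equation *)

Section renewal_kernel.
Context {R : realType}.
Local Notation mu := (@lebesgue_measure R).
Variable a : R.
Hypotheses (a_gt0 : 0 < a) (a_lt1 : a < 1).

Definition nbfun (x : R) := - bfun a x.

Lemma nbfun_ge0 x : 0 <= nbfun x.
Proof.
rewrite /nbfun /bfun; case: ifP => [x1|_]; last by rewrite oppr0.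
rewrite mulNr opprK mulr_ge0 ?(ltW (C0_gt0 a_gt0 a_lt1))// divr_ge0 ?powR_ge0//.
by rewrite ltW// (lt_trans _ x1).
Qed.

Lemma measurable_nbfun : measurable_fun [set: R] nbfun.
Proof. rewrite /nbfun /bfun; meas. Qed.

(** Boundedness of b is what makes convolution with it converge at every point: (x - 1)^a <= x^a <=
    x for x > 1. *)
Lemma nbfun_le x : nbfun x <= C0 a.
Proof.
rewrite /nbfun /bfun; case: ifP => [x1|_]; last by rewrite oppr0 ltW// C0_gt0//.
have x0 : 0 < x by exact: lt_trans x1.
rewrite mulNr opprK ler_piMr ?(ltW (C0_gt0 a_gt0 a_lt1))// ler_pdivrMr// mul1r.
apply: (@le_trans _ _ (x `^ a)).
  by apply: ge0_ler_powR; rewrite ?nnegrE ?(ltW a_gt0)//; lra.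
by apply: ler1_powR; rewrite ltW.
Qed.

(** The function -b is itself the convolution of [afun] with [levy_tail_fun]; its Laplace transform
    is therefore the product of theirs, by Tonelli on 1 < y < x. *)
Lemma integral_nbfun (l : R) : 0 < l ->
  (\int[mu]_x (exp_ray l x * nbfun x)%:E = (C0 a * Gamma a * l `^ (- a) * levy_tail a l)%:E)%E.
Proof.
move=> l0.
pose f (x y : R) : R := if (1 < y) && (y < x) then
  C0 a * expR (- (l * x)) * ((x - y) `^ (a - 1) * (a * y `^ (- a - 1))) else 0.
have f0 x y : 0 <= f x y.
  rewrite /f; case: ifP => // _.
  by apply: mulr_ge0; apply: mulr_ge0; rewrite ?expR_ge0 ?powR_ge0 ?(ltW (C0_gt0 a_gt0 a_lt1))// mulr_ge0 ?powR_ge0 ?ltW.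
have mf : measurable_fun [set: R * R] (fun z => f z.1 z.2) by rewrite /f; meas.
have m1 y : measurable_fun [set: R] (f ^~ y) by rewrite /f; meas.
have := tonelli mf f0.
have inner_x y : (\int[mu]_x (f x y)%:E = ((C0 a * Gamma a * l `^ (- a)) * (exp_ray l y * levy_tail_fun a y))%:E)%E.
  have [y1|y1] := ltP 1 y; last first.
    rewrite integral0_eq; first by rewrite /levy_tail_fun ltNge y1/= !mulr0.
    by move=> x _; rewrite /f (ltNge 1) y1.
  rewrite (@ge0_integral_affine _ y 1)// ?mul1e; last 2 first.
    by apply/measurable_EFinP; exact: m1.
    by move=> x; rewrite lee_fin.
  have fE t : f (y + 1 * t) y = C0 a * (exp_ray l y * levy_tail_fun a y) * gamma_integrand a l t.
    rewrite /f /levy_tail_fun /exp_ray /gamma_integrand y1 mul1r (lt_trans _ y1)// ltrDl/=.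
    case: ifP => _; last by rewrite !mulr0.
    rewrite (addrC y t) addrK mulrDr opprD expRD; ring.
  under eq_integral do rewrite fE.
  rewrite ge0_integralM; last 3 first.
  - by rewrite mulr_ge0 ?(ltW (C0_gt0 a_gt0 a_lt1))// mulr_ge0 ?exp_ray_ge0 ?levy_tail_fun_ge0.
  - exact: measurable_gamma_integrand.
  - by move=> t; exact: gamma_integrand_ge0.
  by rewrite integral_gamma// -EFinM; congr EFin; ring.
have inner_y x : (\int[mu]_y (f x y)%:E = (exp_ray l x * nbfun x)%:E)%E.
  have [x1|x1] := ltP 1 x; last first.
    rewrite integral0_eq; first by rewrite /nbfun /bfun ltNge x1/= oppr0 mulr0.
    by move=> y _; rewrite /f ifF//; apply/negbTE/negP => /andP[y1 yx]; move: x1; rewrite leNgt (lt_trans y1).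
  have x0 : 0 < x by exact: lt_trans x1.
  have fE y : f x y = C0 a * expR (- (l * x)) * (if 1 < y < x then (x - y) `^ (a - 1) * (a * y `^ (- a - 1)) else 0).
    by rewrite /f; case: ifP => _; rewrite ?mulr0.
  under eq_integral do rewrite fE.
  rewrite ge0_integralM; last 3 first.
  - by rewrite mulr_ge0 ?expR_ge0 ?(ltW (C0_gt0 a_gt0 a_lt1)).
  - meas.
  - by move=> y; case: ifP => // _; rewrite mulr_ge0 ?powR_ge0// mulr_ge0 ?powR_ge0 ?ltW.
  (* That is, - ((x - y) / y)^a / x; the derivative of (x - y) / y is - x / y^2, which explains the
     factor 1 / x, the origin of the denominator of b. *)
  pose F y := - (x^-1 * ((x - y) `^ a * y `^ (- a))).
  have dF y : 1 < y < x -> is_derive y 1 F ((x - y) `^ (a - 1) * (a * y `^ (- a - 1))).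
    move=> /andP[y1 yx]; have y0 : 0 < y by exact: lt_trans y1.
    have xy0 : 0 < x - y by rewrite subr_gt0.
    have d1 : is_derive y 1 (fun y => (x - y) `^ a) (- (a * (x - y) `^ (a - 1))).
      have := @is_derive_powR _ a (x - y) xy0 => d.
      have d2 : is_derive y 1 (fun y => x - y) (-1).
        by apply: is_derive_eq; rewrite add0r mul1r.
      have := @is_derive1_comp _ (fun z => z `^ a) (fun y => x - y) y _ _ d d2.
      by rewrite /comp /GRing.scale/= ?mulrN1 ?mulN1r.
    have d2 := @is_derive_powR _ (- a) y y0.
    apply: is_derive_eq; rewrite /GRing.scale/=.
    have -> : y `^ (- a) = y * y `^ (- a - 1).
      rewrite -{2}(powRr1 (ltW y0)) -powRD; last by rewrite (gt_eqF y0) implybT.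
      by congr (_ `^ _); ring.
    rewrite -(mulr_powRB1 (ltW xy0) a_gt0).
    by field; rewrite gt_eqF.
  rewrite integral_if_oo (@ge0_FTC_oo _ _ F 1 x (- (x^-1 * (x - 1) `^ a)) 0)//.
  - rewrite sub0r opprK -EFinM /exp_ray x0 /nbfun /bfun x1; congr EFin; ring.
  - move=> y /andP[y1 yx]; have y0 : 0 < y by exact: lt_trans y1.
    split; last by apply: dF; rewrite y1.
    + by rewrite mulr_ge0 ?powR_ge0// mulr_ge0 ?powR_ge0 ?ltW.
    + apply: cvgM.
        apply: (@continuous_comp _ _ _ (fun y : R => x - y) (fun z => z `^ (a - 1))).
          by apply: cvgB; [exact: cvg_cst|exact: cvg_id].
        by apply: continuous_powR; rewrite subr_gt0.
      by apply: cvgM; [exact: cvg_cst|exact: continuous_powR].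
  - rewrite (_ : x^-1 * (x - 1) `^ a = x^-1 * ((x - 1) `^ a * 1 `^ (- a))); last by rewrite powR1 mulr1.
    apply: cvgN; apply: cvg_at_right_filter; apply: cvgM; first exact: cvg_cst.
    apply: cvgM; last exact: continuous_powR.
    apply: (@continuous_comp _ _ _ (fun y : R => x - y) (fun z => z `^ a)).
      by apply: cvgB; [exact: cvg_cst|exact: cvg_id].
    by apply: continuous_powR; rewrite subr_gt0.
  - suff : F y @[y --> x^'-] --> - (x^-1 * (0 * x `^ (- a))) by rewrite mul0r mulr0 oppr0.
    apply: cvgN; apply: cvgM; first exact: cvg_cst.
    apply: cvgM; last by apply: cvg_at_left_filter; exact: continuous_powR.
    apply: (@cvg_comp _ _ _ (fun y => x - y) (fun z => z `^ a) _ (0^'+)); last exact: powR_cvg0.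
    move=> A /= [e e0 Ae]; exists e => //= y /= ye yx; apply: Ae => /=; last by rewrite subr_gt0.
    by rewrite sub0r normrN.
under eq_integral do rewrite inner_y.
move=> ->; under eq_integral do rewrite inner_x.
have Cpos : 0 <= C0 a * Gamma a * l `^ (- a).
  by rewrite mulr_ge0 ?powR_ge0// mulr_ge0 ?(ltW (C0_gt0 a_gt0 a_lt1))// ltW// Gamma_gt0.
have ge0 y : 0 <= exp_ray l y * levy_tail_fun a y by rewrite mulr_ge0 ?exp_ray_ge0 ?levy_tail_fun_ge0.
have it := integrable_exp_ray_levy_tail a_gt0 l0.
rewrite ge0_integralM//; last by apply/measurable_EFinP; exact: measurable_int it.
rewrite [in RHS]EFinM; congr (_ * _)%E.
rewrite /levy_tail /Rintegral; under [X in _ = (fine X)%:E]eq_integral do rewrite levy_tail_funE.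
by rewrite fineK//; exact: integrable_fin_num.
Qed.

End renewal_kernel.

Section renewal.
Context {R : realType}.
Local Notation mu := (@lebesgue_measure R).
Variables (a : R) (g : R -> R).
Hypotheses (a_gt0 : 0 < a) (a_lt1 : a < 1).
Hypothesis g_ge0 : forall x, 0 <= g x.
Hypothesis g_int : mu.-integrable setT (EFin \o g).
Hypothesis g_le0 : forall x : R, x <= 0 -> g x = 0.
Hypothesis levy_eq : forall s,
  fourier_cos g s * (1 - levy_cos a s) + fourier_sin g s * levy_sin a s = 1.

Let mg : measurable_fun [set: R] g.
Proof. by apply/measurable_EFinP; exact: measurable_int g_int. Qed.

Let h (x : R) := \int[mu]_y (g y * nbfun a (x - y)).

Let mnb (x : R) : measurable_fun [set: R] (fun y => nbfun a (x - y)).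
Proof. by apply: (measurableT_comp (measurable_nbfun a)); meas. Qed.

Let nb0 x : 0 <= nbfun a x. Proof. exact: nbfun_ge0. Qed.

Let ih x : mu.-integrable setT (EFin \o (fun y => g y * nbfun a (x - y))).
Proof.
rewrite (_ : (fun y => _) = (fun y => nbfun a (x - y) * g y)); last by apply/funext => y; rewrite mulrC.
apply: (@integrableM_bounded _ _ _ (C0 a)) => // y _.
by rewrite ger0_norm// nbfun_le.
Qed.

Lemma convolutionN x : convolution g (bfun a) x = - h x.
Proof.
rewrite -mulN1r -RintegralZl//; apply: eq_Rintegral => y _.
by rewrite /nbfun mulrN mulN1r opprK.
Qed.

Let mf : measurable_fun [set: R * R] (fun z => g z.2 * nbfun a (z.1 - z.2)).
Proof.
apply: measurable_funM; first exact: (measurableT_comp mg measurable_snd).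
by apply: (measurableT_comp (measurable_nbfun a)); meas.
Qed.

Let mh : measurable_fun [set: R] h.
Proof. exact: (measurable_fun_Rintegral (f := fun x y => g y * nbfun a (x - y))). Qed.

Let h_ge0 x : 0 <= h x.
Proof. by apply: Rintegral_ge0 => y _; rewrite mulr_ge0. Qed.

Let h_le0 x : x <= 0 -> h x = 0.
Proof.
move=> x0; rewrite /h /Rintegral integral0_eq// => y _.
have [y0|y0] := leP y 0; first by rewrite g_le0// mul0r.
by rewrite /nbfun /bfun ifF ?oppr0 ?mulr0//; apply/negbTE; rewrite -leNgt; lra.
Qed.

Let ilap (l : R) : 0 < l -> mu.-integrable setT (EFin \o (fun x => exp_ray l x * g x)).
Proof.
move=> l0; apply: (@integrableM_bounded _ _ _ 1) => //; first exact: measurable_exp_ray.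
by move=> x _; exact: exp_ray_le1.
Qed.

Let integral_exp_h (l : R) : 0 < l ->
  (\int[mu]_x (exp_ray l x * h x)%:E = (laplace g l * (C0 a * Gamma a * l `^ (- a) * levy_tail a l))%:E)%E.
Proof.
move=> l0; have mel := measurable_exp_ray l.
pose f x y := exp_ray l x * (g y * nbfun a (x - y)).
have f0 x y : 0 <= f x y by rewrite /f mulr_ge0 ?exp_ray_ge0// mulr_ge0.
have mf' : measurable_fun [set: R * R] (fun z => f z.1 z.2).
  by apply: measurable_funM => //; exact: (measurableT_comp mel measurable_fst).
have m1 y : measurable_fun [set: R] (f ^~ y).
  exact: (measurable_fun_pair1 (f := fun z => f z.1 z.2)).
transitivity (\int[mu]_x \int[mu]_y (f x y)%:E)%E.
  apply: eq_integral => x _; rewrite ge0_integralM ?exp_ray_ge0//.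
  - by rewrite EFinM /h /Rintegral fineK//; exact: (integrable_fin_num measurableT (ih x)).
  - by apply: measurable_funM.
  - by move=> y; rewrite mulr_ge0.
rewrite tonelli//.
have inner y : (\int[mu]_x (f x y)%:E = (C0 a * Gamma a * l `^ (- a) * levy_tail a l)%:E * (exp_ray l y * g y)%:E)%E.
  have [y0|y0] := leP y 0.
    rewrite integral0_eq; first by rewrite g_le0// mulr0 mule0.
    by move=> x _; rewrite /f g_le0// mul0r mulr0.
  rewrite (@ge0_integral_affine _ y 1)// ?mul1e; last 2 first.
    by apply/measurable_EFinP; exact: m1.
    by move=> x; rewrite lee_fin.
  have fE t : f (y + 1 * t) y = (exp_ray l y * g y) * (exp_ray l t * nbfun a t).
    rewrite /f mul1r (addrC y t) addrK; have [t0|t0] := ltP 0 t; last first.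
      have -> : nbfun a t = 0 by rewrite /nbfun /bfun ifF ?oppr0//; apply/negbTE; rewrite -leNgt; lra.
      by rewrite !mulr0.
    rewrite /exp_ray y0 t0 addr_gt0//.
    have -> : - (l * (t + y)) = - (l * y) + - (l * t) by ring.
    rewrite expRD; ring.
  under eq_integral do rewrite fE.
  rewrite ge0_integralM ?mulr_ge0 ?exp_ray_ge0//.
  - by rewrite integral_nbfun// muleC.
  - have := measurable_nbfun a => mn; meas.
  - by move=> t; rewrite mulr_ge0 ?exp_ray_ge0.
under eq_integral do rewrite inner.
rewrite ge0_integralZl//.
- rewrite /laplace [in RHS]mulrC [RHS]EFinM; congr (_ * _)%E.
  by rewrite /Rintegral fineK//; apply: integrable_fin_num => //; exact: ilap.
- by apply/measurable_EFinP; meas.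
- by move=> y _; rewrite lee_fin mulr_ge0 ?exp_ray_ge0.
- rewrite lee_fin mulr_ge0//; last by apply: Rintegral_ge0 => y _; case: ifP => // _; rewrite !mulr_ge0 ?powR_ge0 ?expR_ge0 ?ltW.
  by rewrite mulr_ge0 ?powR_ge0// mulr_ge0 ?(ltW (C0_gt0 _ _))// ltW// Gamma_gt0.
Qed.

Let integral_exp_a (l : R) : 0 < l ->
  (\int[mu]_x (exp_ray l x * afun a x)%:E = (C0 a * Gamma a * l `^ (- a))%:E)%E.
Proof.
move=> l0; rewrite -mulrA EFinM -integral_gamma// -ge0_integralM ?(ltW (C0_gt0 _ _))//.
- apply: eq_integral => x _; rewrite /exp_ray /afun /gamma_integrand.
  by case: ifP => _; congr EFin; ring.
- exact: measurable_gamma_integrand.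
- by move=> x; exact: gamma_integrand_ge0.
Qed.

Lemma renewal_ae : {ae mu, forall x, g x - afun a x = convolution g (bfun a) x}.
Proof.
have ma : measurable_fun [set: R] (afun a) by rewrite /afun; meas.
have a0 x : 0 <= afun a x.
  by rewrite /afun; case: ifP => // _; rewrite mulr_ge0 ?powR_ge0 ?(ltW (C0_gt0 _ _)).
have ieh (l : R) : 0 < l -> mu.-integrable setT (EFin \o (fun x => exp_ray l x * h x)).
  move=> l0; have me := measurable_exp_ray l; apply: ge0_integrable (integral_exp_h l0); first meas.
  by move=> x; rewrite mulr_ge0 ?exp_ray_ge0.
have iea (l : R) : 0 < l -> mu.-integrable setT (EFin \o (fun x => exp_ray l x * afun a x)).
  move=> l0; have me := measurable_exp_ray l; apply: ge0_integrable (integral_exp_a l0); first meas.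
  by move=> x; rewrite mulr_ge0 ?exp_ray_ge0.
(* The power a is not integrable at infinity; the factor e^(-x) remedies this and shifts the Laplace
   variable from n to n + 1 > 0. *)
pose f x := exp_ray 1 x * g x + exp_ray 1 x * h x - exp_ray 1 x * afun a x.
have fint (l : R) : 0 < l -> mu.-integrable setT (EFin \o (fun x => exp_ray l x * g x + exp_ray l x * h x)).
  by move=> l0; exact: (integrableD measurableT (ilap l0) (ieh _ l0)).
have fi : mu.-integrable setT (EFin \o f).
  exact: (integrableB measurableT (fint 1 ltr01) (iea 1 ltr01)).
have f_le0 (x : R) : x <= 0 -> f x = 0.
  by move=> x0; rewrite /f /exp_ray ltNge x0/= !mul0r addr0 subr0.
have := laplace_eq0 fi f_le0.
have L0 (n : nat) : \int[mu]_x (expR (- (n%:R * x)) * f x) = 0.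
  have n0 : 0 < n%:R + 1 :> R by rewrite ltr_wpDl.
  set l : R := n%:R + 1 in n0 *.
  transitivity (\int[mu]_x (exp_ray l x * g x + exp_ray l x * h x - exp_ray l x * afun a x)).
    apply: eq_Rintegral => x _; rewrite /f /exp_ray; case: ifP => _; last by rewrite !mul0r subr0 addr0 mulr0.
    have -> : - (l * x) = - (n%:R * x) + - (1 * x) by rewrite /l; ring.
    by rewrite expRD; ring.
  rewrite RintegralB//; [|exact: fint|exact: iea].
  rewrite RintegralD//; [|exact: ilap|exact: ieh].
  rewrite -/(laplace g l) [X in _ + X - _]/Rintegral integral_exp_h// [X in _ - X]/Rintegral integral_exp_a//=.
  have := laplace_identity a_gt0 a_lt1 g_ge0 g_int g_le0 levy_eq n0.
  rewrite levy_exponentE// => E.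
  (* By the reflection formula, the transform of the function a is exactly the inverse of the term
     Gamma(1-a) l^a of the exponent. *)
  have E2 : C0 a * Gamma a * l `^ (- a) * (Gamma (1 - a) * l `^ a) = 1.
    have lp : l `^ (- a) * l `^ a = 1 by rewrite powRN mulVf// gt_eqF// powR_gt0.
    have Cp : C0 a * Gamma a * Gamma (1 - a) = 1.
      by rewrite C0E// -mulrA (mulrC (Gamma a)) mulVf// gt_eqF// mulr_gt0 ?Gamma_gt0 ?subr_gt0.
    by rewrite mulrACA lp mulr1 Cp.
  move: E E2; set A := C0 a * Gamma a * l `^ (- a); set L := laplace g l; set T := levy_tail a l; set G := Gamma _ * _.
  move=> E E2; apply/eqP; rewrite subr_eq0; apply/eqP.
  rewrite -[RHS]mulr1 -E -[X in X + _]mulr1 -E2; ring.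
move=> /(_ L0); apply: filterS; first exact: (ae_filter_ringOfSetsType mu).
move=> x; rewrite convolutionN; have [x0|x0] := leP x 0.
  by rewrite g_le0// h_le0// /afun ltNge x0/= subrr oppr0.
rewrite /f /exp_ray x0 -mulrDr -mulrBr => /eqP; rewrite mulf_eq0 expR_eq0/= => /eqP; lra.
Qed.

End renewal.

(** * Expectations and support in terms of the density *)

Section density.
Context {R : realType}.
Local Notation mu := (@lebesgue_measure R).
Variables (P : probability (measurableTypeR R) R) (g : R -> R).
Hypothesis g_density : is_density P g.

Let mg : measurable_fun [set: measurableTypeR R] g. Proof. by case: g_density. Qed.
Let g0 x : 0 <= g x. Proof. by case: g_density. Qed.
Let PE (A : set (measurableTypeR R)) : measurable A -> P A = (\int[mu]_(x in A) (g x)%:E)%E.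
Proof. by case: g_density => _ _; apply. Qed.

Lemma integral_density1 : (\int[mu]_x (g x)%:E = 1%:E)%E.
Proof. by rewrite -PE// probability_setT. Qed.

Lemma integrable_density : mu.-integrable setT (EFin \o g).
Proof. exact: ge0_integrable integral_density1. Qed.

(** The Radon-Nikodym derivative of P integrates like g over every measurable set, so they agree
    almost everywhere and the change of variables for the former transfers to g. *)
Lemma ge0_integral_density (f : R -> R) : measurable_fun [set: R] f -> (forall x, 0 <= f x) ->
  (\int[P]_x (f x)%:E = \int[mu]_x (f x * g x)%:E)%E.
Proof.
move=> mf f0.
have Pmu : P `<< mu.
  apply/null_content_dominatesP => A mA A0; rewrite PE//.
  rewrite null_set_integral//; by apply/measurable_EFinP; exact: measurable_funS mg.
rewrite -(Radon_Nikodym_SigmaFinite.change_of_variables (mu := mu) Pmu)//; last exact/measurable_EFinP.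
have iRN := Radon_Nikodym_SigmaFinite.f_integrable (mu := mu) Pmu.
have mRN := measurable_int _ iRN.
apply: ae_eq_integral => //.
- by apply: emeasurable_funM => //; exact/measurable_EFinP.
- by apply/measurable_EFinP; meas.
have : ae_eq mu setT (Radon_Nikodym_SigmaFinite.f P mu) (EFin \o g).
  apply: integral_ae_eq => //; first exact/measurable_EFinP.
  by move=> E _ mE; rewrite -(Radon_Nikodym_SigmaFinite.f_integral Pmu mE); exact: PE.
move=> [N [mN N0 sN]]; exists N; split => // x /= xN; apply: sN => /= H; apply: xN => _.
by rewrite H.
Qed.

Lemma Rintegral_density (h : R -> R) (M : R) : measurable_fun [set: R] h -> (forall x, `|h x| <= M) ->
  \int[P]_x h x = \int[mu]_x (h x * g x).
Proof.
move=> mh hM; have M0 : 0 <= M by exact: le_trans (hM 0).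
have ig := integrable_density.
have icP : P.-integrable setT (EFin \o (fun=> M)).
  exact: finite_measure_integrable_cst.
have ihP : P.-integrable setT (EFin \o h).
  apply: (le_integrable measurableT _ _ icP); first exact/measurable_EFinP.
  by move=> x _ /=; rewrite lee_fin (ger0_norm M0).
have ihg : mu.-integrable setT (EFin \o (fun x => h x * g x)).
  by apply: (@integrableM_bounded _ _ _ M).
have icg : mu.-integrable setT (EFin \o (fun x => M * g x)).
  by apply: (@integrableM_bounded _ _ _ M) => // x _; rewrite ger0_norm.
(* Shifting by the bound M makes the integrand nonnegative, so that [ge0_integral_density]
   applies. *)
have E1 : \int[P]_x (h x + M) = \int[mu]_x (h x * g x + M * g x).
  rewrite /Rintegral ge0_integral_density//; last 2 first.
    by meas.
    by move=> x; have := hM x; rewrite ler_norml => /andP[]; lra.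
  by congr fine; apply: eq_integral => x _; congr EFin; ring.
have E2 : \int[P]_x M = \int[mu]_x (M * g x).
  by rewrite /Rintegral ge0_integral_density.
by move: E1; rewrite RintegralD// RintegralD// E2 => /addIr.
Qed.

Lemma charfun_density (s : R) :
  charfun P s = ((\int[mu]_x (cos (s * x) * g x)) +i* (\int[mu]_x (sin (s * x) * g x)))%C.
Proof.
rewrite /charfun (@Rintegral_density _ 1) ?(@Rintegral_density (fun x => sin (s * x)) 1)//.
- by meas.
- by move=> x; rewrite ler_norml sin_geN1 sin_le1.
- by meas.
- by move=> x; rewrite ler_norml cos_geN1 cos_le1.
Qed.

Lemma density_le0 : P [set x | 0 <= x] = 1%E -> {ae mu, forall x : R, x <= 0 -> g x = 0}.
Proof.
move=> P1.
have mD : measurable (`]-oo, 0[%classic : set (measurableTypeR R)) by exact: measurable_itv.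
have P0 : P `]-oo, 0[%classic = 0%E.
  have -> : `]-oo, 0[%classic = ~` [set x : R | 0 <= x].
    by apply/seteqP; split => x /=; rewrite in_itv/= ltNge => /negP.
  rewrite probability_setC ?P1 ?subee// -[X in measurable X](_ : `[0, +oo[%classic = _) //.
  by apply/seteqP; split => x /=; rewrite in_itv/= andbT.
rewrite PE// in P0.
have : ae_eq mu `]-oo, 0[%classic (EFin \o g) (cst 0%E).
  apply/ae_eq_integral_abs => //.
    by apply/measurable_EFinP; exact: measurable_funS mg.
  by rewrite -[RHS]P0; apply: eq_integral => x _; rewrite gee0_abs// lee_fin.
have : {ae mu, forall x : R, x <> 0}.
  exists [set 0]; split => //; first by rewrite lebesgue_measure_set1.
  by move=> x /= /contrapT.
apply: filterS2; first exact: (ae_filter_ringOfSetsType mu).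
move=> x x0 gx xle.
have xD : `]-oo, 0[%classic x by rewrite /= in_itv/= lt_neqAle xle andbT; apply/eqP.
by case: (gx xD).
Qed.

End density.

Section DM_density.
Context {R : realType}.
Local Notation mu := (@lebesgue_measure R).
Variables (a : R) (P : probability (measurableTypeR R) R) (g : R -> R).
Hypotheses (a_gt0 : 0 < a) (a_lt1 : a < 1).
Hypotheses (P_DM : is_DM a P) (g_density : is_density P g).

(** A density may be nonzero on a null set of x <= 0; cutting it off there gives a version that
    vanishes at every such x, as the support arguments require. *)
Lemma DM_renewal : exists g' : R -> R, [/\ mu.-integrable setT (EFin \o g'),
  (forall x : R, x <= 0 -> g' x = 0), {ae mu, forall x, g' x = g x} &
  {ae mu, forall x, g' x - afun a x = convolution g' (bfun a) x}].
Proof.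
have [mg g0 _] := g_density.
have ig := integrable_density g_density.
pose g' (x : R) := if 0 < x then g x else 0.
have mg' : measurable_fun [set: R] g' by rewrite /g'; meas.
have g'0 x : 0 <= g' x by rewrite /g'; case: ifP.
have ig' : mu.-integrable setT (EFin \o g').
  apply: (le_integrable measurableT _ _ ig); first exact/measurable_EFinP.
  by move=> x _ /=; rewrite lee_fin /g'; case: ifP => // _; rewrite normr0.
have g'le0 (x : R) : x <= 0 -> g' x = 0 by move=> x0; rewrite /g' ltNge x0.
have g'g : {ae mu, forall x, g' x = g x}.
  have := density_le0 g_density P_DM.1; apply: filterS; first exact: (ae_filter_ringOfSetsType mu).
  by move=> x gx; rewrite /g'; case: ltP => // /gx.
exists g'; split => //.
apply: renewal_ae => // s.
have Eint (h : R -> R) : measurable_fun [set: R] h -> \int[mu]_x (h x * g' x) = \int[mu]_x (h x * g x).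
  move=> mh; rewrite /Rintegral; congr fine; apply: ae_eq_integral => //.
  - by apply/measurable_EFinP; meas.
  - by apply/measurable_EFinP; meas.
  move: g'g; apply: filterS; first exact: (ae_filter_ringOfSetsType mu).
  by move=> x -> _.
apply: DM_charfunE => //; rewrite -P_DM.2 (charfun_density g_density).
by rewrite /fourier_cos /fourier_sin !Eint//; meas.
Qed.

End DM_density.

(** * Iterated convolutions and the finite renewal expansion *)

Section locally_integrable.
Context {R : realType}.
Local Notation mu := (@lebesgue_measure R).

Definition trunc_right (T : R) (f : R -> R) (x : R) : R := if x <= T then f x else 0.

(** The function a is not integrable at infinity, so integrability is only asked up to each T;
    together with vanishing for x <= 0 this is stable under convolution with the bounded function
    b. *)
Definition locL1 (f : R -> R) := [/\ measurable_fun [set: R] f, (forall x : R, x <= 0 -> f x = 0) &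
  forall T, mu.-integrable setT (EFin \o trunc_right T f)].

Lemma integrable_box (v M : R) : 0 < v -> 0 <= M ->
  mu.-integrable setT (EFin \o (fun x => if 0 < x < v then M else 0)).
Proof.
move=> v0 M0; apply: (@ge0_integrable _ _ (M * v)); first meas.
  by move=> x; case: ifP.
rewrite integral_if_oo integral_cst//= lebesgue_measure_itv/= lte_fin v0 oppr0 adde0.
by rewrite EFinM.
Qed.

Variable a : R.
Hypotheses (a_gt0 : 0 < a) (a_lt1 : a < 1).

Lemma bfun_le1 (x : R) : x <= 1 -> bfun a x = 0.
Proof. by move=> x1; rewrite /bfun ltNge x1. Qed.

Lemma measurable_bfun : measurable_fun [set: R] (bfun a).
Proof. rewrite /bfun; meas. Qed.

Lemma norm_bfun_le (x : R) : `|bfun a x| <= C0 a.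
Proof.
have := nbfun_ge0 a_gt0 a_lt1 x; have := nbfun_le a_gt0 a_lt1 x; rewrite /nbfun.
by move=> h1 h2; rewrite ler0_norm -?oppr_ge0.
Qed.

Let C0_ge0 : 0 <= C0 a. Proof. exact: ltW (C0_gt0 a_gt0 a_lt1). Qed.

(** Since b(x - y) = 0 once y >= x - 1, convolution at x <= T only sees f up to T. *)
Lemma conv_truncE (f : R -> R) (T x y : R) : x <= T -> f y * bfun a (x - y) = bfun a (x - y) * trunc_right T f y.
Proof.
move=> xT; rewrite /trunc_right; case: ifPn; first by rewrite mulrC.
by rewrite -ltNge => Ty; rewrite bfun_le1 ?mulr0 ?mul0r//; lra.
Qed.

Lemma integrable_conv (f : R -> R) (x : R) : locL1 f ->
  mu.-integrable setT (EFin \o (fun y => f y * bfun a (x - y))).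
Proof.
move=> [mf f0 fi].
rewrite (_ : (fun y => _) = fun y => bfun a (x - y) * trunc_right x f y); last first.
  by apply/funext => y; exact: conv_truncE.
apply: (@integrableM_bounded _ _ _ (C0 a)) => //.
  by apply: (measurableT_comp measurable_bfun); meas.
by move=> y _; exact: norm_bfun_le.
Qed.

Lemma measurable_conv (f : R -> R) : locL1 f -> measurable_fun [set: R] (convolution f (bfun a)).
Proof.
move=> [mf _ _]; apply: (measurable_fun_Rintegral (f := fun x y => f y * bfun a (x - y))).
apply: measurable_funM; first exact: (measurableT_comp mf measurable_snd).
by apply: (measurableT_comp measurable_bfun); meas.
Qed.

Lemma norm_conv_le (f : R -> R) (T x : R) : locL1 f -> x <= T ->
  `|convolution f (bfun a) x| <= C0 a * \int[mu]_y `|trunc_right T f y|.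
Proof.
move=> Lf xT; have [mf f0 fi] := Lf; have ic := integrable_conv x Lf.
rewrite (le_trans (le_normr_Rintegral measurableT ic))// -RintegralZl//; last exact: integrable_norm (fi T).
apply: le_Rintegral => //.
- exact: integrable_norm.
- exact: (integrableZl measurableT _ (integrable_norm (fi T))).
- by move=> y _; rewrite (conv_truncE f y xT) normrM ler_wpM2r// norm_bfun_le.
Qed.

Lemma conv_eq0 (f : R -> R) (n x : R) : (forall y, y <= n -> f y = 0) -> x <= n + 1 ->
  convolution f (bfun a) x = 0.
Proof.
move=> f0 xn; rewrite /convolution /Rintegral integral0_eq// => y _.
have [yn|yn] := leP y n; first by rewrite f0// mul0r.
by rewrite bfun_le1 ?mulr0//; lra.
Qed.

Lemma locL1_conv (f : R -> R) : locL1 f -> locL1 (convolution f (bfun a)).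
Proof.
move=> Lf; have [mf f0 fi] := Lf; have mc := measurable_conv Lf; split => // [x x0|T].
  by apply: (conv_eq0 f0); lra.
pose M := C0 a * \int[mu]_y `|trunc_right T f y|.
have M0 : 0 <= M by apply: (le_trans _ (norm_conv_le Lf (lexx T))).
have V0 : 0 < `|T| + 1 by rewrite ltr_wpDl.
apply: (le_integrable measurableT _ _ (integrable_box V0 M0)).
  by apply/measurable_EFinP; rewrite /trunc_right; meas.
move=> x _ /=; rewrite lee_fin /trunc_right; have [xT|xT] := leP x T; last by rewrite normr0.
have [x0|x0] := leP x 0; first by rewrite (conv_eq0 f0) ?normr0//; lra.
rewrite (_ : x < `|T| + 1); last by have := ler_norm T; lra.
by rewrite (ger0_norm M0) norm_conv_le.
Qed.

Lemma convB (f1 f2 : R -> R) x : locL1 f1 -> locL1 f2 ->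
  convolution (fun y => f1 y - f2 y) (bfun a) x = convolution f1 (bfun a) x - convolution f2 (bfun a) x.
Proof.
move=> L1 L2; rewrite /convolution -RintegralB//; try exact: integrable_conv.
by apply: eq_Rintegral => y _; rewrite mulrBl.
Qed.

Lemma eq_ae_conv (f1 f2 : R -> R) x : locL1 f1 -> measurable_fun [set: R] f2 ->
  {ae mu, forall y, f2 y = f1 y} ->
  convolution f2 (bfun a) x = convolution f1 (bfun a) x.
Proof.
move=> [mf1 _ _] mf2 f12; rewrite /convolution /Rintegral; congr fine.
have mb : measurable_fun [set: R] (fun y => bfun a (x - y)).
  by apply: (measurableT_comp measurable_bfun); meas.
apply: ae_eq_integral => //; try (by apply/measurable_EFinP; meas).
move: f12; apply: filterS; first exact: (ae_filter_ringOfSetsType mu).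
by move=> y -> _.
Qed.

Lemma locL1_afun : locL1 (afun a).
Proof.
have ma : measurable_fun [set: R] (afun a) by rewrite /afun; meas.
split => //; first by move=> x x0; rewrite /afun ltNge x0.
move=> T; have V0 : 0 < `|T| + 1 by rewrite ltr_wpDl.
have i1 : mu.-integrable setT (EFin \o (fun x => if 0 < x < `|T| + 1 then x `^ (a - 1) else 0)).
  apply: (@ge0_integrable _ _ ((`|T| + 1) `^ a / a)); first meas.
    by move=> x; case: ifP => // _; exact: powR_ge0.
  by rewrite integral_if_oo integral_powR_0.
have i2 : mu.-integrable setT (EFin \o (fun x => C0 a * (if 0 < x < `|T| + 1 then x `^ (a - 1) else 0))).
  exact: (integrableZl measurableT _ i1).
apply: (le_integrable measurableT _ _ i2).
  by apply/measurable_EFinP; rewrite /trunc_right; meas.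
move=> x _ /=; rewrite lee_fin /trunc_right /afun; have [xT|xT] := leP x T; last by rewrite normr0.
rewrite (_ : x < `|T| + 1) ?andbT; last by have := ler_norm T; lra.
by case: ifP => _; rewrite ?mulr0.
Qed.

Lemma gkS k : gk a k.+1 = convolution (gk a k) (bfun a).
Proof. by []. Qed.

Lemma locL1_gk k : locL1 (gk a k).
Proof. by elim: k => [|k IH]; [exact: locL1_afun|rewrite gkS; exact: locL1_conv]. Qed.

Lemma gk_eq0 k (x : R) : x <= k%:R -> gk a k x = 0.
Proof.
elim: k x => [|k IH] x xk; first by rewrite /gk /= /afun ltNge xk.
by rewrite gkS; apply: (conv_eq0 IH); rewrite -natr1 in xk.
Qed.

Variable g : R -> R.
Hypotheses (g_int : mu.-integrable setT (EFin \o g)) (g_le0 : forall x : R, x <= 0 -> g x = 0).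
Hypothesis g_renewal : {ae mu, forall x, g x - afun a x = convolution g (bfun a) x}.

Let rho n := iter n (fun u => convolution u (bfun a)) g.

Let locL1_g : locL1 g.
Proof.
have mg : measurable_fun [set: R] g by apply/measurable_EFinP; exact: measurable_int g_int.
split=> // T; apply: (le_integrable measurableT _ _ g_int).
  by apply/measurable_EFinP; rewrite /trunc_right; meas.
by move=> x _ /=; rewrite lee_fin /trunc_right; case: ifP => // _; rewrite normr0.
Qed.

Let locL1_rho n : locL1 (rho n).
Proof. by elim: n => [|n IH]; [exact: locL1_g|exact: locL1_conv]. Qed.

Let rho_eq0 n (x : R) : x <= n%:R -> rho n x = 0.
Proof.
elim: n x => [|n IH] x xn; first exact: g_le0.
by rewrite /rho /=; apply: (conv_eq0 IH); rewrite -natr1 in xn.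
Qed.

(** Only n = 0 carries an exceptional null set: convolution ignores null sets, so from n = 1 on the
    identity holds everywhere. *)
Let rhoS n : {ae mu, forall x, rho n x - gk a n x = rho n.+1 x}.
Proof.
elim: n => [|n IH]; first exact: g_renewal.
apply: aeW => x; rewrite gkS.
rewrite [rho n.+1]/(convolution (rho n) (bfun a)) -convB//; last exact: locL1_gk.
apply: (eq_ae_conv x (locL1_rho n.+1) _ IH).
by have [m1 _ _] := locL1_rho n; have [m2 _ _] := locL1_gk n; meas.
Qed.

Let rho_sum : {ae mu, forall x, forall n, g x = series (fun k => gk a k x) n + rho n x}.
Proof.
have : {ae mu, forall x, forall n, rho n x - gk a n x = rho n.+1 x} by apply: ae_foralln => n; exact: rhoS.
apply: filterS; first exact: (ae_filter_ringOfSetsType mu).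
move=> x H; elim=> [|n IH]; first by rewrite /series/= big_geq// add0r.
by rewrite IH -H /series /= big_nat_recr//=; ring.
Qed.

Lemma gk_series_eventually (x : R) n : x <= n%:R -> forall m, (n <= m)%N ->
  series (fun k => gk a k x) m = series (fun k => gk a k x) n.
Proof.
move=> xn m /subnK <-; elim: (m - n)%N => [//|j IH].
rewrite addSn {1}/series /= big_nat_recr//= gk_eq0 ?addr0//.
by rewrite (le_trans xn)// ler_nat leq_addl.
Qed.

Lemma gk_series_ae : {ae mu, forall x : R, forall n, x <= n%:R -> series (fun k => gk a k x) n = g x}.
Proof.
have := rho_sum; apply: filterS; first exact: (ae_filter_ringOfSetsType mu).
by move=> x H n xn; rewrite (H n) rho_eq0// addr0.
Qed.

Lemma gk_series_cvg (x : R) n : x <= n%:R ->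
  series (fun k => gk a k x) @ \oo --> series (fun k => gk a k x) n.
Proof.
move=> xn; apply: cvg_near_cst; exists n => // m /= nm; apply/esym.
by rewrite (gk_series_eventually xn).
Qed.

End locally_integrable.

(** * Power series *)

Section power_series.
Context {R : realType}.
Implicit Types (A B c : nat -> R) (q h M : R).

Lemma cvg_natr_geometric (q : R) : 0 <= q -> q < 1 -> (n%:R * q ^+ n) @[n --> \oo] --> (0 : R).
Proof.
(* This d keeps q (1 + d) below 1, while Bernoulli's inequality bounds n by (1 + d)^n / d. *)
move=> q0 q1; pose d := (1 - q) / 2; have d0 : 0 < d by rewrite /d; lra.
have q'0 : 0 <= q * (1 + d) by rewrite mulr_ge0//; lra.
have q'1 : q * (1 + d) < 1 by rewrite /d; nra.
have bern n : n%:R * d <= (1 + d) ^+ n.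
  have : 1 + n%:R * d <= (1 + d) ^+ n; last by lra.
  elim: n => [|n IH]; first by rewrite mul0r addr0 expr0.
  rewrite exprS -natr1; apply: (@le_trans _ _ ((1 + d) * (1 + n%:R * d))); last by rewrite ler_wpM2l//; lra.
  have : 0 <= n%:R * d * d by rewrite mulr_ge0 ?(ltW d0)// mulr_ge0 ?(ltW d0).
  by nra.
have hg : ((d^-1 * (q * (1 + d)) ^+ n) : R) @[n --> \oo] --> (0 : R).
  by apply: cvg_geometric; rewrite ger0_norm.
apply: (@squeeze_cvgr _ _ _ _ (cst 0) (fun n : nat => d^-1 * (q * (1 + d)) ^+ n)) => //; last exact: cvg_cst.
apply: nearW => n; rewrite mulr_ge0 ?exprn_ge0//= mulrC ler_pdivlMl// exprMn mulrCA.
by rewrite ler_wpM2l ?exprn_ge0// mulrC bern.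
Qed.

Lemma series_tail_le B M q m j : 0 <= q -> q < 1 -> (forall n, `|B n| <= M * q ^+ n) ->
  `|series B (m + j)%N - series B m| <= M * q ^+ m / (1 - q).
Proof.
move=> q0 q1 BM; have M0 : 0 <= M by have := BM 0; rewrite expr0 mulr1; apply: le_trans.
(* The induction on j needs the exact finite geometric sum; the factor 1 - q^j is dropped only
   afterwards. *)
apply: (@le_trans _ _ (M * q ^+ m / (1 - q) * (1 - q ^+ j))); last first.
  rewrite ler_piMr ?gerBl ?exprn_ge0// !mulr_ge0 ?invr_ge0 ?exprn_ge0// subr_ge0 ltW//.
elim: j => [|j IH]; first by rewrite addn0 !subrr normr0 mulr0.
rewrite addnS /series/= big_nat_recr//= addrAC (le_trans (ler_normD _ _))//.
apply: (le_trans (lerD IH (BM _))); rewrite exprD exprS.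
by rewrite le_eqVlt; apply/orP; left; apply/eqP; field; lra.
Qed.

Lemma lim_tail_le B M q (l : R) m : 0 <= q -> q < 1 -> (forall n, `|B n| <= M * q ^+ n) ->
  series B @ \oo --> l -> `|l - series B m| <= M * q ^+ m / (1 - q).
Proof.
move=> q0 q1 BM Bl.
have h : `|series B n - series B m| @[n --> \oo] --> `|l - series B m|.
  by apply: cvg_norm; apply: cvgB => //; exact: cvg_cst.
apply: (ler_cvg_to h (cvg_cst _)); exists m => // n /= /subnKC <-.
exact: series_tail_le.
Qed.

Lemma series_cauchy_productE A B N :
  series (fun n => \sum_(i < n.+1) A i * B (n - i)%N) N = \sum_(i < N) A i * series B (N - i)%N.
Proof.
elim: N => [|N IH]; first by rewrite /series /= big_geq// big_ord0.
rewrite /series/= big_nat_recr//= -[X in X + _]/(series _ N) IH.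
rewrite [RHS]big_ord_recr/= subSn// subnn.
rewrite [X in _ + X]big_ord_recr/= subnn addrA; congr (_ + _); last by rewrite big_nat1.
rewrite -big_split/=; apply: eq_bigr => i _.
by rewrite subSn ?(ltnW (ltn_ord i))// -mulrDr /series/= [in RHS]big_nat_recr.
Qed.

(** Replacing each partial sum of B by its limit costs at most MA q^i MB q^(N-i) / (1-q) for the
    i-th of N terms, hence K N q^N in total, which tends to 0. *)
Lemma cauchy_product A B MA MB q (lA lB : R) : 0 <= q -> q < 1 ->
  (forall n, `|A n| <= MA * q ^+ n) -> (forall n, `|B n| <= MB * q ^+ n) ->
  series A @ \oo --> lA -> series B @ \oo --> lB ->
  series (fun n => \sum_(i < n.+1) A i * B (n - i)%N) @ \oo --> lA * lB.
Proof.
move=> q0 q1 AM BM Al Bl.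
have MB0 : 0 <= MB by have := BM 0; rewrite expr0 mulr1; apply: le_trans.
suff H : (series (fun n => \sum_(i < n.+1) A i * B (n - i)%N) N - series A N * lB) @[N --> \oo] --> (0 : R).
  pose S := series (fun n => \sum_(i < n.+1) A i * B (n - i)%N).
  have E : S = (fun N => (S N - series A N * lB) + series A N * lB) by apply/funext => N; rewrite subrK.
  rewrite -/S E -[X in _ --> X]add0r; exact: (cvgD H (cvgM Al (cvg_cst lB))).
pose K := MA * MB / (1 - q).
have hK : (K * (N%:R * q ^+ N)) @[N --> \oo] --> (0 : R).
  have := cvgM (cvg_cst K) (cvg_natr_geometric q0 q1); rewrite mulr0; exact.
apply/norm_cvg0P; apply: (@squeeze_cvgr _ _ _ _ (cst 0) _ _ _ _ (cvg_cst _) hK).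
apply: nearW => N; rewrite normr_ge0/= series_cauchy_productE /series/= big_mkord mulr_suml -sumrB.
rewrite (le_trans (ler_norm_sum _ _ _))//.
have -> : K * (N%:R * q ^+ N) = \sum_(i < N) K * q ^+ N.
  by rewrite sumr_const card_ord -[RHS]mulr_natr; ring.
apply: ler_sum => i _; rewrite -mulrBr normrM distrC.
have -> : K * q ^+ N = (MA * q ^+ i) * (MB * q ^+ (N - i) / (1 - q)).
  by rewrite -{1}(subnKC (ltnW (ltn_ord i))) exprD /K; field; lra.
by apply: ler_pM => //; apply: lim_tail_le.
Qed.

End power_series.

(** * Taylor coefficients of the summands *)

Section beta_weight.
Context {R : realType}.
Local Notation mu := (@lebesgue_measure R).
Variables (p q : R).
Hypotheses (p0 : 0 < p) (q0 : 0 < q).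

Lemma integrable_beta : mu.-integrable setT (EFin \o beta_integrand p q).
Proof.
apply: ge0_integrable (integral_beta p0 q0); first exact: measurable_beta_integrand.
by move=> x; exact: beta_integrand_ge0.
Qed.

Lemma beta_integrand_neq0 (t : R) : beta_integrand p q t != 0 -> 0 < t < 1.
Proof. by rewrite /beta_integrand; case: ifP => //; rewrite eqxx. Qed.

Lemma integrable_betaM (K : R -> R) (M : R) : measurable_fun [set: R] K ->
  (forall t, 0 < t < 1 -> `|K t| <= M) ->
  mu.-integrable setT (EFin \o (fun t => beta_integrand p q t * K t)).
Proof.
move=> mK KM; rewrite (_ : (fun t => _) = fun t => K t * beta_integrand p q t); last by apply/funext => t; rewrite mulrC.
apply: (@integrableM_bounded _ _ _ M) => //; first exact: integrable_beta.
by move=> t /beta_integrand_neq0; exact: KM.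
Qed.

Lemma norm_integral_betaM_le (K : R -> R) (M : R) : measurable_fun [set: R] K ->
  (forall t, 0 < t < 1 -> `|K t| <= M) ->
  `|\int[mu]_t (beta_integrand p q t * K t)| <= M * \int[mu]_t beta_integrand p q t.
Proof.
move=> mK KM; have iK := integrable_betaM mK KM; have ib := integrable_beta.
rewrite (le_trans (le_normr_Rintegral measurableT iK))// -RintegralZl//.
apply: le_Rintegral => //.
- exact: integrable_norm.
- exact: (integrableZl measurableT _ ib).
- move=> t _; rewrite normrM (ger0_norm (beta_integrand_ge0 _ _ _)) mulrC.
  have [->|/beta_integrand_neq0/KM h] := eqVneq (beta_integrand p q t) 0; first by rewrite !mulr0.
  by rewrite ler_wpM2r// beta_integrand_ge0.
Qed.

Lemma cvg_integral_betaM (K : nat -> R -> R) (L : R -> R) (M : R) :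
  (forall n, measurable_fun [set: R] (K n)) -> measurable_fun [set: R] L ->
  (forall n t, 0 < t < 1 -> `|K n t| <= M) ->
  (forall t, 0 < t < 1 -> K n t @[n --> \oo] --> L t) ->
  \int[mu]_t (beta_integrand p q t * K n t) @[n --> \oo] --> \int[mu]_t (beta_integrand p q t * L t).
Proof.
move=> mK mL KM KL; have mb := measurable_beta_integrand p q.
have [//|||//||iwf _ H] := @dominated_convergence _ _ R mu setT measurableT
  (fun n t => (beta_integrand p q t * K n t)%:E) (fun t => (beta_integrand p q t * L t)%:E)
  (fun t => (M * beta_integrand p q t)%:E).
- by move=> n; have mKn := mK n; apply/measurable_EFinP; meas.
- by apply/measurable_EFinP; meas.
- apply: aeW => t _; apply: cvg_EFin; first exact: nearW.
  have [E|/beta_integrand_neq0/KL h] := eqVneq (beta_integrand p q t) 0; last by apply: cvgM; [exact: cvg_cst|exact: h].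
  by rewrite E mul0r /=; under eq_fun do rewrite mul0r; exact: cvg_cst.
- exact: (integrableZl measurableT _ integrable_beta).
- apply: aeW => t n _; rewrite lee_fin normrM (ger0_norm (beta_integrand_ge0 _ _ _)) mulrC.
  have [->|/beta_integrand_neq0/(KM n) h] := eqVneq (beta_integrand p q t) 0; first by rewrite !mulr0.
  by rewrite ler_wpM2r// beta_integrand_ge0.
have {}H : fine (\int[mu]_t (beta_integrand p q t * K n t)%:E)%E @[n --> \oo] --> \int[mu]_t (beta_integrand p q t * L t).
  by apply: fine_cvg; rewrite fineK//; exact: integrable_fin_num.
exact: H.
Qed.

Lemma integral_beta_sum (N : nat) (K : nat -> R -> R) (M : nat -> R) :
  (forall n, measurable_fun [set: R] (K n)) ->
  (forall n t, 0 < t < 1 -> `|K n t| <= M n) ->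
  \int[mu]_t (beta_integrand p q t * \sum_(i < N) K i t) = \sum_(i < N) \int[mu]_t (beta_integrand p q t * K i t).
Proof.
move=> mK KM; have ms n : measurable_fun [set: R] (fun t => \sum_(i < n) K i t) by apply: measurable_sum => i.
elim: N => [|N IH].
  rewrite big_ord0; under eq_Rintegral do rewrite big_ord0 mulr0.
  by rewrite /Rintegral integral0.
rewrite big_ord_recr/= -IH -RintegralD//.
- by apply: eq_Rintegral => t _; rewrite big_ord_recr/= mulrDr.
- apply: (@integrable_betaM _ (\sum_(i < N) M i)) => // t t01.
  by rewrite (le_trans (ler_norm_sum _ _ _))//; apply: ler_sum => i _; exact: KM.
- by apply: (@integrable_betaM _ (M N)) => // t; exact: KM.
Qed.

End beta_weight.

Lemma beta__gt0 (R : realType) (a : R) k : 0 < a -> 0 < beta_ a k.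
Proof. by move=> a0; rewrite /beta_ ltr_wpDr// mulr_ge0 ?ler0n//; lra. Qed.

Section coefficients.
Context {R : realType}.
Local Notation mu := (@lebesgue_measure R).
Variable a : R.
Hypotheses (a_gt0 : 0 < a) (a_lt1 : a < 1).

(* Cauchy product of the Taylor expansions, in w at v, of u(w t), where c n v is
   the n-th Taylor coefficient of u at v, and of 1 / (1 + w (1 - t)). *)
Definition coef_step (c : nat -> R -> R) (n : nat) (v t : R) : R :=
  \sum_(i < n.+1) (t ^+ i * c i (v * t)) * ((- (1 - t)) ^+ (n - i) / (1 + v * (1 - t)) ^+ (n - i).+1).

(* The n-th Taylor coefficient at v >= 0 of the factor G_k in
   gk a k x = (x - k)^(beta_k - 1) G_k(x - k); thus gk_coef k 0 is G_k. *)
Fixpoint gk_coef (k : nat) : nat -> R -> R :=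
  if k is k'.+1 then
    fun n v => - C0 a * \int[mu]_t (beta_integrand (beta_ a k') (1 + a) t * coef_step (gk_coef k') n v t)
  else fun n _ => if n == 0%N then C0 a else 0.

Let a10 : 0 < 1 + a. Proof. by rewrite addr_gt0. Qed.
Let bk0 k : 0 < beta_ a k. Proof. exact: beta__gt0. Qed.

Lemma measurable_coef_step2 c n : (forall i, measurable_fun [set: R] (c i)) ->
  measurable_fun [set: R * R] (fun z => coef_step c n z.1 z.2).
Proof.
move=> mc; rewrite /coef_step; apply: measurable_sum => i.
apply: measurable_funM.
  by apply: measurable_funM; [meas|apply: (measurableT_comp (mc i)); meas].
meas.
Qed.

Lemma measurable_coef_step c n v : (forall i, measurable_fun [set: R] (c i)) ->
  measurable_fun [set: R] (coef_step c n v).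
Proof.
move=> mc; rewrite /coef_step; apply: measurable_sum => i.
apply: measurable_funM.
  by apply: measurable_funM; [meas|apply: (measurableT_comp (mc i)); meas].
meas.
Qed.

Lemma measurable_gk_coef k n : measurable_fun [set: R] (gk_coef k n).
Proof.
elim: k n => [|k IH] n; first exact: measurable_cst.
apply: measurable_funM; first exact: measurable_cst.
apply: (measurable_fun_Rintegral (f := fun v t => beta_integrand (beta_ a k) (1 + a) t * coef_step (gk_coef k) n v t)).
apply: measurable_funM; last exact: measurable_coef_step2.
exact: (measurableT_comp (measurable_beta_integrand _ _) measurable_snd).
Qed.

(** Since 1 + v (1 - t) >= 1 >= 1 - t, the factors from the geometric series are at most 1. Only the
    sum of the rho^i for i <= n is lost; for rho > 1 it is of the order of its last term, which is
    why the growth rate does not deteriorate with k. *)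
Lemma coef_step_le c n (v t M rho : R) : 1 < rho -> 0 <= v -> 0 < t < 1 ->
  (forall i u, 0 <= u -> `|c i u| <= M * rho ^+ i) ->
  `|coef_step c n v t| <= M * rho / (rho - 1) * rho ^+ n.
Proof.
move=> r1 v0 /andP[t0 t1] cM.
have M0 : 0 <= M by have := cM 0%N 0 (lexx 0); rewrite expr0 mulr1; apply: le_trans.
apply: (@le_trans _ _ (\sum_(i < n.+1) M * rho ^+ i)).
  rewrite (le_trans (ler_norm_sum _ _ _))//; apply: ler_sum => i _.
  rewrite normrM -[leRHS]mulr1; apply: ler_pM => //.
    rewrite normrM -[leRHS]mul1r; apply: ler_pM => //; last by apply: cM; rewrite mulr_ge0// ltW.
    by rewrite normrX ger0_norm ?(ltW t0)// exprn_ile1// ltW.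
  have d1 : 1 <= 1 + v * (1 - t) by rewrite lerDl mulr_ge0//; lra.
  rewrite normrM normfV !normrX normrN (ger0_norm (x := 1 - t)); last by lra.
  rewrite (ger0_norm (x := 1 + _)); last by lra.
  rewrite ler_pdivrMr ?exprn_gt0//; last by lra.
  rewrite mul1r (@le_trans _ _ 1)//; first by apply: exprn_ile1; lra.
  by rewrite exprn_ege1.
rewrite -mulr_sumr -!mulrA ler_wpM2l//.
rewrite [leRHS](_ : _ = rho ^+ n.+1 / (rho - 1)); last by rewrite exprS; ring.
by rewrite ler_pdivlMr ?subr_gt0// mulrC -subrX1; lra.
Qed.

Lemma gk_coef_le k (rho : R) : 1 < rho ->
  exists M, forall n v, 0 <= v -> `|gk_coef k n v| <= M * rho ^+ n.
Proof.
move=> r1; have c00 := ltW (C0_gt0 a_gt0 a_lt1); elim: k => [|k [M IH]].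
  exists (C0 a) => n v _ /=; case: eqP => [->|_]; first by rewrite expr0 mulr1 ger0_norm.
  by rewrite normr0 mulr_ge0// exprn_ge0//; lra.
exists (C0 a * (M * rho / (rho - 1) * \int[mu]_t beta_integrand (beta_ a k) (1 + a) t)) => n v v0 /=.
rewrite normrM normrN (ger0_norm c00) -mulrA ler_wpM2l// mulrAC.
apply: norm_integral_betaM_le => //.
  by apply: measurable_coef_step => i; exact: measurable_gk_coef.
by move=> t t01; apply: coef_step_le.
Qed.

Lemma gk_coefS0 k w : gk_coef k.+1 0 w = - C0 a *
  \int[mu]_t (beta_integrand (beta_ a k) (1 + a) t * (gk_coef k 0 (w * t) / (1 + w * (1 - t)))).
Proof.
rewrite /=; congr (_ * _); apply: eq_Rintegral => t _; congr (_ * _).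
by rewrite /coef_step big_ord1 expr0 !mul1r expr1.
Qed.

(** Under the integral, the expansion of [gk_coef k 0] at v t and the geometric series of 1 / (1 + w
    (1 - t)) at v are multiplied; the common bound M' q^n permits summation under the integral
    sign. *)
Lemma gk_coef_expansion k (v w : R) : 0 <= v -> 0 <= w -> `|w - v| < 1 ->
  series (fun n => gk_coef k n v * (w - v) ^+ n) @ \oo --> gk_coef k 0 w.
Proof.
elim: k v w => [|k IH] v w v0 w0 wv.
  apply: cvg_near_cst; exists 1%N => // -[//|N] _.
  rewrite /series/= big_ltn// expr0 mulr1 big_nat_cond big1 ?addr0//.
  by move=> i; rewrite andbT => /andP[i0 _]; rewrite gtn_eqF// mul0r.
set h := w - v in wv *.
(* Chosen so that rho > 1 and rho |h| < 1 hold at once, which is possible because |h| < 1. *)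
pose rho := 2 / (1 + `|h|).
have h0 := normr_ge0 h.
have r1 : 1 < rho by rewrite /rho ltr_pdivlMr//; lra.
pose q := rho * `|h|.
have q0 : 0 <= q by rewrite mulr_ge0//; lra.
have q1 : q < 1 by rewrite /q /rho mulrAC ltr_pdivrMr//; lra.
have hq : `|h| <= q by rewrite /q ler_peMl// ltW.
have [M cM] := gk_coef_le k r1.
have M0 : 0 <= M by have := cM 0%N 0 (lexx 0); rewrite expr0 mulr1; apply: le_trans.
have mst n : measurable_fun [set: R] (coef_step (gk_coef k) n v).
  by apply: measurable_coef_step => i; exact: measurable_gk_coef.
pose M' := M * rho / (rho - 1).
pose K n t := coef_step (gk_coef k) n v t * h ^+ n.
have Kle n t : 0 < t < 1 -> `|K n t| <= M' * q ^+ n.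
  move=> t01; rewrite /K normrM /q exprMn mulrA normrX ler_wpM2r ?exprn_ge0//.
  exact: coef_step_le.
have mK n : measurable_fun [set: R] (K n).
  by apply: measurable_funM => //; exact: measurable_cst.
have mc i : measurable_fun [set: R] (gk_coef k i) by exact: measurable_gk_coef.
have sE N : series (fun n => gk_coef k.+1 n v * h ^+ n) N =
    - C0 a * \int[mu]_t (beta_integrand (beta_ a k) (1 + a) t * \sum_(n < N) K n t).
  rewrite (integral_beta_sum (bk0 k) a10 N mK Kle) mulr_sumr /series /= big_mkord.
  apply: eq_bigr => n _; rewrite -mulrA; congr (_ * _).
  rewrite -RintegralZr//; first by apply: eq_Rintegral => t _; rewrite mulrA.
  apply: (integrable_betaM (bk0 k) a10 (mst n) (M := M' * rho ^+ n)) => t t01.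
  exact: coef_step_le.
rewrite gk_coefS0 (_ : series _ = fun N => - C0 a * \int[mu]_t (beta_integrand (beta_ a k) (1 + a) t * \sum_(n < N) K n t)); last by apply/funext.
apply: cvgM; first exact: cvg_cst.
apply: (cvg_integral_betaM (bk0 k) a10 (M := M' / (1 - q))).
- by move=> N; apply: measurable_sum => i.
- apply: measurable_funM; first by apply: (measurableT_comp (mc 0%N)); meas.
  meas.
- move=> N t t01; have := @series_tail_le _ (K ^~ t) M' q 0 N q0 q1 (fun n => Kle n t t01).
  by rewrite /series/= [X in _ - X]big_geq// subr0 add0n big_mkord expr0 mulr1.
move=> t t01; have /andP[t0 t1] := t01.
have vt0 : 0 <= v * (1 - t) by rewrite mulr_ge0//; lra.
have dv : 0 < 1 + v * (1 - t) by rewrite ltr_wpDr// mulr_ge0//; lra.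
have dw : 0 < 1 + w * (1 - t) by rewrite ltr_wpDr// mulr_ge0//; lra.
pose A i := gk_coef k i (v * t) * (w * t - v * t) ^+ i.
(* The ratio for which 1 + w (1 - t) = (1 + v (1 - t)) (1 - z). *)
pose z := - (1 - t) * h / (1 + v * (1 - t)).
pose B := geometric (1 + v * (1 - t))^-1 z.
have zle : `|z| <= `|h|.
  rewrite /z !normrM normrN normfV (ger0_norm (ltW dv)) (ger0_norm (x := 1 - t)); last by lra.
  rewrite ler_pdivrMr// mulrC ler_wpM2l//.
  by lra.
have z1 : `|z| < 1 by exact: le_lt_trans wv.
have Acvg : series A @ \oo --> gk_coef k 0 (w * t).
  apply: IH; rewrite ?mulr_ge0 ?(ltW t0)//.
  rewrite -mulrBl normrM (ger0_norm (ltW t0)) -/h.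
  by rewrite (le_lt_trans _ wv)// ler_piMr// ltW.
have Bcvg : series B @ \oo --> (1 + w * (1 - t))^-1.
  have := @cvg_geometric_series _ (1 + v * (1 - t))^-1 z z1.
  rewrite (_ : _ / (1 - z) = (1 + w * (1 - t))^-1)//.
  rewrite /z /h; field.
  by rewrite !gt_eqF//=; apply: le_lt_trans dw; rewrite le_eqVlt; apply/orP; left; apply/eqP; ring.
have AM n : `|A n| <= M * q ^+ n.
  rewrite /A normrM /q exprMn mulrA normrX ler_pM ?exprn_ge0//.
    by apply: cM; rewrite mulr_ge0// ltW.
  rewrite -mulrBl -/h lerXn2r ?nnegrE// normrM (ger0_norm (ltW t0)).
  by rewrite ler_piMr// ltW.
have BM n : `|B n| <= 1 * q ^+ n.
  rewrite /B /geometric /= normrM normrX ler_pM ?exprn_ge0//.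
    rewrite ger0_norm ?invr_ge0 ?(ltW dv)// invf_le1//.
    by lra.
  by rewrite lerXn2r ?nnegrE// (le_trans zle).
have := cauchy_product q0 q1 AM BM Acvg Bcvg.
rewrite (_ : series _ = fun N => \sum_(n < N) K n t)//.
apply/funext => N; rewrite /series/= big_mkord; apply: eq_bigr => n _.
rewrite /K /coef_step mulr_suml; apply: eq_bigr => -[i /= lin] _.
rewrite ltnS in lin.
rewrite /A /B /geometric /= /z !exprMn exprVn -mulrBl -/h exprMn exprS.
have -> : h ^+ n = h ^+ i * h ^+ (n - i) by rewrite -exprD subnKC.
by field; rewrite ?expf_eq0 ?gt_eqF// ?andbF.
Qed.

End coefficients.

Section Rintegral_affine.
Context {R : realType}.
Local Notation mu := (@lebesgue_measure R).

Lemma Rintegral_affine (c w : R) (f : R -> R) : 0 < w -> mu.-integrable setT (EFin \o f) ->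
  \int[mu]_x f x = w * \int[mu]_x f (c + w * x).
Proof.
move=> w0 fi; have fi' := integrable_affine c w0 fi.
have mf := measurable_int _ fi.
have E1 : (\int[mu]_x ((EFin \o f)^\+ x) = w%:E * \int[mu]_x ((EFin \o (fun x => f (c + w * x)%R))^\+ x))%E.
  by rewrite (ge0_integral_affine c w0 (measurable_funepos mf) (funepos_ge0 _)); congr (_ * _)%E; apply: eq_integral => x _; rewrite !funeposE.
have E2 : (\int[mu]_x ((EFin \o f)^\- x) = w%:E * \int[mu]_x ((EFin \o (fun x => f (c + w * x)%R))^\- x))%E.
  by rewrite (ge0_integral_affine c w0 (measurable_funeneg mf) (funeneg_ge0 _)); congr (_ * _)%E; apply: eq_integral => x _; rewrite !funenegE.
have p1 := integrable_fin_num measurableT (integrable_funepos measurableT fi').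
have p2 := integrable_fin_num measurableT (integrable_funeneg measurableT fi').
rewrite /Rintegral integralE E1 E2 [X in _ = _ * fine X]integralE.
by rewrite -(fineK p1) -(fineK p2) -!EFinM -!EFinB /= mulrBr.
Qed.

End Rintegral_affine.

Section gk_expansion.
Context {R : realType}.
Local Notation mu := (@lebesgue_measure R).
Variable a : R.
Hypotheses (a_gt0 : 0 < a) (a_lt1 : a < 1).

Let a10 : 0 < 1 + a. Proof. by rewrite addr_gt0. Qed.
Let bk0 k : 0 < beta_ a k. Proof. exact: beta__gt0. Qed.

Lemma beta_S k : beta_ a k.+1 = beta_ a k + (1 + a).
Proof. by rewrite /beta_ -natr1; ring. Qed.

Lemma gkE k (x : R) : k%:R < x -> gk a k x = (x - k%:R) `^ (beta_ a k - 1) * gk_coef a k 0 (x - k%:R).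
Proof.
elim: k x => [|k IH] x xk.
  by rewrite /gk /= /afun xk subr0 /beta_ mul0r addr0 mulrC.
set w := x - k.+1%:R.
have w0 : 0 < w by rewrite subr_gt0.
rewrite gkS /convolution (@Rintegral_affine _ k%:R w)//; last exact: (integrable_conv a_gt0 a_lt1 x (locL1_gk a_gt0 a_lt1 k)).
pose K t := gk_coef a k 0 (w * t) / (1 + w * (1 - t)).
have mG := measurable_gk_coef a k 0.
have mK : measurable_fun [set: R] K.
  apply: measurable_funM; first by apply: (measurableT_comp mG); meas.
  meas.
have [M GM] := gk_coef_le a_gt0 a_lt1 k (@ltr1n R 2 : 1 < 2).
have KM t : 0 < t < 1 -> `|K t| <= M.
  move=> /andP[t0 t1]; have d1 : 1 <= 1 + w * (1 - t) by rewrite lerDl mulr_ge0 ?(ltW w0)//; lra.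
  rewrite /K normrM normfV (ger0_norm (x := 1 + _)); last by lra.
  rewrite ler_pdivrMr; last by lra.
  have G0 : `|gk_coef a k 0 (w * t)| <= M by have := GM 0%N (w * t); rewrite expr0 mulr1; apply; rewrite mulr_ge0// ltW.
  by rewrite (le_trans G0)// ler_peMr// (le_trans _ G0).
rewrite (_ : \int[mu]_t _ = \int[mu]_t (- C0 a * w `^ (beta_ a k - 1 + a) * (beta_integrand (beta_ a k) (1 + a) t * K t))).
  rewrite RintegralZl//; last exact: (integrable_betaM (bk0 k) a10 mK KM).
  rewrite gk_coefS0 -/w beta_S.
  (* The exponent collects beta_k - 1 from g_k, a from b, and 1 from the change of variable. *)
  have -> : w `^ (beta_ a k + (1 + a) - 1) = w * w `^ (beta_ a k - 1 + a).
    rewrite -{2}(powRr1 (ltW w0)) -powRD; last by rewrite (gt_eqF w0) implybT.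
    by congr (_ `^ _); ring.
  rewrite /K; ring.
apply: eq_Rintegral => t _.
have [t0|t0] := leP t 0.
  rewrite gk_eq0; first by rewrite mul0r /beta_integrand ltNge t0/= mul0r mulr0.
  have : w * t <= 0 by rewrite pmulr_rle0.
  by lra.
have xE : x - (k%:R + w * t) = 1 + w * (1 - t) by rewrite /w -natr1; ring.
have [t1|t1] := leP 1 t.
  rewrite /beta_integrand (ltNge t) t1 andbF mul0r mulr0 bfun_le1 ?mulr0//.
  have : w * (1 - t) <= 0 by rewrite pmulr_rle0//; lra.
  by rewrite xE; lra.
have wt0 : 0 < w * t by rewrite mulr_gt0.
have wt1 : 0 < w * (1 - t) by rewrite mulr_gt0//; lra.
rewrite xE IH ?ltrDl// (addrC k%:R) addrK /beta_integrand t0 t1/= /bfun ltrDl wt1.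
rewrite (_ : 1 + w * (1 - t) - 1 = w * (1 - t)); last by ring.
rewrite powRM ?(ltW w0) ?(ltW t0)// powRM ?(ltW w0) ?subr_ge0 ?(ltW t1)//.
rewrite (@powRD _ w (beta_ a k - 1) a); last by rewrite (gt_eqF w0) implybT.
by rewrite (_ : 1 + a - 1 = a) /K; ring.
Qed.

Fixpoint conv_pow (q : nat -> R) (k n : nat) : R :=
  if k is k'.+1 then \sum_(i < n.+1) conv_pow q k' i * q (n - i)%N else (n == 0%N)%:R.

(** Identifies the iterated Cauchy product with a coefficient of a polynomial power, whose expansion
    by distributivity will produce the sum over k-tuples. *)
Lemma conv_powE q k n N : (n < N)%N -> ((\poly_(j < N) q j) ^+ k)`_n = conv_pow q k n.
Proof.
elim: k n => [|k IH] n nN; first by rewrite expr0 coef1.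
rewrite exprSr coefM /=; apply: eq_bigr => i _.
rewrite IH; last by rewrite (leq_ltn_trans _ nN)// -ltnS.
by rewrite coef_poly ifT// (leq_ltn_trans _ nN)// leq_subr.
Qed.

(** As 0 < a < 1, the recurrence in the definition of [Gamma] takes exactly one step at - a. *)
Lemma GammaN : Gamma (- a) = Gamma (1 - a) / (- a).
Proof.
rewrite {1}/Gamma oppr_gt0 ltNge (ltW a_gt0)/= opprK (_ : Num.truncn a = 0%N); last first.
  by apply/truncn_def; rewrite ?(ltW a_gt0)//= a_lt1.
rewrite big_ord1 addr0 /Gamma subr_gt0 a_lt1 addrC//.
Qed.

(** Accounts for the extra factor Gamma(-a) that [C_] gains with each convolution; the remaining
    Gamma(1+a) normalises the new Pochhammer symbol. *)
Lemma C0_GammaN : - C0 a = (Gamma (- a) * Gamma (1 + a))^-1.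
Proof.
have g1 := @Gamma_gt0 _ a a_gt0; have g2 : 0 < Gamma (1 - a) by apply: Gamma_gt0; rewrite subr_gt0.
rewrite GammaN (addrC 1 a) GammaS// C0E//.
by field; rewrite !gt_eqF.
Qed.

(** At v = 0 the denominators of [coef_step] are 1, leaving Beta integrals with parameters beta_k +
    i and 1 + a + n - i. The first Gamma factor cancels the Pochhammer symbol of the previous stage
    and the second supplies (1+a)_(n-i), the new factor of the Cauchy power. *)
Lemma gk_coef_at0 k n : gk_coef a k n 0 =
  C_ a k * conv_pow (pochhammer (1 + a)) k n * (-1) ^+ n / pochhammer (beta_ a k) n.
Proof.
have g2 : 0 < Gamma (1 - a) by apply: Gamma_gt0; rewrite subr_gt0.
have gN : Gamma (- a) != 0 by rewrite GammaN mulf_neq0 ?invr_eq0 ?oppr_eq0 ?gt_eqF.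
elim: k n => [|k IH] n.
  rewrite /=; case: n => [|n]; last by rewrite mulr0 !mul0r.
  rewrite /C_ /pochhammer /= !mulr1 addr0 divff; last by rewrite gt_eqF// Gamma_gt0.
  by rewrite divr1 /beta_ mul0r addr0 C0E.
have int_i (i : 'I_n.+1) : \int[mu]_t (beta_integrand (beta_ a k) (1 + a) t *
    (t ^+ i * gk_coef a k i 0 * (- (1 - t)) ^+ (n - i))) =
    gk_coef a k i 0 * (-1) ^+ (n - i) * (Gamma (beta_ a k + i%:R) * Gamma (1 + a + (n - i)%N%:R) / Gamma (beta_ a k.+1 + n%:R)).
  have p0 : 0 < beta_ a k + i%:R by rewrite ltr_wpDr.
  have q0 : 0 < 1 + a + (n - i)%N%:R by rewrite ltr_wpDr.
  rewrite (_ : \int[mu]_t _ = \int[mu]_t (gk_coef a k i 0 * (-1) ^+ (n - i) * beta_integrand (beta_ a k + i%:R) (1 + a + (n - i)%N%:R) t)).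
    rewrite RintegralZl//; last exact: integrable_beta.
    congr (_ * _); rewrite /Rintegral integral_beta//=; congr (_ / Gamma _).
    rewrite beta_S natrB -1?ltnS//; ring.
  apply: eq_Rintegral => t _; rewrite /beta_integrand; case: ifP => [/andP[t0 t1]|_]; last by rewrite mul0r mulr0.
  have s0 : 0 < 1 - t by rewrite subr_gt0.
  rewrite exprNn -(@powR_mulrn _ t) ?(ltW t0)// -(@powR_mulrn _ (1 - t)) ?(ltW s0)//.
  have -> : beta_ a k + i%:R - 1 = (beta_ a k - 1) + i%:R by ring.
  have -> : 1 + a + (n - i)%N%:R - 1 = (1 + a - 1) + (n - i)%N%:R by ring.
  rewrite (@powRD _ t (beta_ a k - 1)); last by rewrite (gt_eqF t0) implybT.
  rewrite (@powRD _ (1 - t) (1 + a - 1)); last by rewrite (gt_eqF s0) implybT.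
  ring.
rewrite (_ : gk_coef a k.+1 n 0 = - C0 a * \int[mu]_t (beta_integrand (beta_ a k) (1 + a) t *
    \sum_(i < n.+1) t ^+ i * gk_coef a k i 0 * (- (1 - t)) ^+ (n - i))); last first.
  congr (_ * _); apply: eq_Rintegral => t _; congr (_ * _); apply: eq_bigr => i _.
  by rewrite !mul0r addr0 expr1n divr1.
have mT i : measurable_fun [set: R] (fun t => t ^+ i * gk_coef a k i 0 * (- (1 - t)) ^+ (n - i)) by meas.
rewrite (@integral_beta_sum _ _ _ (bk0 k) a10 n.+1 (fun i t => t ^+ i * gk_coef a k i 0 * (- (1 - t)) ^+ (n - i)) (fun i => `|gk_coef a k i 0|))//; last first.
  move=> i t /andP[t0 t1]; rewrite !normrM !normrX normrN (ger0_norm (ltW t0)) (ger0_norm (x := 1 - t)); last by lra.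
  rewrite mulrAC ler_piMl// mulr_ile1 ?exprn_ge0 ?exprn_ile1//; lra.
rewrite mulr_sumr -!mulrA mulr_suml mulr_sumr; apply: eq_bigr => i _.
rewrite -/(conv_pow _ k i) int_i IH C0_GammaN; move: (conv_pow _ k i) => cp; rewrite /C_ /pochhammer exprS.
have -> : (-1 : R) ^+ n = (-1) ^+ i * (-1) ^+ (n - i) by rewrite -exprD subnKC// -ltnS.
have h1 := Gamma_gt0 (bk0 k); have h2 := Gamma_gt0 (bk0 k.+1).
have h3 := Gamma_gt0 a10.
have h4 : 0 < Gamma (beta_ a k + i%:R) by apply: Gamma_gt0; rewrite ltr_wpDr.
have h5 : 0 < Gamma (beta_ a k.+1 + n%:R) by apply: Gamma_gt0; rewrite ltr_wpDr.
by field; rewrite ?expf_eq0 !(negbTE gN) ?andbF !gt_eqF.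
Qed.

End gk_expansion.

(** * Analytic functions *)

Section analytic.
Context {R : realType}.
Implicit Types (f g F : R -> R) (x : R).

(** Analyticity with explicit constants: rho is an inverse radius and M rho^n a geometric bound,
    which makes tails and Cauchy products quantitative. *)
Definition power_series_at f x (c : nat -> R) (rho M : R) :=
  [/\ 0 < rho, forall n, `|c n| <= M * rho ^+ n &
      forall h, rho * `|h| < 1 -> series (fun n => c n * h ^+ n) @ \oo --> f (x + h)].

(** Convergence at half the radius makes the terms c_n (r/2)^n bounded, which is the geometric bound
    with rho = 2 / r. *)
Lemma analytic_atP f x : analytic_at f x <-> exists c rho M, power_series_at f x c rho M.
Proof.
split; last first.
  move=> [c [rho [M [r0 _ H]]]]; exists c, rho^-1; rewrite invr_gt0; split => // y yx.
  by have := H (y - x); rewrite addrCA subrr addr0; apply; rewrite -ltr_pdivlMl// mulr1.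
move=> [c [r [r0 H]]].
have r20 : 0 < r / 2 by rewrite divr_gt0.
have cr : series (fun n => c n * (r / 2) ^+ n) @ \oo --> f (x + r / 2).
  by have := H (x + r / 2); rewrite addrAC subrr add0r; apply; rewrite gtr0_norm//; lra.
have [M [_ HM]] : bounded_fun (fun n => c n * (r / 2) ^+ n).
  by apply: cvg_seq_bounded; apply: cvgP; apply: cvg_series_cvg_0; apply: cvgP cr.
exists c, (2 / r), (M + 1); split; first by rewrite divr_gt0.
- move=> n; have := HM (M + 1) (ltac:(lra)) n I.
  rewrite /= normrM normrX (gtr0_norm r20) -ler_pdivlMr ?exprn_gt0// -exprVn.
  by rewrite invf_div.
- move=> h hr; have := H (x + h); rewrite addrAC subrr add0r; apply.
  by move: hr; rewrite mulrAC ltr_pdivrMr// mul1r; have := normr_ge0 h; lra.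
Qed.

Lemma power_series_term_le f x c rho M h n : power_series_at f x c rho M ->
  `|c n * h ^+ n| <= M * (rho * `|h|) ^+ n.
Proof. by move=> [_ cM _]; rewrite normrM normrX exprMn mulrA ler_wpM2r ?exprn_ge0. Qed.

Lemma power_series_bound_ge0 f x c rho M : power_series_at f x c rho M -> 0 <= M.
Proof. by move=> [_ cM _]; have := cM 0%N; rewrite expr0 mulr1; apply: le_trans. Qed.

Lemma power_series_atW f x c rho M rho' : power_series_at f x c rho M -> rho <= rho' ->
  power_series_at f x c rho' M.
Proof.
move=> fc rr; have M0 := power_series_bound_ge0 fc; have [r0 cM H] := fc; split.
- exact: lt_le_trans rr.
- move=> n; rewrite (le_trans (cM n))// ler_wpM2l// lerXn2r ?nnegrE ?(ltW r0)// (le_trans (ltW r0))//.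
- by move=> h hr; apply: H; rewrite (le_lt_trans _ hr)// ler_wpM2r.
Qed.

Lemma analytic_atM f g x : analytic_at f x -> analytic_at g x -> analytic_at (fun y => f y * g y) x.
Proof.
move=> /analytic_atP[c [r1 [M1 fc]]] /analytic_atP[d [r2 [M2 gd]]].
pose rho := Num.max r1 r2.
have {}fc := power_series_atW (rho' := rho) fc; have {}gd := power_series_atW (rho' := rho) gd.
have {}fc : power_series_at f x c rho M1 by apply: fc; rewrite le_max lexx.
have {}gd : power_series_at g x d rho M2 by apply: gd; rewrite le_max lexx orbT.
have [r0 _ Hf] := fc; have [_ _ Hg] := gd.
exists (fun n => \sum_(i < n.+1) c i * d (n - i)%N), rho^-1; rewrite invr_gt0; split => // y yx.
set h := y - x in yx *.
have q1 : rho * `|h| < 1 by rewrite -ltr_pdivlMl// mulr1.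
have q0 : 0 <= rho * `|h| by rewrite mulr_ge0// ltW.
have := cauchy_product q0 q1 (fun n => power_series_term_le h n fc) (fun n => power_series_term_le h n gd) (Hf _ q1) (Hg _ q1).
rewrite (_ : x + h = y); last by rewrite /h addrCA subrr addr0.
rewrite (_ : (fun n => \sum_(i < n.+1) _) = (fun n => (\sum_(i < n.+1) c i * d (n - i)%N) * h ^+ n))//.
apply/funext => n; rewrite mulr_suml; apply: eq_bigr => -[i /= ni] _.
by rewrite mulrACA -exprD subnKC.
Qed.

Lemma analytic_atB f g x : analytic_at f x -> analytic_at g x -> analytic_at (fun y => f y - g y) x.
Proof.
move=> [c [r1 [r10 Hf]]] [d [r2 [r20 Hg]]].
exists (fun n => c n - d n), (Num.min r1 r2); rewrite lt_min r10 r20; split => // y.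
rewrite lt_min => /andP[y1 y2].
rewrite (_ : series _ = (fun N => series (fun n => c n * (y - x) ^+ n) N - series (fun n => d n * (y - x) ^+ n) N)).
  by apply: cvgB; [exact: Hf|exact: Hg].
by apply/funext => n; rewrite /series /= -sumrB; apply: eq_bigr => i _; rewrite mulrBl.
Qed.

Lemma eq_analytic_at f g x (e : R) : 0 < e -> (forall y, `|y - x| < e -> f y = g y) ->
  analytic_at f x -> analytic_at g x.
Proof.
move=> e0 fg [c [r [r0 H]]]; exists c, (Num.min r e); rewrite lt_min r0 e0; split => // y.
by rewrite lt_min => /andP[y1 y2]; rewrite -fg//; exact: H.
Qed.

Lemma analytic_at_cst (l x : R) : analytic_at (fun=> l) x.
Proof.
exists (fun n => if n == 0%N then l else 0), 1; split => // y _.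
apply: cvg_near_cst; exists 1%N => // -[//|N] _.
rewrite /series/= big_ltn// expr0 mulr1 big_nat_cond big1 ?addr0//.
by move=> i; rewrite andbT => /andP[i0 _]; rewrite gtn_eqF// mul0r.
Qed.

Lemma analytic_at_id x : analytic_at id x.
Proof.
exists (fun n => if n == 0%N then x else (n == 1%N)%:R), 1; split => // y _.
apply: cvg_near_cst; exists 2%N => // -[//|[//|N]] _.
rewrite /series/= big_ltn// big_ltn// expr0 mulr1 mul1r expr1 big_nat_cond big1 ?addr0.
  by rewrite addrC subrK.
by move=> i; rewrite andbT => /andP[i0 _]; rewrite !gtn_eqF ?mul0r// ltnW.
Qed.

Lemma analytic_atX (m : nat) x : analytic_at (fun y => y ^+ m) x.
Proof.
elim: m => [|m IH]; first exact: analytic_at_cst.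
have := analytic_atM (analytic_at_id x) IH.
by rewrite (_ : (fun y => id y * y ^+ m) = (fun y => y ^+ m.+1))//; apply/funext => y; rewrite exprS.
Qed.

Lemma analytic_at_shift f x (k : R) : analytic_at f (x - k) -> analytic_at (fun y => f (y - k)) x.
Proof.
move=> [c [r [r0 H]]]; exists c, r; split => // y yx.
have -> : y - x = y - k - (x - k) by ring.
by apply: H; rewrite opprB addrA subrK.
Qed.

(** A Taylor remainder of order n: n = 1 yields continuity, general n the vanishing of coefficients.
    The factor 2 bounds 1 / (1 - rho |h|). *)
Lemma power_series_lip f x c rho M h : power_series_at f x c rho M -> rho * `|h| <= 2^-1 ->
  forall n, `|f (x + h) - series (fun i => c i * h ^+ i) n| <= 2 * M * (rho * `|h|) ^+ n.
Proof.
move=> fc hr n; have M0 := power_series_bound_ge0 fc; have [r0 _ H] := fc.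
have q0 : 0 <= rho * `|h| by rewrite mulr_ge0// ltW.
have q1 : rho * `|h| < 1 by lra.
have := lim_tail_le n q0 q1 (fun n => power_series_term_le h n fc) (H _ q1).
move=> H2; rewrite (le_trans H2)// ler_pdivrMr ?subr_gt0//.
have : 0 <= M * (rho * `|h|) ^+ n by rewrite mulr_ge0// exprn_ge0.
move: ((rho * `|h|) ^+ n) => u; nra.
Qed.

Lemma power_series_at_center f x c rho M : power_series_at f x c rho M -> f x = c 0%N.
Proof.
move=> fc; have := @power_series_lip _ _ _ _ _ 0 fc; rewrite normr0 mulr0 addr0 => /(_ (ltac:(lra)) 1%N).
rewrite expr1 mulr0 /series/= big_nat1 expr0 mulr1 => h.
by apply/eqP; rewrite -subr_eq0 -normr_le0.
Qed.

Lemma analytic_at_continuous f x : analytic_at f x -> {for x, continuous f}.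
Proof.
move=> /analytic_atP[c [rho [M fc]]]; have [r0 _ _] := fc.
have M0 := power_series_bound_ge0 fc.
rewrite /prop_for /continuous_at; apply/cvgrPdist_le => e e0.
pose d := Num.min (2^-1 / rho) (e / (2 * M * rho + 1)).
have p0 : 0 < 2 * M * rho + 1 by rewrite ltr_wpDl// !mulr_ge0// ltW.
have d0 : 0 < d by rewrite lt_min !divr_gt0.
exists d => //= y yx; rewrite distrC.
have hx : `|y - x| < d by rewrite distrC.
move: hx; rewrite lt_min ltr_pdivlMr// ltr_pdivlMr// => /andP[h1 h2].
have := @power_series_lip _ _ _ _ _ (y - x) fc; rewrite addrCA subrr addr0 => /(_ (ltac:(nra)) 1%N).
rewrite /series/= big_nat1 expr0 mulr1 -(power_series_at_center fc) expr1 => h.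
by apply: (le_trans h); have := normr_ge0 (y - x); nra.
Qed.

(** Once the lower coefficients vanish, evaluating at s - t gives |c_n| t^n <= K t^(n+1) by the
    Taylor remainder; letting t tend to 0 gives c_n = 0. *)
Lemma power_series_left_zero F s c rho M (d : R) : power_series_at F s c rho M -> 0 < d ->
  (forall z, s - d < z < s -> F z = 0) -> forall n, c n = 0.
Proof.
move=> Fc d0 F0 n; have [r0 _ _] := Fc; have M0 := power_series_bound_ge0 Fc.
elim/ltn_ind: n => n IH; apply/eqP; rewrite -normr_le0.
apply/ler_addgt0Pr => e e0; rewrite add0r.
pose K := 2 * M * rho ^+ n.+1.
have K0 : 0 <= K by rewrite !mulr_ge0// exprn_ge0// ltW.
pose t := Num.min (d / 2) (Num.min (2^-1 / rho) (e / (K + 1))).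
have t0 : 0 < t by rewrite !lt_min !divr_gt0// ltr_wpDl.
have td : t < d by rewrite (@le_lt_trans _ _ (d / 2)) ?ge_min ?lexx//; lra.
have tr : t * rho <= 2^-1 by rewrite -ler_pdivlMr// !ge_min lexx orbT.
have te : t * (K + 1) <= e by rewrite -ler_pdivlMr ?ltr_wpDl// !ge_min lexx !orbT.
have := @power_series_lip _ _ _ _ _ (- t) Fc; rewrite normrN (gtr0_norm t0) mulrC => /(_ tr n.+1).
rewrite F0; last by apply/andP; split; lra.
rewrite /series/= big_nat_recr//= big_nat big1; last by move=> i /andP[_ /IH ->]; rewrite mul0r.
rewrite !add0r normrN normrM normrX normrN (gtr0_norm t0) exprMn.
have -> : 2 * M * (t ^+ n.+1 * rho ^+ n.+1) = K * t * t ^+ n by rewrite /K exprS; ring.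
rewrite ler_pM2r ?exprn_gt0// => h; apply: (le_trans h); lra.
Qed.

(** Let s be the supremum of the y <= x such that F vanishes on ]k, y[. Then F vanishes just left of
    s, so all Taylor coefficients at s are 0 and F vanishes on both sides of s; this contradicts the
    choice of s unless s = x. *)
Lemma analytic_identity F (k x : R) : analytic_on F `]k, +oo[ ->
  (forall z, k < z < k + 1 -> F z = 0) -> k + 1 <= x -> F x = 0.
Proof.
move=> aF F0 kx.
pose E := [set y | k < y <= x /\ forall z, k < z < y -> F z = 0].
have Ek : E (k + 1) by split => //; apply/andP; split => //; lra.
have Ex : ubound E x by move=> y [/andP[]].
have hE : has_sup E by split; [exists (k + 1)|exists x].
pose s := sup E.
have ks : k + 1 <= s by apply: ub_le_sup => //; exists x.
have sx : s <= x by apply: ge_sup => //; exists (k + 1).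
have Fs z : k < z < s -> F z = 0.
  move=> /andP[kz zs]; have [y [_ Ey] zy] := sup_adherent (ltac:(rewrite subr_gt0; exact: zs) : 0 < s - z) hE.
  by apply: Ey; rewrite kz/=; move: zy; rewrite -/s; lra.
have /analytic_atP[c [rho [M Fc]]] : analytic_at F s by apply: aF; rewrite /= in_itv/= andbT; lra.
have c0 : forall n, c n = 0.
  by apply: (power_series_left_zero (d := 1) Fc) => // z /andP[z1 z2]; apply: Fs; apply/andP; split; lra.
have [r0 _ H] := Fc.
have Fh h : rho * `|h| < 1 -> F (s + h) = 0.
  move=> /H Hh; apply/esym/(cvg_unique _ _ Hh) => //.
  rewrite (_ : series _ = cst 0); first exact: cvg_cst.
  by apply/funext => n; rewrite /series /= big1// => i _; rewrite c0 mul0r.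
move: sx; rewrite le_eqVlt => /orP[/eqP <-|sx].
  by rewrite -[s]addr0 Fh// normr0 mulr0.
(* Half the radius beyond s, capped at x so that y stays a candidate for the supremum. *)
exfalso; pose y := Num.min x (s + rho^-1 / 2).
have sy : s < y by rewrite lt_min sx ltrDl divr_gt0// invr_gt0.
have : y <= s; last by lra.
apply: ub_le_sup; first by exists x.
split; first by apply/andP; split; [lra|rewrite ge_min lexx].
move=> z /andP[kz zy]; have [zs|sz] := ltP z s; first by apply: Fs; rewrite kz.
rewrite -(subrK s z) addrC Fh// ger0_norm ?subr_ge0// -ltr_pdivlMl// mulr1.
move: zy; rewrite lt_min => /andP[_]; have : 0 < rho^-1 by rewrite invr_gt0.
lra.
Qed.

End analytic.

(** * Analyticity of real powers *)

Section powR_analytic.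
Context {R : realType}.
Local Notation mu := (@lebesgue_measure R).

Lemma integrable_gamma (s l : R) : 0 < s -> 0 < l -> mu.-integrable setT (EFin \o gamma_integrand s l).
Proof.
move=> s0 l0; apply: ge0_integrable (integral_gamma s0 l0); first exact: measurable_gamma_integrand.
by move=> x; exact: gamma_integrand_ge0.
Qed.

Lemma integrable_Rintegral_sum (N : nat) (f : nat -> R -> R) :
  (forall i, mu.-integrable setT (EFin \o f i)) ->
  mu.-integrable setT (EFin \o (fun x => \sum_(i < N) f i x)) /\
  \int[mu]_x (\sum_(i < N) f i x) = \sum_(i < N) \int[mu]_x f i x.
Proof.
move=> fi; elim: N => [|N [IH1 IH2]].
  rewrite big_ord0 (_ : (fun x => _) = fun=> 0); last by apply/funext => x; rewrite big_ord0.
  by split; [exact: integrable0|rewrite /Rintegral integral0].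
rewrite big_ord_recr/= -IH2 -RintegralD//.
rewrite (_ : (fun x => _) = (fun x => \sum_(i < N) f i x + f N x)); last by apply/funext => x; rewrite big_ord_recr.
by split => //; exact: (integrableD measurableT IH1 (fi N)).
Qed.

(* Expand e^(-uw) around w = v in Gamma(s) w^(-s) = int u^(s-1) e^(-uw) du. *)
Lemma analytic_at_powRN (s v : R) : 0 < s -> 0 < v -> analytic_at (fun w => w `^ (- s)) v.
Proof.
move=> s0 v0; have Gs := Gamma_gt0 s0.
pose E n u := gamma_integrand s v u * ((- u) ^+ n / n`!%:R).
exists (fun n => (Gamma s)^-1 * \int[mu]_u E n u), v; split => // w wv.
set h := w - v in wv *.
have w0 : 0 < w by move: wv; rewrite ltr_norml /h => /andP[]; lra.
have vh0 : 0 < v - `|h| by rewrite subr_gt0.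
pose K n u := gamma_integrand s v u * exp_coeff (- (u * h)) n.
have KE n u : K n u = h ^+ n * E n u.
  by rewrite /K /E /exp_coeff /= -mulNr exprMn; ring.
have mE n : measurable_fun [set: R] (E n).
  have mg := measurable_gamma_integrand s v; rewrite /E; meas.
have iE n : mu.-integrable setT (EFin \o E n).
  have sn0 : 0 < s + n%:R by rewrite ltr_wpDr.
  have i1 : mu.-integrable setT (EFin \o (fun u => ((-1) ^+ n / n`!%:R) * gamma_integrand (s + n%:R) v u)).
    exact: (integrableZl measurableT _ (integrable_gamma sn0 v0)).
  rewrite (_ : E n = fun u => ((-1) ^+ n / n`!%:R) * gamma_integrand (s + n%:R) v u)//.
  apply/funext => u; rewrite /E /gamma_integrand; case: ifP => [u0|_]; last by rewrite mul0r mulr0.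
  rewrite (exprNn u) -(powR_mulrn _ (ltW u0)) (_ : s + n%:R - 1 = s - 1 + n%:R); last by ring.
  rewrite (@powRD _ u (s - 1)); last by rewrite (gt_eqF u0) implybT.
  ring.
have iK n : mu.-integrable setT (EFin \o K n).
  rewrite (_ : K n = fun u => h ^+ n * E n u); last by apply/funext.
  exact: (integrableZl measurableT _ (iE n)).
have sE N : series (fun n => (Gamma s)^-1 * \int[mu]_u E n u * h ^+ n) N =
    (Gamma s)^-1 * \int[mu]_u (\sum_(n < N) K n u).
  rewrite (integrable_Rintegral_sum N iK).2 mulr_sumr /series /= big_mkord.
  apply: eq_bigr => n _; rewrite -mulrA; congr (_ * _); rewrite mulrC -RintegralZl//.
  by apply: eq_Rintegral => u _; rewrite KE.
(* The partial exponential sums are at most e^(u|h|), which only slows the decay rate from v to v -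
   |h| > 0; hence the radius v. *)
have dom N u : `|\sum_(n < N) K n u| <= gamma_integrand s (v - `|h|) u.
  rewrite /K -mulr_sumr; have [u0|u0] := ltP 0 u; last by rewrite /gamma_integrand ltNge u0/= mul0r normr0.
  rewrite /gamma_integrand u0 normrM ger0_norm ?mulr_ge0 ?powR_ge0 ?expR_ge0// -mulrA ler_wpM2l ?powR_ge0//.
  rewrite (_ : - ((v - `|h|) * u) = - (v * u) + u * `|h|); last by ring.
  rewrite expRD ler_wpM2l ?expR_ge0//.
  have uh : 0 <= u * `|h| by rewrite mulr_ge0// ltW.
  rewrite (le_trans _ (series_exp_coeff_le N uh))// /series /= big_mkord (le_trans (ler_norm_sum _ _ _))//.
  apply: ler_sum => n _; rewrite /exp_coeff /= normrM normfV normr_nat normrX normrN normrM.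
  by rewrite (gtr0_norm u0).
have pw u : (\sum_(n < N) K n u) @[N --> \oo] --> gamma_integrand s w u.
  have [u0|u0] := ltP 0 u; last first.
    rewrite /K /gamma_integrand ltNge u0/=; under eq_fun do rewrite -mulr_sumr mul0r; exact: cvg_cst.
  have -> : gamma_integrand s w u = gamma_integrand s v u * expR (- (u * h)).
    rewrite /gamma_integrand u0 -mulrA -expRD; congr (_ * expR _); rewrite /h; ring.
  under eq_fun do rewrite -mulr_sumr.
  apply: cvgM; first exact: cvg_cst.
  rewrite (_ : (fun N : nat => _) = series (exp_coeff (- (u * h)))); first by rewrite /expR; exact: is_cvg_series_exp_coeff.
  by apply/funext => N; rewrite /series /= big_mkord.
have mK N : measurable_fun [set: R] (fun u => \sum_(n < N) K n u).
  apply: measurable_sum => n; rewrite (_ : K n = fun u => h ^+ n * E n u); last by apply/funext.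
  by apply: measurable_funM => //; exact: measurable_cst.
have [//|||//||iwf _ H] := @dominated_convergence _ _ R mu setT measurableT
  (fun N u => (\sum_(n < N) K n u)%:E) (fun u => (gamma_integrand s w u)%:E)
  (fun u => (gamma_integrand s (v - `|h|) u)%:E).
- by move=> n; apply/measurable_EFinP; exact: mK.
- by apply/measurable_EFinP; exact: measurable_gamma_integrand.
- by apply: aeW => u _; apply: cvg_EFin; [exact: nearW|exact: pw].
- exact: integrable_gamma.
- by apply: aeW => u n _; rewrite lee_fin.
have {}H : fine (\int[mu]_u (\sum_(n < N) K n u)%:E)%E @[N --> \oo] --> \int[mu]_u (gamma_integrand s w u).
  by apply: fine_cvg; rewrite fineK//; exact: integrable_fin_num.
rewrite (_ : series _ = fun N => (Gamma s)^-1 * \int[mu]_u (\sum_(n < N) K n u)); last by apply/funext.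
rewrite (_ : w `^ (- s) = (Gamma s)^-1 * \int[mu]_u (gamma_integrand s w u)).
  by apply: cvgM; [exact: cvg_cst|exact: H].
by rewrite /Rintegral integral_gamma//= mulrA mulVf ?mul1r// gt_eqF.
Qed.

(** A monomial w^m with m > p reduces every exponent to a negative one: w^p = w^m w^(-(m-p)). *)
Lemma analytic_at_powR (p v : R) : 0 < v -> analytic_at (fun w => w `^ p) v.
Proof.
move=> v0; pose m := (Num.truncn `|p|).+1.
have pm : p < m%:R by rewrite (le_lt_trans (ler_norm _))// truncnS_gt.
have s0 : 0 < m%:R - p by rewrite subr_gt0.
apply: (eq_analytic_at v0 _ (analytic_atM (analytic_atX m v) (analytic_at_powRN s0 v0))).
move=> w; rewrite ltr_norml => /andP[h1 h2]; have w0 : 0 < w by lra.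
rewrite -(powR_mulrn _ (ltW w0)) -powRD; last by rewrite (gt_eqF w0) implybT.
by congr (_ `^ _); ring.
Qed.

End powR_analytic.

(** * Analyticity and continuity of the summands *)

Section gk_regularity.
Context {R : realType}.
Variable a : R.
Hypotheses (a_gt0 : 0 < a) (a_lt1 : a < 1).

Lemma analytic_on_gk k : analytic_on (gk a k) `]k%:R, +oo[.
Proof.
move=> x /=; rewrite in_itv/= andbT => kx; set v := x - k%:R.
have v0 : 0 < v by rewrite subr_gt0.
have aG : analytic_at (gk_coef a k 0) v.
  (* The expansion has radius 1 but is only available for w >= 0, whence the minimum with v. *)
  exists (fun n => gk_coef a k n v), (Num.min 1 v); rewrite lt_min ltr01 v0; split => // w.
  rewrite lt_min => /andP[w1 w2]; apply: (gk_coef_expansion a_gt0 a_lt1) => //; first exact: ltW.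
  by move: w2; rewrite ltr_norml => /andP[]; lra.
have := analytic_at_shift (analytic_atM (analytic_at_powR (beta_ a k - 1) v0) aG).
apply: (eq_analytic_at v0) => y; rewrite ltr_norml => /andP[h1 h2].
by rewrite gkE//; move: h1; rewrite /v; lra.
Qed.

Lemma continuous_gk k (x : R) : 0 < x -> {for x, continuous (gk a k)}.
Proof.
move=> x0; have [kx|xk|xk] := ltgtP k%:R x.
- by apply: analytic_at_continuous; apply: analytic_on_gk; rewrite /= in_itv/= kx.
- have d0 : 0 < k%:R - x by rewrite subr_gt0.
  rewrite /prop_for /continuous_at gk_eq0 ?(ltW xk)//; apply: cvg_near_cst.
  exists (k%:R - x) => //= y /=; rewrite ltr_norml => /andP[h1 h2].
  by rewrite gk_eq0//; lra.
(* At x = k, positivity of x forces k >= 1, hence beta_k > 1: the power (y - k)^(beta_k - 1) tends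
   to 0 from the right while its cofactor stays bounded. *)
rewrite -xk in x0 *.
rewrite /prop_for /continuous_at gk_eq0//.
have [M GM] := gk_coef_le a_gt0 a_lt1 k (@ltr1n R 2 : 1 < 2).
have M0 : 0 <= M by have := GM 0%N 0 (lexx 0); rewrite expr0 mulr1; apply: le_trans.
have b0 : 0 < beta_ a k - 1.
  have k1 : 1 <= k%:R :> R by rewrite ler1n; move: x0; rewrite ltr0n.
  have : 1 + a <= k%:R * (1 + a) by rewrite ler_peMl// addr_ge0 ?ltW.
  by rewrite /beta_; move: a_gt0; lra.
apply/cvgrPdist_lt => e e0.
have e1 : 0 < e / (M + 1) by rewrite divr_gt0// ltr_wpDl.
have /cvgrPdist_lt /(_ _ e1) [d /= d0 H] := powR_cvg0 b0.
exists d => //= y yd; rewrite sub0r normrN.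
have [yk|ky] := leP y k%:R; first by rewrite gk_eq0// normr0.
have w0 : 0 < y - k%:R by rewrite subr_gt0.
have := H (y - k%:R); rewrite /= sub0r normrN sub0r normrN => /(_ _ w0).
have {}yd : `|y - k%:R| < d by rewrite distrC; exact: yd.
move=> /(_ yd); rewrite (ger0_norm (powR_ge0 _ _)) ltr_pdivlMr ?ltr_wpDl// => h.
rewrite gkE// normrM (ger0_norm (powR_ge0 _ _)) (le_lt_trans _ h)// ler_wpM2l ?powR_ge0//.
by have := GM 0%N _ (ltW w0); rewrite expr0 mulr1; lra.
Qed.

End gk_regularity.

(** * The unordered sum *)

Section unordered_sum.
Context {R : realType}.

Lemma fsum_sub (I : choiceType) (S B : {fset I}) (g : I -> R) : (S `<=` B)%fset ->
  \sum_(i <- B) g i - \sum_(i <- S) g i = \sum_(i <- B) (if i \in S then 0 else g i).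
Proof.
move=> SB; have -> : \sum_(i <- S) g i = \sum_(i <- S) (if i \in S then g i else 0).
  by apply: eq_big_seq => i ->.
rewrite (big_fset_incl _ SB); last by move=> i _ /negbTE ->.
by rewrite -sumrB; apply: eq_bigr => i _; case: ifP => _; rewrite ?subrr ?subr0.
Qed.

(** Sandwiching an arbitrary finite set B between two sets of a cofinal family bounds its deviation
    by sums of absolute values over that family alone. *)
Lemma norm_fsum_sub_le (I : choiceType) (S B S' : {fset I}) (g : I -> R) :
  (S `<=` B)%fset -> (B `<=` S')%fset ->
  `|\sum_(i <- B) g i - \sum_(i <- S) g i| <= \sum_(i <- S') `|g i| - \sum_(i <- S) `|g i|.
Proof.
move=> SB BS'; apply: (@le_trans _ _ (\sum_(i <- B) `|g i| - \sum_(i <- S) `|g i|)).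
  rewrite !fsum_sub// (le_trans (ler_norm_sum _ _ _))//.
  by apply: ler_sum => i _; case: ifP => _; rewrite ?normr0.
rewrite lerD2r -subr_ge0 fsum_sub//; apply: sumr_ge0 => i _.
by case: ifP.
Qed.

Variable k : nat.
Let I := {ffun 'I_k -> nat}.

(** A tuple of total degree below M has all entries below M, so the simplex is the image of a finite
    type, over which distributivity can be applied. *)
Definition simplex_emb (M : nat) (f : {ffun 'I_k -> 'I_M}) : I := [ffun i => val (f i)].

Definition simplex (M : nat) : {fset I} :=
  seq_fset tt [seq simplex_emb f | f <- enum [pred f : {ffun 'I_k -> 'I_M} | (\sum_(i < k) f i < M)%N]].

Lemma mem_simplex M (n : I) : (n \in simplex M) = (\sum_(i < k) n i < M)%N.
Proof.
rewrite seq_fsetE; apply/mapP/idP => [[f]|nM].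
  rewrite mem_enum inE => fM ->; apply: leq_ltn_trans fM; rewrite leq_eqVlt; apply/orP; left.
  by apply/eqP; apply: eq_bigr => i _; rewrite ffunE.
have ni i : (n i < M)%N by apply: leq_ltn_trans nM; rewrite (bigD1 i)//= leq_addr.
exists [ffun i => Ordinal (ni i)]; last by apply/ffunP => i; rewrite !ffunE.
rewrite mem_enum inE; apply: leq_ltn_trans nM; rewrite leq_eqVlt; apply/orP; left.
by apply/eqP; apply: eq_bigr => i _; rewrite ffunE.
Qed.

Lemma simplex_sum M (g : I -> R) : \sum_(n <- simplex M) g n =
  \sum_(f : {ffun 'I_k -> 'I_M} | (\sum_(i < k) f i < M)%N) g (simplex_emb f).
Proof.
rewrite (perm_big [seq simplex_emb f | f <- enum [pred f : {ffun 'I_k -> 'I_M} | (\sum_(i < k) f i < M)%N]]).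
  by rewrite big_map big_enum.
apply: uniq_perm; first exact: fset_uniq.
  rewrite map_inj_uniq ?enum_uniq// => f f' /ffunP ff'; apply/ffunP => i.
  by apply: val_inj; have := ff' i; rewrite !ffunE.
by move=> n; rewrite seq_fsetE.
Qed.

(** Distributing the k-th power of the polynomial over its monomials, the functions f of total
    degree m are those that contribute to X^m. *)
Lemma conv_pow_sum (q : nat -> R) (M m : nat) : (m < M)%N ->
  \sum_(f : {ffun 'I_k -> 'I_M} | (\sum_(i < k) f i == m)%N) \prod_(i < k) q (f i) = conv_pow q k m.
Proof.
move=> mM; rewrite -(conv_powE q k mM).
have -> : (\poly_(j < M) q j) ^+ k = \prod_(i < k) \sum_(j < M) q j *: 'X^j :> {poly R}.
  by rewrite prodr_const card_ord poly_def.
rewrite bigA_distr_bigA coef_sum big_mkcond/=; apply: eq_bigr => f _.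
rewrite scaler_prod prodrXr coefZ coefXn eq_sym.
by case: eqP => _; rewrite ?mulr1 ?mulr0.
Qed.

Lemma simplex_sum_degree (q phi : nat -> R) M :
  \sum_(n <- simplex M) (\prod_(i < k) q (n i)) * phi (\sum_(i < k) n i)%N =
  \sum_(m < M) conv_pow q k m * phi m.
Proof.
rewrite simplex_sum; under eq_bigr => f _.
  under eq_bigr do rewrite ffunE; under [in phi _]eq_bigr do rewrite ffunE; over.
rewrite (eq_bigr (fun f : {ffun 'I_k -> 'I_M} => \sum_(m < M | (\sum_(i < k) f i == m)%N) (\prod_(i < k) q (f i)) * phi m)); last first.
  by move=> f fM; rewrite (big_pred1 (Ordinal fM)).
rewrite (exchange_big_dep xpredT)//=; apply: eq_bigr => m _.
rewrite -(conv_pow_sum q (ltn_ord m)) mulr_suml; apply: eq_bigl => f.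
by case: eqP => [->|]; rewrite ?ltn_ord ?andbT ?andbF.
Qed.

Variables (q phi : nat -> R) (C r l : R).
Hypotheses (q_ge0 : forall n, 0 <= q n) (r_ge0 : 0 <= r) (r_lt1 : r < 1).
Let A m := conv_pow q k m * phi m.
Hypothesis A_le : forall m, `|A m| <= C * r ^+ m.
Hypothesis A_cvg : series A @ \oo --> l.

Let t (n : I) := (\prod_(i < k) q (n i)) * phi (\sum_(i < k) n i)%N.

Let conv_pow_ge0 j m : 0 <= conv_pow q j m.
Proof. by elim: j m => [|j IH] m //=; apply: sumr_ge0 => i _; rewrite mulr_ge0. Qed.

Let sum_simplex M : \sum_(n <- simplex M) t n = series A M.
Proof. by rewrite simplex_sum_degree /series /= big_mkord. Qed.

(** As q >= 0, there is no cancellation among tuples of equal total degree, so absolute values may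
    be taken before or after grouping. *)
Let sum_simplex_norm M : \sum_(n <- simplex M) `|t n| = series (fun m => `|A m|) M.
Proof.
rewrite /series /= big_mkord.
rewrite (eq_bigr (fun n : I => (\prod_(i < k) q (n i)) * (fun m => `|phi m|) (\sum_(i < k) n i)%N)).
  rewrite (simplex_sum_degree q (fun m => `|phi m|)); apply: eq_bigr => m _.
  by rewrite /A normrM (ger0_norm (conv_pow_ge0 _ _)).
by move=> n _; rewrite /t normrM ger0_norm// prodr_ge0.
Qed.

(* Grouping by total degree: the terms are dominated by a geometric series in
   the degree, so that the simplices are cofinal up to a small error. *)
Lemma cvg_partial_sum : partial_sum t @ totally --> l.
Proof.
have FF : ProperFilter (@totally I) := totally_filter.
apply/cvgrPdist_le => e e0.
have hg : (C / (1 - r) * r ^+ M) @[M --> \oo] --> (0 : R).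
  by apply: cvg_geometric; rewrite ger0_norm.
have e2 : 0 < e / 2 by rewrite divr_gt0.
move/cvgrPdist_le : hg => /(_ _ e2)[M _ /(_ M (leqnn M))].
rewrite /= sub0r normrN => HM.
have HM2 : C * r ^+ M / (1 - r) <= e / 2 by rewrite mulrAC (le_trans (ler_norm _) HM).
exists (simplex M) => // B /= SB.
rewrite /partial_sum -(big_seq_fsetE _ B xpredT t)/=.
(* Exceeds the total degree of every tuple in B; the form M + j is that of [series_tail_le]. *)
pose M' := (M + \sum_(n <- B) (\sum_(i < k) n i).+1)%N.
have BS' : (B `<=` simplex M')%fset.
  apply/fsubsetP => n nB; rewrite mem_simplex /M' (big_fsetD1 n)//=.
  by rewrite addSn addnS ltnS addnCA leq_addr.
have h1 := norm_fsum_sub_le t SB BS'.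
rewrite sum_simplex !sum_simplex_norm in h1.
have h2 := @series_tail_le _ (fun m => `|A m|) C r M (\sum_(n <- B) (\sum_(i < k) n i).+1)%N r_ge0 r_lt1.
have {}h2 := h2 (fun n => ltac:(rewrite normr_id; exact: A_le)).
have h3 := lim_tail_le M r_ge0 r_lt1 A_le A_cvg.
rewrite -(subrK (series A M) l) -addrA (le_trans (ler_normD _ _))//.
have h4 := le_trans h1 (le_trans (ler_norm _) h2).
rewrite distrC in h4.
by rewrite (splitr e) lerD// ?(le_trans h3)// (le_trans h4).
Qed.

End unordered_sum.

(** * The power series on ]k, k+1[ as an unordered sum *)

Section gk_sum.
Context {R : realType}.
Variable a : R.
Hypotheses (a_gt0 : 0 < a) (a_lt1 : a < 1).

Lemma C_neq0 k : C_ a k != 0.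
Proof.
rewrite /C_ invr_eq0 !mulf_neq0 ?expf_neq0//.
- by rewrite gt_eqF// Gamma_gt0// subr_gt0.
- by rewrite GammaN// mulf_neq0 ?invr_eq0 ?oppr_eq0 ?gt_eqF// Gamma_gt0// subr_gt0.
- by rewrite gt_eqF// Gamma_gt0// beta__gt0.
Qed.

Lemma gk_sum k (x : R) : k%:R < x -> x < k.+1%:R ->
  partial_sum (gk_term a x (k := k)) @ totally --> gk_coef a k 0 (x - k%:R) / C_ a k.
Proof.
move=> kx xk; set w := x - k%:R.
have w0 : 0 < w by rewrite subr_gt0.
have w1 : w < 1 by rewrite /w; move: xk; rewrite -natr1; lra.
have a10 : 0 < 1 + a by rewrite addr_gt0.
have C0_neq := C_neq0 k.
(* Gives rho > 1 and rho w < 1, the latter because x < k + 1. *)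
pose rho := 2 / (1 + w).
have r1 : 1 < rho by rewrite /rho ltr_pdivlMr; lra.
have [M GM] := gk_coef_le a_gt0 a_lt1 k r1.
pose phi m := (pochhammer (beta_ a k) m)^-1 * (k%:R - x) ^+ m.
have AE m : conv_pow (pochhammer (1 + a)) k m * phi m = gk_coef a k m 0 * w ^+ m / C_ a k.
  rewrite gk_coef_at0// /phi (_ : k%:R - x = - w); last by rewrite /w opprB.
  rewrite (exprNn w); move: (conv_pow _ k m) (pochhammer _ m)^-1 => c p.
  by field.
rewrite (_ : gk_term a x (k := k) = fun n : {ffun 'I_k -> nat} => (\prod_(i < k) pochhammer (1 + a) (n i)) * phi (\sum_(i < k) n i)%N); last first.
  by apply/funext => n; rewrite /gk_term /phi mulrA.
apply: (@cvg_partial_sum _ _ _ _ (M / `|C_ a k|) (rho * w)).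
- by move=> n; rewrite /pochhammer divr_ge0// ltW// Gamma_gt0// ltr_wpDr.
- by rewrite mulr_ge0 ?(ltW w0)//; lra.
- by rewrite /rho mulrAC ltr_pdivrMr; lra.
- move=> m; rewrite AE !normrM normfV normrX (gtr0_norm w0).
  rewrite [leRHS](_ : _ = M * rho ^+ m * w ^+ m / `|C_ a k|); last by rewrite exprMn; ring.
  by rewrite ler_wpM2r ?invr_ge0// ler_wpM2r ?exprn_ge0 ?(ltW w0)// GM.
rewrite (_ : (fun m => _) = (fun m => gk_coef a k m 0 * w ^+ m / C_ a k)); last by apply/funext => m; exact: AE.
have := @gk_coef_expansion _ a a_gt0 a_lt1 k 0 w (lexx 0) (ltW w0); rewrite subr0 gtr0_norm// => /(_ w1) H.
rewrite (_ : series _ = fun N => series (fun n => gk_coef a k n 0 * w ^+ n) N / C_ a k).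
  by apply: cvgM => //; exact: cvg_cst.
by apply/funext => N; rewrite /series /= mulr_suml.
Qed.

(** Convergence is recorded next to the equality because [sum] is a limit, which has a value in any
    case. *)
Lemma gk_gk_expr k (x : R) : k%:R < x < k.+1%:R ->
  cvg (partial_sum (gk_term a x (k := k)) @ totally) /\ gk a k x = gk_expr a k x.
Proof.
move=> /andP[kx xk]; have H := gk_sum kx xk; split; first exact: cvgP H.
have -> : gk_expr a k x = C_ a k * (x - k%:R) `^ (beta_ a k - 1) * (gk_coef a k 0 (x - k%:R) / C_ a k).
  by rewrite /gk_expr; congr (_ * _); have FF : ProperFilter (@totally {ffun 'I_k -> nat}) := totally_filter; apply/cvg_lim.
have C0_neq := C_neq0 k.
by rewrite gkE//; field.
Qed.

End gk_sum.

Theorem theorem2 (R : realType) (a : R) (a_gt0 : 0 < a) (a_lt1 : a < 1)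
    (P : probability (measurableTypeR R) R) (P_DM : is_DM a P)
    (g : R -> R) (g_density : is_density P g) :
  [/\ C0 a = (Gamma (1 - a) * Gamma a)^-1,
      {ae lebesgue_measure, forall x : measurableTypeR R,
         series (fun k => gk a k x) @ \oo --> g x},
      (forall x : R, {for x, continuous g} ->
         series (fun k => gk a k x) @ \oo --> g x) &
      forall k : nat,
        [/\ (forall x : R, 0 < x -> {for x, continuous (gk a k)}),
            (forall x : R, x <= k%:R -> gk a k x = 0),
            analytic_on (gk a k) `]k%:R, +oo[,
            (forall x : R, k%:R < x < k.+1%:R ->
               cvg (partial_sum (gk_term a x (k := k)) @ totally) /\
               gk a k x = gk_expr a k x) &
            forall h : R -> R,
              analytic_continuation (gk_expr a k)
                `]k%:R, k.+1%:R[ `]k%:R, +oo[ h ->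
              forall x : R, k.+1%:R <= x -> gk a k x = h x]].
Proof.
have [g' [ig' g'0 g'g ren]] := DM_renewal a_gt0 a_lt1 P_DM g_density.
have ser := gk_series_ae a_gt0 a_lt1 ig' g'0 ren.
have serg : {ae lebesgue_measure, forall x : R, forall n : nat, x <= n%:R -> series (fun k => gk a k x) n = g x}.
  move: g'g ser; apply: filterS2; first exact: (ae_filter_ringOfSetsType lebesgue_measure).
  by move=> x <-.
have nat_ge (x : R) : x <= (Num.truncn `|x|).+1%:R.
  by rewrite (le_trans (ler_norm x))// ltW// truncnS_gt.
split; first exact: C0E.
- move: serg; apply: filterS; first exact: (ae_filter_ringOfSetsType lebesgue_measure).
  move=> x H; rewrite -(H _ (nat_ge x)); apply: gk_series_cvg => //.
- move=> x cg; pose N := (Num.truncn `|x|).+1.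
  (* N exceeds x, so to the left of x the N-th partial sum equals g almost everywhere; continuity of
     both at x turns this into equality at x. *)
  suff -> : g x = series (fun k => gk a k x) N by exact: gk_series_cvg.
  apply: (@ae_eq_cvg_left _ g (fun y => series (fun k => gk a k y) N) x).
  + by apply: cvg_at_left_filter; exact: cg.
  + rewrite /series /=; have [x0|x0] := ltP 0 x.
      apply: cvg_at_left_filter; elim: (N) => [|n IH].
        by rewrite big_geq//; under eq_fun do rewrite big_geq//; exact: cvg_cst.
      rewrite big_nat_recr//=; under eq_fun do rewrite big_nat_recr//=.
      by apply: cvgD => //; exact: continuous_gk.
    rewrite big1; last by move=> k _; rewrite gk_eq0// (le_trans x0).
    apply: cvg_near_cst; near=> y; rewrite big1// => k _; rewrite gk_eq0//.
    by rewrite (@le_trans _ _ 0)// (le_trans _ x0)// ltW.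
  + move: serg; apply: filterS; first exact: (ae_filter_ringOfSetsType lebesgue_measure).
    by move=> y H yx; rewrite H// (le_trans (ltW yx))// nat_ge.
move=> k; split.
- by move=> x x0; exact: continuous_gk.
- by move=> x xk; exact: gk_eq0.
- exact: analytic_on_gk.
- by move=> x xk; exact: gk_gk_expr.
(* The difference of [gk] and h is analytic on x > k and vanishes on ]k, k+1[, so the identity
   theorem applies. *)
- move=> h [ah he] x kx; apply/eqP; rewrite -subr_eq0; apply/eqP.
  apply: (@analytic_identity _ (fun y => gk a k y - h y) k%:R); last by rewrite natr1.
    by move=> y yk; apply: analytic_atB; [exact: analytic_on_gk|exact: ah].
  move=> z; rewrite natr1 => kz.
  by rewrite he ?(gk_gk_expr a_gt0 a_lt1 kz).2 ?subrr//= in_itv.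
Unshelve. all: by end_near. Qed.
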